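(* The following seven collections are categories of noncrossing partitions, they are generated as indicated, and they correspond, for every $n\in\mathbb N$, to the indicated quantum groups (i.e. $C_{G}(k,l)=\mathrm{span}\{T_p : p\in NC_X(k,l)\}$ for all $k,l\in\mathbb N_0$, where $G$ is the quantum group and $NC_X$ the category): (1) $\langle\emptyset\rangle=NC_2$ is the category of all noncrossing pair partitions. It corresponds to $O_n^+$. (2) $\langle p_{\rm four}\rangle$ is the category of all noncrossing partitions with all blocks of even size. It corresponds to $H_n^+$. (3) $\langle \uparrow\otimes\uparrow,\ p_{\rm four}\rangle$ is the category of all noncrossing partitions with an even number of blocks of odd size (and an arbitrary number of blocks of even size). It corresponds to $S_n'^+$. (4) $\langle\uparrow,\ p_{\rm four}\rangle=NC$ is the category of all noncrossing partitions. It corresponds to $S_n^+$. (5) $\langle\uparrow\otimes\uparrow\rangle$ is the category of all noncrossing partitions consisting of an arbitrary number of blocks of size two, each connecting one $\oplus$ with one $\ominus$, and an even number of blocks of size one. It corresponds to $B_n^{\#+}$. (6) $\langle p_{\rm pos}\rangle$ is the category of all noncrossing partitions consisting of an arbitrary number of blocks of size two and an even number of blocks of size one. It corresponds to $B_n'^+$. (7) $\langle\uparrow\rangle$ is the category of all noncrossing partitions with all blocks of size one or two. It corresponds to $B_n^+$.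
   Context: Partitions. For $k,l\in\mathbb N_0$, $P(k,l)$ is the set of set partitions of $k$ upper points $1,\dots,k$ and $l$ lower points $1',\dots,l'$ (numbered left to right; for $k=0$ primes are omitted), drawn by connecting points of the same block by lines between two horizontal rows. $NC(k,l)\subseteq P(k,l)$ is the subset of noncrossing partitions, $NC_2(k,l)$ the subset of noncrossing partitions with all blocks of size two; $P$, $NC$, $NC_2$ denote the collections over all $k,l$. A (full) category of partitions $P_X$ is a collection of subsets $P_X(k,l)\subseteq P(k,l)$, $k,l\in\mathbb N_0$, closed under: tensor product (horizontal concatenation); composition ($p\in P(k,l)$, $q\in P(l,m)$ give $pq\in P(k,m)$ by vertical concatenation, identifying the lower points of $p$ with the upper points of $q$, then removing the middle points and any components not connected to upper or lower points); involution (turning upside down); rotation (moving the leftmost upper point to the left end of the lower row without changing connections, or conversely, and likewise on the right side); and containing the unit partition $|\in P(1,1)$ (one upper point connected to one lower point) and the pair partition $\sqcap\in P(0,2)$ (two connected lower points). A category of noncrossing partitions is a category of partitions $NC_X$ with $NC_X\subseteq NC$. $\langle p_1,\dots,p_m\rangle$ is the smallest category of partitions containing $p_1,\dots,p_m$. Special partitions: $\uparrow\in P(0,1)$ is the singleton; $\uparrow\otimes\uparrow\in P(0,2)$ consists of two singletons; $p_{\rm four}\in P(0,4)$ is the four block $\{1,2,3,4\}$; $p_{\rm pos}\in P(0,4)$ is the positioner partition $\{1\},\{2,4\},\{3\}$. Labelling by $\oplus,\ominus$: the points of $p\in P(k,l)$ are labelled alternately $\oplus,\ominus,\oplus,\dots$,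 starting with $\oplus$ at the rightmost upper point, proceeding from right to left along the upper row and then from left to right along the lower row. For $p\in P(k,l)$, $T_p:(\mathbb C^n)^{\otimes k}\to(\mathbb C^n)^{\otimes l}$ is $T_p(e_{i_1}\otimes\cdots\otimes e_{i_k})=\sum_{j_1,\dots,j_l=1}^n\delta_p(i,j)\,e_{j_1}\otimes\cdots\otimes e_{j_l}$, where $\delta_p(i,j)=1$ if, after placing the indices $i$ on the upper and $j$ on the lower points, points in the same block carry equal indices, and $\delta_p(i,j)=0$ otherwise. Quantum groups. An orthogonal quantum group $G$ is given by a unital C*-algebra $A_G$ generated by self-adjoint $u_{ij}$ ($1\le i,j\le n$) with $\sum_k u_{ik}u_{jk}=\sum_k u_{ki}u_{kj}=\delta_{ij}$, such that there are homomorphisms $\Delta:A_G\to A_G\otimes A_G$, $u_{ij}\mapsto\sum_k u_{ik}\otimes u_{kj}$; $\epsilon:A_G\to\mathbb C$, $u_{ij}\mapsto\delta_{ij}$; $S:A_G\to A_G^{op}$, $u_{ij}\mapsto u_{ji}$. With $u=(u_{ij})$, its intertwiner spaces are $C_G(k,l)=\{T:(\mathbb C^n)^{\otimes k}\to(\mathbb C^n)^{\otimes l}\text{ linear} : Tu^{\otimes k}=u^{\otimes l}T\}$. A system $(u_{ij})_{1\le i,j\le n}$ of self-adjoint elements is: orthogonal if $\sum_k u_{ik}u_{jk}=\sum_k u_{ki}u_{kj}=\delta_{ij}$ for all $i,j$; cubic if orthogonal and $u_{ik}u_{jk}=u_{ki}u_{kj}=0$ whenever $i\ne j$; magic' if cubic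 and $\sum_k u_{ik}=\sum_k u_{kj}$ for all $i,j$ (put $r:=\sum_k u_{ik}$); magic if magic' and $r=1$; bistochastic$^\#$ if orthogonal and $\sum_k u_{ik}=\sum_k u_{kj}$ for all $i,j$ (put $r:=\sum_k u_{ik}$); bistochastic' if bistochastic$^\#$ and $u_{ij}r=ru_{ij}$ for all $i,j$; bistochastic if bistochastic' and $r=1$. The quantum groups $O_n^+,H_n^+,S_n'^+,S_n^+,B_n^{\#+},B_n'^+,B_n^+$ are given by the universal unital C*-algebras generated by self-adjoint $u_{ij}$, $1\le i,j\le n$, that are respectively orthogonal, cubic, magic', magic, bistochastic$^\#$, bistochastic', bistochastic. *)

(* Defs.v *)
From HB Require Import structures.
From mathcomp Require Import all_boot all_order all_algebra.

Set Implicit Arguments.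
Unset Strict Implicit.
Unset Printing Implicit Defensive.

Import Order.TTheory GRing.Theory Num.Theory.

Local Open Scope ring_scope.

(* Partitions of k upper points (inl) and l lower points (inr), both numbered
   from left to right starting at 0. *)

Notation point k l := ('I_k + 'I_l)%type.

Definition blocks (k l : nat) := {set {set point k l}}.

Definition collection := forall k l : nat, {set blocks k l}.

Definition Part : collection := fun k l => [set p | partition p [set: point k l]].

(* The number of a point when one runs from right to left along the upper row
   and then from left to right along the lower row: this is a cyclic order of
   the boundary of the diagram. *)
Definition pos k l (x : point k l) : nat :=
  match x with
  | inl a => rev_ord a
  | inr b => (k + b)%N
  end.

Definition oplus k l (x : point k l) : bool := ~~ odd (pos x).

Definition noncrossing k l (p : blocks k l) : bool :=
  [forall B in p, [forall B' in p, (B != B') ==>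
    ~~ [exists a in B, [exists b in B', [exists c in B, [exists d in B',
          (pos a < pos b < pos c)%N && (pos c < pos d)%N]]]]]].

Definition NC : collection := fun k l => [set p in Part k l | noncrossing p].

Definition one_block k l : blocks k l := [set [set: point k l]].

Definition relabel k l k' l' (f : point k l -> point k' l') (p : blocks k l) :
    blocks k' l' :=
  [set [set f x | x in B] | B : {set point k l} in p].

Definition tensor_left k l k' l' (x : point k l) : point (k + k') (l + l') :=
  match x with
  | inl a => inl (lshift k' a)
  | inr b => inr (lshift l' b)
  end.

Definition tensor_right k l k' l' (x : point k' l') : point (k + k') (l + l') :=
  match x with
  | inl a => inl (rshift k a)
  | inr b => inr (rshift l b)
  end.

Definition tensor k l k' l' (p : blocks k l) (q : blocks k' l') :
    blocks (k + k') (l + l') :=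
  relabel (@tensor_left k l k' l') p :|: relabel (@tensor_right k l k' l') q.

(* Vertical concatenation: the points of the stacked diagram are
   upper + middle + lower; two points are linked when they lie in a common
   block of p (upper and middle row) or of q (middle and lower row). *)
Notation stacked k l m := ('I_k + 'I_l + 'I_m)%type.

Definition stack_top k l m (x : point k l) : stacked k l m := inl x.

Definition stack_bottom k l m (x : point l m) : stacked k l m :=
  match x with
  | inl b => inl (inr b)
  | inr c => inr c
  end.

Definition stack_outer k l m (x : point k m) : stacked k l m :=
  match x with
  | inl a => inl (inl a)
  | inr c => inr c
  end.

Definition linked k l m (p : blocks k l) (q : blocks l m) : rel (stacked k l m) :=
  fun x y =>
    [exists B in p, (x \in stack_top m @: B) && (y \in stack_top m @: B)]
    || [exists B in q,
         (x \in @stack_bottom k l m @: B) && (y \in @stack_bottom k l m @: B)].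

Definition compose k l m (p : blocks k l) (q : blocks l m) : blocks k m :=
  equivalence_partition
    (fun x y => connect (linked p q) (stack_outer l x) (stack_outer l y))
    [set: point k m].

Definition flip k l (x : point k l) : point l k :=
  match x with
  | inl a => inr a
  | inr b => inl b
  end.

Definition involution k l (p : blocks k l) : blocks l k := relabel (@flip k l) p.

(* Rotations at the end h of a row; h is ord0 on the left and ord_max on the
   right. *)
Definition move_down k l (h : 'I_k.+1) (h' : 'I_l.+1) (x : point k.+1 l) :
    point k l.+1 :=
  match x with
  | inl a => if unlift h a is Some a' then inl a' else inr h'
  | inr b => inr (lift h' b)
  end.

Definition move_up k l (h : 'I_k.+1) (h' : 'I_l.+1) (x : point k l.+1) :
    point k.+1 l :=
  match x with
  | inl a => inl (lift h a)
  | inr b => if unlift h' b is Some b' then inr b' else inl h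
  end.

Definition rotate_left_down k l : blocks k.+1 l -> blocks k l.+1 :=
  relabel (move_down ord0 ord0).
Definition rotate_left_up k l : blocks k l.+1 -> blocks k.+1 l :=
  relabel (move_up ord0 ord0).
Definition rotate_right_down k l : blocks k.+1 l -> blocks k l.+1 :=
  relabel (move_down ord_max ord_max).
Definition rotate_right_up k l : blocks k l.+1 -> blocks k.+1 l :=
  relabel (move_up ord_max ord_max).

Definition subcollection (X Y : collection) : Prop :=
  forall k l, X k l \subset Y k l.

Record is_category (X : collection) : Prop := IsCategory {
  category_sub : subcollection X Part;
  category_tensor : forall k l k' l' (p : blocks k l) (q : blocks k' l'),
    p \in X k l -> q \in X k' l' -> tensor p q \in X (k + k')%N (l + l')%N;
  category_compose : forall k l m (p : blocks k l) (q : blocks l m),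
    p \in X k l -> q \in X l m -> compose p q \in X k m;
  category_involution : forall k l (p : blocks k l),
    p \in X k l -> involution p \in X l k;
  category_left_down : forall k l (p : blocks k.+1 l),
    p \in X k.+1 l -> rotate_left_down p \in X k l.+1;
  category_left_up : forall k l (p : blocks k l.+1),
    p \in X k l.+1 -> rotate_left_up p \in X k.+1 l;
  category_right_down : forall k l (p : blocks k.+1 l),
    p \in X k.+1 l -> rotate_right_down p \in X k l.+1;
  category_right_up : forall k l (p : blocks k l.+1),
    p \in X k l.+1 -> rotate_right_up p \in X k.+1 l;
  category_unit : one_block 1 1 \in X 1%N 1%N;
  category_pair : one_block 0 2 \in X 0%N 2%N
}.

Definition is_nc_category (X : collection) : Prop :=
  is_category X /\ subcollection X NC.

Definition diagram : Type := {kl : nat * nat & blocks kl.1 kl.2}.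

Definition diag k l (p : blocks k l) : diagram := existT _ (k, l) p.

Definition contains (X : collection) (gs : seq diagram) : Prop :=
  all (fun g : diagram => tagged g \in X (tag g).1 (tag g).2) gs.

(* X is the smallest category of partitions containing gs. *)
Definition generated_by (gs : seq diagram) (X : collection) : Prop :=
  [/\ is_category X, contains X gs
    & forall Y, is_category Y -> contains Y gs -> subcollection X Y].

Definition p_singleton : blocks 0 1 := one_block 0 1.

Definition p_double_singleton : blocks 0 2 := tensor p_singleton p_singleton.

Definition p_four : blocks 0 4 := one_block 0 4.

Definition lower4 (i : 'I_4) : point 0 4 := inr i.

Definition p_pos : blocks 0 4 :=
  [set [set lower4 (inord 0)]; [set lower4 (inord 1); lower4 (inord 3)];
       [set lower4 (inord 2)]].

Definition NC_pairs : collection := fun k l =>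
  [set p in NC k l | [forall B in p, #|B| == 2%N]].

Definition NC_even : collection := fun k l =>
  [set p in NC k l | [forall B in p, ~~ odd #|B|]].

Definition NC_evenly_many_odd : collection := fun k l =>
  [set p in NC k l | ~~ odd #|[set B in p | odd #|B| ]|].

Definition sizes_one_two k l (p : blocks k l) : bool :=
  [forall B in p, (#|B| == 1%N) || (#|B| == 2%N)].

Definition even_singletons k l (p : blocks k l) : bool :=
  ~~ odd #|[set B in p | #|B| == 1%N]|.

Definition alternating_pairs k l (p : blocks k l) : bool :=
  [forall B in p, (#|B| == 2%N) ==> (#|[set x in B | oplus x]| == 1%N)].

Definition NC_alternating : collection := fun k l =>
  [set p in NC k l
     | [&& sizes_one_two p, alternating_pairs p & even_singletons p]].

Definition NC_even_singletons : collection := fun k l =>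
  [set p in NC k l | sizes_one_two p && even_singletons p].

Definition NC_one_two : collection := fun k l =>
  [set p in NC k l | sizes_one_two p].

(* Unital C*-algebras over C (in the end R[i] with R a realType). The norm takes
   its values in C, as `|_| does in mathcomp; nonnegativity follows from the
   triangle inequality and homogeneity. The axioms are not stated over
   completeNormedModType, because the join of algType and normedModType would
   have to be declared before numDomainType, which inherits from both. *)
HB.mixin Record isCStarAlgebra (C : numClosedFieldType) A
    & GRing.Algebra C A := {
  star : A -> A;
  cnorm : A -> C;
  starK : forall x : A, star (star x) = x;
  starD : forall x y : A, star (x + y) = star x + star y;
  starZ : forall (a : C) (x : A), star (a *: x) = a^* *: star x;
  starM : forall x y : A, star (x * y) = star y * star x;
  cnormD : forall x y : A, cnorm (x + y) <= cnorm x + cnorm y;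
  cnormZ : forall (a : C) (x : A), cnorm (a *: x) = `|a| * cnorm x;
  cnorm0_eq0 : forall x : A, cnorm x = 0 -> x = 0;
  cnormM : forall x y : A, cnorm (x * y) <= cnorm x * cnorm y;
  cnorm_star : forall x : A, cnorm (star x * x) = cnorm x ^+ 2;
  cnorm_complete : forall s : nat -> A,
    (forall e : C, 0 < e -> exists N : nat, forall i j : nat,
       (N <= i)%N -> (N <= j)%N -> cnorm (s i - s j) < e) ->
    exists x : A, forall e : C, 0 < e -> exists N : nat, forall i : nat,
       (N <= i)%N -> cnorm (s i - x) < e
}.

#[short(type="cstarType")]
HB.structure Definition CStarAlgebra (C : numClosedFieldType) :=
  {A of GRing.Algebra C A & isCStarAlgebra C A}.

Section QuantumGroups.
Variable C : numClosedFieldType.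

Definition star_preserving (A B : cstarType C) (f : A -> B) : Prop :=
  forall x, f (star x) = star (f x).

(* The smallest closed unital *-subalgebra containing the u i j is A. *)
Definition generates n (A : cstarType C) (u : 'I_n -> 'I_n -> A) : Prop :=
  forall S : A -> Prop,
    (forall x, (forall e : C, 0 < e -> exists2 y, S y & cnorm (x - y) < e) ->
       S x) ->
    (forall i j, S (u i j)) -> S 1 ->
    (forall x y, S x -> S y -> S (x + y)) ->
    (forall (a : C) x, S x -> S (a *: x)) ->
    (forall x y, S x -> S y -> S (x * y)) ->
    (forall x, S x -> S (star x)) ->
    forall x, S x.

Definition relations :=
  forall (n : nat) (A : cstarType C), ('I_n -> 'I_n -> A) -> Prop.

(* A is the universal unital C*-algebra generated by elements u i j
   satisfying rel. *)
Definition is_universal (rel : relations) n (A : cstarType C)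
    (u : 'I_n -> 'I_n -> A) : Prop :=
  [/\ rel n A u, generates u
    & forall (B : cstarType C) (v : 'I_n -> 'I_n -> B), rel n B v ->
      exists f : {lrmorphism A -> B},
        star_preserving f /\ forall i j, f (u i j) = v i j].

Definition orthogonal_system : relations := fun n A u =>
  (forall i j, star (u i j) = u i j) /\
  (forall i j, \sum_k u i k * u j k = (i == j)%:R /\
               \sum_k u k i * u k j = (i == j)%:R).

Definition cubic_system : relations := fun n A u =>
  orthogonal_system u /\
  (forall i j k, i != j -> u i k * u j k = 0 /\ u k i * u k j = 0).

Definition equal_sums : relations := fun n A u =>
  forall i j, \sum_k u i k = \sum_k u k j.

Definition magic_system' : relations := fun n A u => cubic_system u /\ equal_sums u.

Definition magic_system : relations := fun n A u =>
  magic_system' u /\ forall i, \sum_k u i k = 1.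

Definition bistochastic_sharp_system : relations := fun n A u =>
  orthogonal_system u /\ equal_sums u.

Definition bistochastic_system' : relations := fun n A u =>
  bistochastic_sharp_system u /\
  forall i j a, let r := \sum_k u a k in u i j * r = r * u i j.

Definition bistochastic_system : relations := fun n A u =>
  bistochastic_system' u /\ forall i, \sum_k u i k = 1.

(* The k-th tensor power of C^n, as the space of coordinate functions on
   multi-indices; basis_vector i is e_{i_1} (x) ... (x) e_{i_k}. *)
Definition multi_index (n k : nat) := {ffun 'I_k -> 'I_n}.

Definition tensor_power (n k : nat) := {ffun multi_index n k -> C^o}.

Definition basis_vector n k (i : multi_index n k) : tensor_power n k :=
  [ffun i' => (i' == i)%:R].

Definition coef n k l (T : 'Hom(tensor_power n k, tensor_power n l))
    (j : multi_index n l) (i : multi_index n k) : C :=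
  T (basis_vector i) j.

Definition index_at n k l (i : multi_index n k) (j : multi_index n l)
    (x : point k l) : 'I_n :=
  match x with
  | inl a => i a
  | inr b => j b
  end.

Definition delta n k l (p : blocks k l) (i : multi_index n k)
    (j : multi_index n l) : bool :=
  [forall B in p, [forall x in B, [forall y in B,
     index_at i j x == index_at i j y]]].

Definition T_fun n k l (p : blocks k l) (v : tensor_power n k) :
    tensor_power n l :=
  \sum_i (v i : C) *: \sum_j (delta p i j)%:R *: basis_vector j.

Fact T_fun_is_linear n k l (p : blocks k l) : linear (@T_fun n k l p).
Proof.
move=> a v w; rewrite /T_fun scaler_sumr -big_split /=.
apply: eq_bigr => i _.
have E1 : (a *: v + w) i = (a *: v) i + w i by rewrite [LHS]ffunE.
by rewrite E1 [(a *: v) i]ffunE scalerDl scalerA.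
Qed.

HB.instance Definition _ n k l (p : blocks k l) :=
  GRing.isLinear.Build C (tensor_power n k) (tensor_power n l) _ (@T_fun n k l p)
    (@T_fun_is_linear n k l p).

Definition T_ n k l (p : blocks k l) : 'Hom(tensor_power n k, tensor_power n l) :=
  linfun (@T_fun n k l p).

Lemma T_basis_vector n k l (p : blocks k l) (i : multi_index n k) :
  T_ n p (basis_vector i) = \sum_j (delta p i j)%:R *: basis_vector j.
Proof.
rewrite lfunE /= /T_fun (bigD1 i) //= [X in _ + X]big1 => [|i' /negPf ii'].
  by rewrite addr0 ffunE eqxx scale1r.
by rewrite ffunE ii' scale0r.
Qed.

Definition upower n (A : cstarType C) (u : 'I_n -> 'I_n -> A) k
    (i j : multi_index n k) : A :=
  \prod_a u (i a) (j a).

(* The matrix identity T u^{(x) k} = u^{(x) l} T over A. *)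
Definition intertwiner n (A : cstarType C) (u : 'I_n -> 'I_n -> A) k l
    (T : 'Hom(tensor_power n k, tensor_power n l)) : Prop :=
  forall (j : multi_index n l) (i : multi_index n k),
    \sum_i' coef T j i' *: upower u i' i =
    \sum_j' coef T j' i *: upower u j j'.

(* For every n, the quantum group given by the universal C*-algebra of rel has
   the linear spans of the T_p, p in X, as its intertwiner spaces. *)
Definition corresponds_to (X : collection) (rel : relations) : Prop :=
  forall n : nat, (0 < n)%N ->
  forall (A : cstarType C) (u : 'I_n -> 'I_n -> A), is_universal rel u ->
  forall k l (T : 'Hom(tensor_power n k, tensor_power n l)),
    intertwiner u T <-> T \in <<[seq T_ n p | p in X k l]>>%VS.

End QuantumGroups.

(* Main.v *)
(* Reading a partition along the boundary of its diagram turns it into a word of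
   block labels, and a category of partitions into a set of words closed under
   renaming, disjoint concatenation, rotation and capping of two neighbours. A
   noncrossing word has a block that is an interval; removing or shrinking it gives,
   by induction, the generators of the seven categories.

   Each word [w] of length N has a vector [xi w] in the N-th tensor power of C^n,
   and T_p is [xi w] up to Frobenius reciprocity. The words whose vectors are fixed
   by an orthogonal matrix [u] are closed under the operations above, so the
   relations of each quantum group only have to be checked on generators, and the
   span of the T_p consists of intertwiners. For the converse, let P_N be the
   orthogonal projection onto the span of the [xi w], [w] of length N in the given
   class. Then u_{i1 j1} ... u_{iN jN} |-> P_N(i, j) is a state on the free
   *-algebra: its kernel intertwines the morphisms of the class, and for such kernels
   the form is a sum of squares. The GNS construction, followed by completion, yields
   a C*-algebra with a matrix [v] that satisfies the relations and whose fixed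
   vectors are spanned by the [xi w]. By universality, intertwiners of the universal
   matrix are intertwiners of [v], hence lie in the span of the T_p. *)

From HB Require Import structures.
From mathcomp Require Import generic_quotient boolp classical_sets functions.
From mathcomp Require Import all_boot all_order all_algebra reals complex.
From mathcomp Require Import zify ring lra.
Require Import Defs.

Set Implicit Arguments.
Unset Strict Implicit.
Unset Printing Implicit Defensive.

Import Order.TTheory GRing.Theory Num.Theory.

(** * Categories of partitions as classes of words *)

(** The expected answer itself defines the state: once the spans of the [xi w] are taken as
    candidates for the fixed vectors, the integral of a tensor power of the matrix has to be the
    projection onto such a span, and no duality theorem of Tannaka-Krein type is invoked. For small
    [n] the vectors [xi w] are linearly dependent, so the arguments speak of spans and orthogonal
    projections, never of a basis or of the inverse of a Gram matrix. A component removed by capping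
    contributes a factor [n], which is invertible because [n] is positive. The analysis stays
    elementary because the algebra is completed and not the space: on the semi-inner product space
    of noncommutative polynomials, the bounded operators that carry a bounded adjoint already
    satisfy the C*-identity, and only their seminorm is separated and completed. Letters act as
    contractions because the squares of the entries of a column sum to one and each square
    contributes a nonnegative form. *)

Definition subst (b a x : nat) := if x == b then a else x.

(* A partition is encoded by the word of its block labels, read along the boundary
   of the diagram from the rightmost upper point to the rightmost lower point.
   Word classes correspond to categories of partitions: [wc_rot] is rotation, and
   [wc_contract] caps two neighbouring points, which joins their blocks. *)
Record word_class (W : seq nat -> Prop) : Prop := WordClass {
  wc_map : forall (f : nat -> nat) w, {in w &, injective f} -> W w -> W (map f w);
  wc_cat : forall s t, {in s, forall x, x \notin t} -> W s -> W t -> W (s ++ t);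
  wc_rot : forall a s, W (a :: s) -> W (rcons s a);
  wc_contract : forall a b s, W [:: a, b & s] -> W (map (subst b a) s);
  wc_pair : W [:: 0; 0] }.

Lemma subst_id b a s : b \notin s -> map (subst b a) s = s.
Proof.
move=> bs; rewrite -[RHS]map_id; apply/eq_in_map => x xs.
by rewrite /subst; case: eqP => // xb; rewrite -xb xs in bs.
Qed.

Lemma subst_inj b a (s : seq nat) : a \notin s -> {in s &, injective (subst b a)}.
Proof.
move=> as_ x y xs ys; rewrite /subst.
case: (eqVneq x b) => [->|_]; case: (eqVneq y b) => [->|_] //.
  by move=> ay; move: as_; rewrite ay ys.
by move=> xa; move: as_; rewrite -xa xs.
Qed.

Definition fresh (s : seq nat) := (\max_(x <- s) x).+1.

Lemma fresh_bound s x : x \in s -> x < fresh s.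
Proof. by move=> xs; rewrite ltnS (big_rem x) //= leq_maxl. Qed.

Lemma fresh_notin s n : fresh s <= n -> n \notin s.
Proof. by move=> h; apply/negP => /fresh_bound; lia. Qed.

Section WordClass.
Variables (W : seq nat -> Prop) (HW : word_class W).

Lemma wc_catC s t : W (s ++ t) -> W (t ++ s).
Proof.
elim: s t => [|a s IHs] t; first by rewrite cats0.
by move=> /(wc_rot HW); rewrite -cats1 -catA => /IHs; rewrite -catA.
Qed.

Lemma wc_contract_at s a b t :
  W (s ++ [:: a, b & t]) -> W (map (subst b a) (s ++ t)).
Proof.
move=> /wc_catC; rewrite !cat_cons => /(wc_contract HW).
by rewrite map_cat => /wc_catC; rewrite -map_cat.
Qed.

Lemma wc_insert s1 s2 t : {in s1 ++ s2, forall x, x \notin t} ->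
  W t -> W (s1 ++ s2) -> W (s1 ++ t ++ s2).
Proof.
move=> dis Wt /wc_catC Ws; rewrite catA; apply: wc_catC; rewrite catA.
by apply: wc_cat => // x xs; apply: dis; rewrite !mem_cat orbC -mem_cat.
Qed.

Lemma wc_rename s b a : a \notin s -> W s -> W (map (subst b a) s).
Proof. by move=> /subst_inj inj; apply: wc_map. Qed.

Lemma wc_nseq m a b : W (nseq m a) -> W (nseq m b).
Proof.
move=> Wa; have -> : nseq m b = map (fun=> b) (nseq m a) by rewrite map_nseq.
by apply: wc_map => // x y /nseqP[-> _] /nseqP[-> _].
Qed.

Lemma wc_pair_at s1 s2 a : a \notin s1 ++ s2 -> W (s1 ++ s2) ->
  W (s1 ++ [:: a, a & s2]).
Proof.
move=> h Ws; apply: (@wc_insert s1 s2 [:: a; a]) => //.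
  by move=> x xs; rewrite !inE orbb; apply: contraNneq h => <-.
exact: (@wc_nseq 2 0 a (wc_pair HW)).
Qed.

(** A fresh block [c c c c] is inserted between the neighbours. Capping [a] with the first [c], and
    then the last point of the enlarged block with [b], joins all three blocks and leaves two
    adjacent points of the result. *)
Lemma wc_merge s1 a b s2 : W [:: 0; 0; 0; 0] -> W (s1 ++ [:: a, b & s2]) ->
  W (map (subst b a) s1 ++ [:: a, a & map (subst b a) s2]).
Proof.
move=> W4 Ws; pose w := s1 ++ [:: a, b & s2]; pose c := fresh w.
have cw : c \notin w by exact: fresh_notin.
have : W ((s1 ++ [:: a]) ++ [:: c; c; c; c] ++ (b :: s2)).
  apply: wc_insert; last by rewrite -catA.
    move=> x; rewrite -catA => xs; rewrite !inE !orbb.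
    by apply: contraNneq cw => <-.
  exact: (@wc_nseq 4 0 c W4).
rewrite -catA => /wc_contract_at /=.
move: cw; rewrite mem_cat !inE !negb_or => /and4P[cs1 ca cb cs2].
rewrite map_cat /= subst_id // subst_id // {1 2 3}/subst eqxx.
rewrite /subst eq_sym (negPf cb) -/(subst _ _).
rewrite -[s1 ++ _]/(s1 ++ [:: a; a] ++ [:: a, b & s2]) catA.
move=> /wc_contract_at; rewrite map_cat map_cat -catA /= {2 3}/subst.
by case: eqP => [->|].
Qed.

(** Two fresh singletons [d e] are inserted after the chosen [a], and this [a] is capped with [d].
    The other legs of its block survive, and the free point [e] takes its place. *)
Lemma wc_disconnect s1 a s2 c : W [:: 0; 1] -> c \notin s1 ++ s2 ->
  W (s1 ++ a :: s2) -> W (s1 ++ c :: s2).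
Proof.
move=> W2 cs Ws; pose w := c :: s1 ++ a :: s2; pose d := fresh w.
have : d \notin w by exact: fresh_notin.
rewrite !inE mem_cat inE !negb_or => /and4P[dc ds1 da ds2].
pose e := d.+1; have : e \notin w by apply: fresh_notin; exact: leqnSn.
rewrite !inE mem_cat inE !negb_or => /and4P[ec es1 ea es2].
have ed : e != d by rewrite /e; lia.
have : W ((s1 ++ [:: a]) ++ [:: d; e] ++ s2).
  apply: wc_insert; last by rewrite -catA.
    move=> x; rewrite !mem_cat !inE -!orbA negb_or => h.
    by apply/andP; split; apply/negP => /eqP xE; move: h; rewrite xE;
       rewrite ?(negPf ds1, negPf da, negPf ds2, negPf es1, negPf ea, negPf es2).
  have -> : [:: d; e] = map (fun x => if x == 0 then d else e) [:: 0; 1] by [].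
  apply: wc_map => // x y; rewrite !inE.
  by move=> /orP[]/eqP-> /orP[]/eqP-> //= /eqP; rewrite ?(negPf ed) // eq_sym (negPf ed).
rewrite -catA => /wc_contract_at /=.
rewrite map_cat /= subst_id // subst_id // /subst (negPf ed).
move=> /(@wc_rename _ e c); rewrite map_cat /= subst_id // subst_id //.
rewrite {1}/subst eqxx; apply.
by move: cs; rewrite !mem_cat inE !negb_or (eq_sym c e) => /andP[-> ->]; rewrite ec.
Qed.

(** Capping one leg of the pair with a neighbouring singleton leaves the other leg as a
    singleton. *)
Lemma wc_pos_double : W [:: 0; 1; 2; 1] -> W [:: 0; 1].
Proof.
move=> /(wc_rot HW)/(@wc_catC [:: 1; 2]) /= /(wc_contract HW) /=.
move=> h; have := @wc_map W HW (fun x => if x == 1 then 0 else 1) [:: 1; 2].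
apply=> // x y; rewrite !inE.
by move=> /orP[]/eqP-> /orP[]/eqP->.
Qed.

End WordClass.

(** * Noncrossing words *)

Definition nc (w : seq nat) : Prop :=
  forall a b, subseq [:: a; b; a; b] w -> a = b.

Lemma subseq_mapP (T U : eqType) (f : T -> U) (t : seq U) (s : seq T) :
  subseq t (map f s) -> exists2 t', t = map f t' & subseq t' s.
Proof.
move=> /subseqP[m sm ->]; exists (mask m s); first by rewrite map_mask.
by apply: mask_subseq.
Qed.

Lemma nc_sub s t : subseq s t -> nc t -> nc s.
Proof. by move=> st nt a b h; apply: nt (subseq_trans h st). Qed.

Lemma nc_map (f : nat -> nat) w : {in w &, injective f} -> nc w -> nc (map f w).
Proof.
move=> inj nw a b /subseq_mapP[[|x [|y [|z [|u [|? ?]]]]]] //= [-> -> E1 E2] sub.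
have h := mem_subseq sub.
have m c : c \in [:: x; y; z; u] -> c \in w by apply: h.
have xz : x = z by apply: inj; rewrite ?m // ?inE ?eqxx ?orbT.
have yu : y = u by apply: inj; rewrite ?m // ?inE ?eqxx ?orbT.
by rewrite (nw x y) // {2}xz {2}yu.
Qed.

(** A pattern [x a x a] that ends in the moved letter of the rotated word comes from a pattern
    [a x a x] that starts with it in the original one. *)
Lemma nc_rot a s : nc (a :: s) -> nc (rcons s a).
Proof.
move=> nas x y; rewrite -subseq_rev rev_rcons.
rewrite [rev [:: x; y; x; y]]/(rev _) /=; case: eqP => [ya h|_ h].
  by apply/esym/nas; rewrite /= ya eqxx -subseq_rev -ya.
apply: nas; apply: subseq_trans (subseq_cons s a).
by rewrite -subseq_rev.
Qed.

Lemma nc_rev s : nc s -> nc (rev s).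
Proof. by move=> ns a b; rewrite -subseq_rev revK => /ns. Qed.

Lemma nc_contract a b s : nc [:: a, b & s] -> nc (map (subst b a) s).
Proof.
move=> ns; have [<-|ab] := eqVneq a b.
  have h : map (subst a a) s = s.
    by rewrite -[RHS]map_id; apply: eq_map => x; rewrite /subst; case: eqP.
  by rewrite h; apply: nc_sub (suffix_subseq [:: a; b] s) ns.
have na c d : subseq [:: c; d; c; d] s -> c = d.
  by move=> h; apply: ns; apply: subseq_trans h (suffix_subseq [:: a; b] s).
(* Since [a] and [b] head the word, [c x c] in the tail extends to the pattern [x c x c] in the
   whole word. *)
have n1 c x : x = a \/ x = b -> subseq [:: c; x; c] s -> x = c.
  move=> [->|->] h; apply: ns => /=; rewrite ?eqxx.
    by case: eqP => // _; exact: cons_subseq h.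
  by rewrite (eq_sym b) (negPf ab) eqxx.
move=> p q /subseq_mapP[[|x [|y [|z [|u [|? ?]]]]]] //= [-> -> E1 E2] sub.
have c1 : subst b a x = subst b a z -> x = z \/ (x = a /\ z = b) \/ (x = b /\ z = a).
  by rewrite /subst; case: (eqVneq x b) (eqVneq z b) => [->|_] [->|_]; auto.
have c2 : subst b a y = subst b a u -> y = u \/ (y = a /\ u = b) \/ (y = b /\ u = a).
  by rewrite /subst; case: (eqVneq y b) (eqVneq u b) => [->|_] [->|_]; auto.
have sub1 : subseq [:: x; y; z] s.
  by apply: subseq_trans sub; rewrite (prefix_subseq [:: x; y; z] [:: u]).
have sub2 : subseq [:: y; z; u] s.
  by apply: subseq_trans sub; rewrite (suffix_subseq [:: x] [:: y; z; u]).
have [xz|xz] := c1 E1; have [yu|yu] := c2 E2.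
- by rewrite (na x y) // {2}xz {2}yu.
- by rewrite (n1 x y) //; [case: yu => -[]; auto|rewrite {2}xz].
- by rewrite E1 (n1 y z) //; [case: xz => -[]; auto|rewrite {2}yu].
- by rewrite /subst; case: xz => -[-> _]; case: yu => -[-> _];
    rewrite ?eqxx ?(negPf ab).
Qed.

Lemma subseq_catr (y : nat) r s t :
  y \notin s -> subseq (y :: r) (s ++ t) -> subseq (y :: r) t.
Proof.
elim: s => //= c s IHs; rewrite inE negb_or => /andP[/negPf yc ys].
by rewrite yc; apply: IHs.
Qed.

Lemma subseq_catl (y : nat) r s t :
  y \notin t -> subseq (rcons r y) (s ++ t) -> subseq (rcons r y) s.
Proof.
rewrite -mem_rev -subseq_rev rev_rcons rev_cat => yt /(subseq_catr yt).
by rewrite -rev_rcons subseq_rev.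
Qed.

Lemma nc_cat s t : {in s, forall x, x \notin t} -> nc s -> nc t -> nc (s ++ t).
Proof.
move=> dis ns nt a b h.
have [as_|as_] := boolP (a \in s); last exact: nt (subseq_catr as_ h).
have [bs|bs] := boolP (b \in s).
  exact: ns (@subseq_catl b [:: a; b; a] _ _ (dis b bs) h).
have h' : subseq [:: b; a; b] (s ++ t).
  by apply: subseq_trans h; exact: subseq_cons.
have := mem_subseq (subseq_catr bs h') (x := a).
by rewrite !inE eqxx orbT (negPf (dis a as_)) => /(_ isT).
Qed.

(* [par true x w] and [par false x w] count the occurrences of [x] in [w] at
   even and at odd positions. *)
Fixpoint par (e : bool) (x : nat) (w : seq nat) : nat :=
  if w is y :: w' then ((y == x) && e) + par (~~ e) x w' else 0.

Lemma count_par x w : count_mem x w = par true x w + par false x w.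
Proof. by elim: w => //= y w ->; case: (y == x) => /=; lia. Qed.

Lemma par_cat e x s t : par e x (s ++ t) = par e x s + par (e (+) odd (size s)) x t.
Proof.
elim: s e => [|y s IHs] e /=; first by rewrite addbF.
by rewrite IHs addnA addbN addNb.
Qed.

Lemma par_rcons e x s a :
  par e x (rcons s a) = par e x s + ((a == x) && (e (+) odd (size s))).
Proof. by rewrite -cats1 par_cat /= addn0. Qed.

Lemma par_rev e x s : par e x (rev s) = par (e (+) ~~ odd (size s)) x s.
Proof.
elim: s e => [|y s IHs] e //=; rewrite rev_cons par_rcons IHs size_rev negbK addnC.
by rewrite addbN.
Qed.

Lemma par_subst e x a b s : a != b -> par e x (map (subst b a) s) =
  if x == a then par e a s + par e b s else if x == b then 0 else par e x s.
Proof.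
move=> ab; elim: s e => [|y s IHs] e /=; first by case: ifP => //; case: ifP.
rewrite IHs /subst; case: (eqVneq y b) => [->|yb].
  case: (eqVneq x a) => xa; first by rewrite eq_sym (negPf ab); lia.
  by case: (eqVneq x b).
case: (eqVneq x a) => xa; first by rewrite xa; lia.
by case: (eqVneq x b) => // xb; rewrite xb (negPf yb).
Qed.

Lemma par_map e (f : nat -> nat) x w : {in x :: w &, injective f} ->
  par e (f x) (map f w) = par e x w.
Proof.
elim: w e => //= y w IHw e inj; rewrite IHw; last first.
  by apply: sub_in2 inj => u; rewrite !inE => /orP[]->; rewrite ?orbT.
congr ((_ && _) + _); apply/eqP/eqP => [|->] // h.
by apply: inj h; rewrite !inE eqxx ?orbT.
Qed.

Lemma par_notin e x w : x \notin w -> par e x w = 0.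
Proof.
move=> /count_memPn; rewrite count_par.
by case: e; lia.
Qed.

(* The seven categories of the theorem, on words: block sizes lie in [S], the
   number of points is even if [ev], and pairs join positions of opposite parity
   if [al]. *)
Definition wordset (S : pred nat) (ev al : bool) (w : seq nat) : Prop :=
  [/\ nc w, {in w, forall x, S (count_mem x w)}, ev -> ~~ odd (size w)
    & al -> forall x, count_mem x w = 2 -> par true x w = par false x w].

(** What the word operations demand of the sizes: capping blocks of sizes [m.+1] and [n.+1] leaves
    one of size [m + n], and capping inside a block lowers its size by two. Alternation needs an
    even number of points, so that rotation flips all parities at once and concatenation flips
    none. *)
Definition admissible (S : pred nat) (ev al : bool) : Prop :=
  [/\ S 2, forall m n, S m.+1 -> S n.+1 -> 0 < m + n -> S (m + n),
      forall m, S m.+2 -> 0 < m -> S m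
    & al -> ev /\ forall m, S m -> m <= 2].

Section Wordset.
Variables (S : pred nat) (ev al : bool) (adm : admissible S ev al).

Lemma wordset_rev w : wordset S ev al w -> wordset S ev al (rev w).
Proof.
move=> [nw Sw ew aw]; split; first exact: nc_rev.
- by move=> x; rewrite mem_rev count_rev => /Sw.
- by rewrite size_rev.
- by move=> al1 x; rewrite count_rev !par_rev => /(aw al1) E; case: (odd _); rewrite E.
Qed.

Lemma wordset_word_class : word_class (wordset S ev al).
Proof.
case: adm => S2 Sadd Ssub Sal; split.
- move=> f w inj [nw Sw ew aw]; split.
  + exact: nc_map.
  + move=> _ /mapP[x xw ->]; suff -> : count_mem (f x) (map f w) = count_mem x w.
      exact: Sw.
    rewrite !count_par !par_map //.
      by apply: sub_in2 inj => u; rewrite inE => /predU1P[->|].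
    by apply: sub_in2 inj => u; rewrite inE => /predU1P[->|].
  + by rewrite size_map.
  + move=> al1 y c2; have /mapP[x xw yE] : y \in map f w.
      by rewrite -has_pred1 has_count c2.
    have inj' : {in x :: w &, injective f}.
      by apply: sub_in2 inj => u; rewrite inE => /predU1P[->|].
    move: c2; rewrite yE count_par !par_map // -count_par; exact: aw.
- move=> s t dis [ns Ss es a_s] [nt St et a_t]; split.
  + exact: nc_cat.
  + move=> x; rewrite mem_cat count_cat => /orP[xs|xt].
      by rewrite (count_memPn (dis x xs)) addn0 Ss.
    rewrite (_ : count_mem x s = 0) ?St //; apply/count_memPn.
    by apply: contraTN xt; exact: dis.
  + by move=> ev1; rewrite size_cat oddD (negPf (es ev1)) (negPf (et ev1)).
  + move=> al1 x; rewrite !par_cat; have [ev1 _] := Sal al1.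
    rewrite (negPf (es ev1)) !addbF count_cat.
    have [xs|xs] := boolP (x \in s).
      by rewrite (count_memPn (dis x xs)) !(par_notin _ (dis x xs)) !addn0; exact: a_s.
    by rewrite (count_memPn xs) !(par_notin _ xs); exact: a_t.
- move=> a s [ns Ss es a_s]; split; first exact: nc_rot.
  + move=> x; rewrite mem_rcons -cats1 count_cat addnC => /Ss /=.
    by rewrite addn0.
  + by rewrite size_rcons.
  + move=> al1 x; have [ev1 _] := Sal al1.
    have := es ev1; have := a_s al1 x; rewrite !count_par !par_rcons /=.
    by rewrite !andbT !andbF /= negbK => + ->; case: (a == x) => /=; lia.
- move=> a b s [ns Ss es a_s]; split; first exact: nc_contract.
  + have [ab|ab] := eqVneq a b.
      have -> : map (subst b a) s = s.
        by rewrite -[RHS]map_id; apply: eq_map => x; rewrite /subst ab; case: eqP.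
      move=> x xs; have := Ss x; rewrite !inE xs !orbT /= -ab => /(_ isT).
      case: (eqVneq a x) => _; rewrite /= ?add0n // => Sx; apply: Ssub Sx _.
      by rewrite -has_count has_pred1.
    move=> x xs; rewrite count_par !par_subst //.
    have cx : 0 < count_mem x (map (subst b a) s) by rewrite -has_count has_pred1.
    move: cx; rewrite count_par !par_subst //.
    case: (eqVneq x a) => xa.
      have -> : par true a s + par true b s + (par false a s + par false b s) =
        count_mem a s + count_mem b s by rewrite !count_par; lia.
      move=> c0; apply: Sadd => //.
        by have := Ss a; rewrite /= !inE eqxx /= (eq_sym b) (negPf ab) => /(_ isT).
      by have := Ss b; rewrite /= !inE eqxx /= orbT (negPf ab) => /(_ isT).
    case: (eqVneq x b) => // xb; rewrite -count_par -has_count has_pred1 => xs'.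
    have := Ss x; rewrite /= !inE xs' !orbT /=.
    by rewrite eq_sym (negPf xa) eq_sym (negPf xb) => /(_ isT).
  + by rewrite size_map => /es /=; rewrite negbK.
  + move=> al1 x; have [ev1 le2] := Sal al1.
    have [ab|ab] := eqVneq a b.
      have -> : map (subst b a) s = s.
        by rewrite -[RHS]map_id; apply: eq_map => y; rewrite /subst ab; case: eqP.
      move: (a_s al1 x) (Ss x) => /=; rewrite -ab !inE.
      case: (eqVneq a x) => [ax|ax].
        rewrite orbT => _ /(_ isT)/le2; rewrite count_par /=; lia.
      by rewrite !andbF /=; lia.
    (* The capped legs sit at positions 0 and 1, so the surviving partners of [a] and [b], if both
       exist, again have opposite parities. *)
    have la := le2 _ (Ss a _); have lb := le2 _ (Ss b _).
    move: la lb (a_s al1 a) (a_s al1 b) (a_s al1 x).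
    rewrite /= !inE !eqxx /= (eq_sym b) (negPf ab) orbT => /(_ isT) la /(_ isT) lb.
    rewrite !count_par !par_subst //= in la lb *.
    case: (eqVneq x a) => xa; first by lia.
    case: (eqVneq x b) => xb; first by lia.
    by rewrite ?(negPf xa) ?(negPf xb) /=; lia.
- split.
  + move=> x y /mem_subseq h; have m z : z \in [:: x; y; x; y] -> z = 0.
      by move/h; rewrite !inE orbb => /eqP.
    have -> : x = 0 by apply: m; rewrite !inE eqxx.
    by apply/esym/m; rewrite !inE eqxx orbT.
  + by move=> x; rewrite !inE orbb => /eqP->.
  + by [].
  + by move=> _ [].
Qed.

End Wordset.

(** * Generation of the seven classes *)

(** Induction on the length, looking at the first letter [a]. If it does not recur it is an interval
    itself; if it recurs at once the problem passes to the tail. Otherwise the stretch up to the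
    next [a] is a shorter noncrossing word, and a block that is an interval there cannot reappear
    beyond that [a] without a crossing [a d a d]. *)
Lemma nc_interval w : nc w -> w != [::] ->
  exists s b a t, [/\ w = s ++ nseq b.+1 a ++ t, a \notin s & a \notin t].
Proof.
have [n] := ubnP (size w); elim: n w => // n IHn [|a w] //= sw nw _.
have [aw|aw] := boolP (a \in w); last first.
  by exists [::], 0, a, w; split.
have [x [y [E ax]]] : exists x y, w = x ++ a :: y /\ a \notin x.
  exists (take (index a w) w), (drop (index a w).+1 w); split.
    rewrite -[w in LHS](cat_take_drop (index a w)).
    by rewrite [drop _ w](drop_nth a) ?index_mem // nth_index.
  by apply/negP => /index_ltn; rewrite ltnn.
subst w; case: x ax nw sw aw => [|c x] ax nw sw aw /=.
  have ny : nc (a :: y) by apply: nc_sub nw; exact: subseq_cons.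
  have [[|c s] [b [d [t [/= E ds dt]]]]] := IHn (a :: y) sw ny isT.
    case: E => ad Ey; exists [::], b.+1, d, t; split=> //=.
    by rewrite ad Ey.
  by case: E ds => <- ->; exists [:: a, a & s], b, d, t; split=> //;
     move: ds; rewrite !inE orbA orbb.
have nx : nc (c :: x).
  by apply: nc_sub nw; rewrite (subseq_trans (prefix_subseq (c :: x) (a :: y))) // subseq_cons.
have sx : size (c :: x) < n by move: sw; rewrite /= size_cat /=; lia.
have [s [b [d [t [E ds dt]]]]] := IHn (c :: x) sx nx isT.
have dE : d \in c :: x by rewrite E !mem_cat inE eqxx orbT.
have da : d != a by apply: contraNneq ax => <-.
have dy : d \notin y.
  apply/negP => dy; case/eqP: da; apply/esym/nw.
  apply: (@cat_subseq _ [:: a; d] [:: a; d] (a :: c :: x) (a :: y)).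
    by apply: (@cat_subseq _ [:: a] [:: d] [:: a]); rewrite // sub1seq.
  by apply: (@cat_subseq _ [:: a] [:: d] [:: a]); rewrite // sub1seq.
exists (a :: s), b, d, (t ++ a :: y); split.
- by rewrite -cat_cons E -!catA.
- by rewrite inE negb_or da.
- by rewrite mem_cat inE !negb_or dt da.
Qed.

(** Descent on the length of the enclosed segment: a letter of multiplicity two inside has both legs
    inside, by noncrossing, and its own pair encloses less. *)
Lemma nc_innermost w x s m t : nc w -> {in w, forall z, count_mem z w <= 2} ->
  w = s ++ x :: m ++ x :: t -> exists x s m t, w = s ++ x :: m ++ x :: t /\
    {in m, forall z, count_mem z w = 1}.
Proof.
move=> nw le2; have [n] := ubnP (size m); elim: n x s m t => // n IHn x s m t sm E.
have [/allP h|] := boolP (all (fun z => count_mem z w == 1) m).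
  by exists x, s, m, t; split=> // z /h /eqP.
rewrite -has_predC => /hasP[y ym /= cy].
have yw : y \in w by rewrite E mem_cat inE mem_cat ym !orbT.
have c2 : count_mem y w = 2.
  have := le2 y yw; have : 0 < count_mem y w by rewrite -has_count has_pred1.
  by move: cy => /eqP; case: (count_mem y w) => [|[|[|?]]].
have cx : count_mem x w <= 2.
  by apply: le2; rewrite E mem_cat inE eqxx orbT.
have yx : y != x.
  apply/eqP => yx; have : 0 < count_mem y m by rewrite -has_count has_pred1.
  by move: cx; rewrite E -yx count_cat /= count_cat /= !eqxx; lia.
have subxyx : subseq [:: x; y; x] (x :: m ++ [:: x]).
  by rewrite /= eqxx; apply: (@cat_subseq _ [:: y] [:: x]); rewrite sub1seq ?inE.
case/splitPr: ym sm E subxyx => m1 m2; rewrite size_cat /= => sm E subxyx.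
have [ym1|ym1] := boolP (y \in m1).
  case/splitPr: ym1 sm E {subxyx} => m11 m12; rewrite size_cat /= => sm E.
  apply: (IHn y (s ++ x :: m11) m12 (m2 ++ x :: t)); first by lia.
  by rewrite E -!(catA, cat_cons).
have [ym2|ym2] := boolP (y \in m2).
  case/splitPr: ym2 sm E {subxyx} => m11 m12; rewrite size_cat /= => sm E.
  apply: (IHn y (s ++ x :: m1) m11 (m12 ++ x :: t)); first by lia.
  by rewrite E -!(catA, cat_cons).
have [ys|ys] := boolP (y \in s).
  case/eqP: yx; apply: nw; rewrite E.
  apply: (@cat_subseq _ [:: y] [:: x; y; x]); first by rewrite sub1seq.
  by apply: subseq_trans subxyx _; apply: cat_subseq; rewrite ?sub1seq ?inE ?eqxx.
have [yt|yt] := boolP (y \in t).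
  case/eqP: yx; apply/esym/nw; rewrite E.
  apply: subseq_trans (suffix_subseq s _); rewrite -[x :: t]cat1s catA -cat_cons.
  by apply: (@cat_subseq _ [:: x; y; x] [:: y]); rewrite ?sub1seq.
move: c2; rewrite E !count_cat /= !count_cat /= (count_memPn ys) (count_memPn yt).
by rewrite (count_memPn ym1) (count_memPn ym2) eqxx eq_sym (negPf yx).
Qed.

(** Removing two adjacent points shifts all later positions by two, so the parities behind
    alternation are kept. *)
Lemma wordset_remove2 S ev al (s t : seq nat) a b :
  a \notin s ++ t -> b \notin s ++ t ->
  wordset S ev al (s ++ [:: a, b & t]) -> wordset S ev al (s ++ t).
Proof.
move=> ast bst [nw Sw ew aw].
have cE x : x \in s ++ t -> count_mem x (s ++ [:: a, b & t]) = count_mem x (s ++ t).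
  move=> xst; rewrite !count_cat /=.
  have [ax bx] : a != x /\ b != x by split; [apply: contraNneq ast => ->|apply: contraNneq bst => ->].
  by rewrite (negPf ax) (negPf bx).
split.
- by apply: nc_sub nw; apply: cat_subseq => //; exact: (suffix_subseq [:: a; b]).
- move=> x xst; rewrite -cE //; apply: Sw; move: xst; rewrite !mem_cat !inE.
  by case/orP => ->; rewrite ?orbT.
- by move=> /ew; rewrite !size_cat /= !addnS /= negbK.
- move=> al1 x c2; have xst : x \in s ++ t by rewrite -has_pred1 has_count c2.
  have [ax bx] : a != x /\ b != x by split; [apply: contraNneq ast => ->|apply: contraNneq bst => ->].
  have := aw al1 x; rewrite cE // !par_cat /= (negPf ax) (negPf bx) /= !negbK.
  exact.
Qed.

Lemma wordset_filter S ev x w : ~~ odd (count_mem x w) -> wordset S ev false w ->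
  wordset S ev false (filter (predC1 x) w).
Proof.
move=> cx [nw Sw ew _]; split=> //.
- by apply: nc_sub nw; exact: filter_subseq.
- move=> y; rewrite mem_filter => /andP[/= yx yw].
  rewrite count_filter (eq_count (a2 := pred1 y)) ?Sw // => z /=.
  by case: eqP => // ->; rewrite yx.
- move=> /ew; rewrite size_filter -(count_predC (pred1 x)) oddD.
  by rewrite (negPf cx).
Qed.

Lemma wordset_shorten (S : pred nat) (ev : bool) (s t : seq nat) m m' a : a \notin s -> a \notin t ->
  (ev -> odd m = odd m') -> m' <= m -> (0 < m' -> S m') ->
  wordset S ev false (s ++ nseq m a ++ t) -> wordset S ev false (s ++ nseq m' a ++ t).
Proof.
move=> as_ at_ par_m le_m Sm [nw Sw ew _]; split=> //.
- apply: nc_sub nw; do 2 apply: cat_subseq => //.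
  by rewrite -(subnKC le_m) nseqD prefix_subseq.
- move=> x; have [->|xa] := eqVneq x a.
    rewrite !mem_cat (negPf as_) (negPf at_) orbF /= => h.
    rewrite !count_cat (count_memPn as_) (count_memPn at_) count_nseq /= eqxx mul1n.
    by rewrite addn0 Sm //; move: h; rewrite mem_nseq => /andP[].
  have cE k : count_mem x (s ++ nseq k a ++ t) = count_mem x (s ++ t).
    by rewrite !count_cat count_nseq /= eq_sym (negPf xa).
  have mE k : (x \in s ++ nseq k a ++ t) = (x \in s ++ t).
    by rewrite !mem_cat mem_nseq (negPf xa) andbF.
  by rewrite cE -(cE m) mE -(mE m); exact: Sw.
- move=> ev1; have := ew ev1; rewrite !size_cat !size_nseq !oddD.
  by rewrite (par_m ev1).
Qed.

Lemma admissible_pairs : admissible (pred1 2) false false.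
Proof. by split=> // [m n|m] /= /eqP[->] // /eqP[->]. Qed.

Lemma admissible_even : admissible (fun m => ~~ odd m) false false.
Proof.
split=> // [m n|m] /=; last by rewrite negbK.
by rewrite !negbK oddD => -> ->.
Qed.

Lemma admissible_all ev : admissible xpredT ev false.
Proof. by split. Qed.

Lemma admissible_le2 ev al : al ==> ev -> admissible (fun m => m <= 2) ev al.
Proof.
move=> /implyP h; split=> //; [lia|lia|move=> al1; split=> //; exact: h].
Qed.

Section Generation.
Variables (W : seq nat -> Prop) (HW : word_class W).

Let singleton := W [:: 0].
Let double_singleton := W [:: 0; 1].
Let four := W [:: 0; 0; 0; 0].
Let positioner := W [:: 0; 1; 2; 1].

Lemma wc_nil : W [::].
Proof. exact: (wc_contract HW (wc_pair HW)). Qed.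

Lemma wc_pair_interval s a t : a \notin s -> a \notin t -> W (s ++ t) ->
  W (s ++ nseq 2 a ++ t).
Proof. by move=> as_ at_; apply: wc_pair_at; rewrite // mem_cat negb_or as_. Qed.

Lemma wc_insert_single s t a : singleton -> a \notin s ++ t -> W (s ++ t) ->
  W (s ++ a :: t).
Proof.
move=> W1 ast; apply: (@wc_insert W HW s t [:: a]).
  by move=> x xst; rewrite inE; apply: contraNneq ast => <-.
exact: (@wc_nseq W HW 1 0 a W1).
Qed.

Lemma wc_insert_double s t a b : double_singleton -> a != b ->
  a \notin s ++ t -> b \notin s ++ t -> W (s ++ t) -> W (s ++ [:: a, b & t]).
Proof.
move=> W2 ab ast bst; apply: (@wc_insert W HW s t [:: a; b]).
  by move=> x xst; rewrite !inE negb_or; apply/andP; split;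
    [apply: contraNneq ast => <-|apply: contraNneq bst => <-].
have -> : [:: a; b] = map (fun x => if x == 0 then a else b) [:: 0; 1] by [].
apply: wc_map => // x y; rewrite !inE.
by move=> /orP[]/eqP-> /orP[]/eqP-> //= /eqP; rewrite ?(negPf ab) // eq_sym (negPf ab).
Qed.

(* Insert a fresh block after the last [a] and merge. *)
Lemma wc_grow m k s a t : four -> a \notin s -> a \notin t ->
  (forall c s1 s2, c \notin s1 ++ s2 -> W (s1 ++ s2) -> W (s1 ++ nseq k.+1 c ++ s2)) ->
  W (s ++ nseq m.+1 a ++ t) -> W (s ++ nseq (m + k).+2 a ++ t).
Proof.
move=> W4 as_ at_ ins; set w := s ++ _ => Ww; pose c := fresh w.
have : c \notin w by exact: fresh_notin.
rewrite !mem_cat mem_nseq !negb_or /= => /and3P[cs ca ct].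
have nE : nseq m.+1 a = rcons (nseq m a) a by elim: (m) => //= j <-.
have := ins c (s ++ nseq m.+1 a) t; rewrite -!catA => /(_ _ Ww).
rewrite !mem_cat mem_nseq !negb_or cs ca ct nE cat_rcons catA => /(_ isT).
move=> /(wc_merge HW W4); rewrite !map_cat !map_nseq {2}/subst eq_sym (negPf ca).
rewrite !subst_id // {1}/subst eqxx -catA.
rewrite (_ : nseq m a ++ _ = nseq (m + k).+2 a ++ t) //.
by rewrite -[[:: a, a & _]]/(nseq k.+2 a ++ t) catA -nseqD !addnS.
Qed.

Lemma size_ind (P : seq nat -> Prop) :
  (forall w, (forall w', size w' < size w -> P w') -> P w) -> forall w, P w.
Proof.
move=> H w; have [n] := ubnP (size w); elim: n w => // n IHn w sw.
by apply: H => w' sw'; apply: IHn; lia.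
Qed.

Lemma count_interval (s : seq nat) m a t : a \notin s -> a \notin t ->
  count_mem a (s ++ nseq m a ++ t) = m.
Proof.
move=> as_ at_; rewrite !count_cat (count_memPn as_) (count_memPn at_).
by rewrite count_nseq /= eqxx mul1n addn0.
Qed.

Lemma wordset_interval S ev al (s : seq nat) m a t :
  a \notin s -> a \notin t -> wordset S ev al (s ++ nseq m.+1 a ++ t) -> S m.+1.
Proof.
move=> as_ at_ [_ Sw _ _]; rewrite -(count_interval m.+1 as_ at_); apply: Sw.
by rewrite !mem_cat inE eqxx orbT.
Qed.

Lemma size_interval s m m' (a : nat) t : m' < m ->
  size (s ++ nseq m' a ++ t) < size (s ++ nseq m a ++ t).
Proof. by rewrite !size_cat !size_nseq; lia. Qed.

Lemma wordset_drop (S : pred nat) (ev : bool) (s t : seq nat) m a :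
  a \notin s -> a \notin t -> (ev -> ~~ odd m) ->
  wordset S ev false (s ++ nseq m a ++ t) -> wordset S ev false (s ++ t).
Proof.
move=> as_ at_ em ww; apply: (@wordset_shorten _ _ s t m 0 a) ww => //.
by move/em/negPf.
Qed.

Lemma generate_pairs w : wordset (pred1 2) false false w -> W w.
Proof.
elim/size_ind: w => w IHw ww; have [->|w0] := eqVneq w [::]; first exact: wc_nil.
have [s [b [a [t [E as_ at_]]]]] := nc_interval (let: And4 h _ _ _ := ww in h) w0.
move: ww IHw; rewrite E => ww IHw.
have /eqP[b1] := wordset_interval as_ at_ ww; rewrite b1 in ww IHw *.
apply: wc_pair_interval => //; apply: IHw; first exact: (@size_interval _ 2 0 a).
exact: (@wordset_drop _ _ _ _ 2 a) ww.
Qed.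

(** An interval block of size at least four arises from one shorter by two by inserting a fresh pair
    next to it and merging. *)
Lemma generate_even w : four -> wordset (fun m => ~~ odd m) false false w -> W w.
Proof.
move=> W4; elim/size_ind: w => w IHw ww.
have [->|w0] := eqVneq w [::]; first exact: wc_nil.
have [s [b [a [t [E as_ at_]]]]] := nc_interval (let: And4 h _ _ _ := ww in h) w0.
move: ww IHw; rewrite E => ww IHw.
have := wordset_interval as_ at_ ww; case: b => [//|[|[//|b]]] in E ww IHw * => Sb.
  apply: wc_pair_interval => //; apply: IHw; first exact: (@size_interval _ 2 0 a).
  exact: (@wordset_drop _ _ _ _ 2 a) ww.
rewrite -(addn1 b); apply: (@wc_grow b.+1) => //.
  by move=> c s1 s2 cs; apply: wc_pair_at.
apply: IHw; first by apply: size_interval; lia.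
by apply: wordset_shorten ww => //=; rewrite /= ?negbK in Sb *; lia.
Qed.

Lemma generate_all w : singleton -> four -> wordset xpredT false false w -> W w.
Proof.
move=> W1 W4; elim/size_ind: w => w IHw ww.
have [->|w0] := eqVneq w [::]; first exact: wc_nil.
have [s [b [a [t [E as_ at_]]]]] := nc_interval (let: And4 h _ _ _ := ww in h) w0.
move: ww IHw; rewrite E; case: b {E} => [|b] ww IHw.
  apply: wc_insert_single => //; first by rewrite mem_cat negb_or as_.
  apply: IHw; first exact: (@size_interval _ 1 0 a).
  exact: (@wordset_drop _ _ _ _ 1 a) ww.
rewrite -(addn0 b); apply: (@wc_grow b) => //.
  by move=> c s1 s2 cs; apply: wc_insert_single.
apply: IHw; first by apply: size_interval; lia.
exact: wordset_shorten ww.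
Qed.

Lemma generate_le2 w : singleton -> wordset (fun m => m <= 2) false false w -> W w.
Proof.
move=> W1; elim/size_ind: w => w IHw ww.
have [->|w0] := eqVneq w [::]; first exact: wc_nil.
have [s [b [a [t [E as_ at_]]]]] := nc_interval (let: And4 h _ _ _ := ww in h) w0.
move: ww IHw; rewrite E => ww IHw.
have := wordset_interval as_ at_ ww; case: b => [|[|//]] in E ww IHw * => Sb.
  apply: wc_insert_single => //; first by rewrite mem_cat negb_or as_.
  apply: IHw; first exact: (@size_interval _ 1 0 a).
  exact: (@wordset_drop _ _ _ _ 1 a) ww.
apply: wc_pair_interval => //; apply: IHw; first exact: (@size_interval _ 2 0 a).
exact: (@wordset_drop _ _ _ _ 2 a) ww.
Qed.

Lemma nc_double c w : nc (c :: w) -> nc [:: c, c & w].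
Proof.
move=> ncw x y; have [xc|xc] := eqVneq x c; last first.
  by rewrite /= !(negPf xc) => h; apply: ncw; rewrite /= (negPf xc).
rewrite -xc in ncw *; have [//|yx] := eqVneq y x; rewrite /= eqxx !(negPf yx) => h.
by apply: ncw; rewrite /= eqxx.
Qed.

(* A singleton is obtained by cutting one leg off its neighbour's block, which
   lowers the number of blocks. *)
Lemma generate_all_even w : double_singleton -> four ->
  wordset xpredT true false w -> W w.
Proof.
move=> W2 W4; have [n] := ubnP (size w + size (undup w)).
elim: n w => // n IHn w sw ww.
have [->|w0] := eqVneq w [::]; first exact: wc_nil.
have [s [b [a [t [E as_ at_]]]]] := nc_interval (let: And4 h _ _ _ := ww in h) w0.
have IH m : m < b.+1 -> odd m = odd b.+1 -> W (s ++ nseq m a ++ t).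
  move=> mb par_m; apply: IHn; last by rewrite E in ww; apply: wordset_shorten ww => //; lia.
  have := size_interval s a t mb; rewrite -E; suff : size (undup (s ++ nseq m a ++ t)) <= size (undup w) by lia.
  apply: uniq_leq_size; rewrite ?undup_uniq // => x; rewrite !mem_undup E !mem_cat !mem_nseq.
  by case/or3P => [->|/andP[_ ->]|->]; rewrite ?orbT.
move: ww; rewrite E; case: b IH E => [|[|b]] IH E ww; last first.
- rewrite -[b.+3]addn1 -[b.+2 + 1]/((b + 1).+2) ; apply: (@wc_grow b 1) => //.
    by move=> c s1 s2 cs; apply: wc_pair_at.
  by apply: IH => //=; rewrite negbK.
- by apply: wc_pair_interval => //; apply: (IH 0).
have Wset := wordset_word_class (admissible_all true).
rewrite -[_ ++ t]/([:: a] ++ t) in ww *.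
apply: (wc_catC HW); rewrite -catA; move/(wc_catC Wset): ww; rewrite -catA.
have ast : a \notin t ++ s by rewrite mem_cat negb_or at_.
have sE : size w = (size (t ++ s)).+1 by rewrite E !size_cat /=; lia.
have uE : {subset a :: t ++ s <= w}.
  by move=> x; rewrite E !inE !mem_cat inE => /or3P[]->; rewrite ?orbT.
(* The number of points is even, so the singleton has a neighbour [c]. Writing a second [c] in its
   place gives a word of the same length with one block fewer, from which [wc_disconnect] recovers
   the original. *)
case: (t ++ s) ast sE uE => [_ _ _ [_ _ /(_ isT)]//|c r] acr sE uE ww.
apply: (@wc_disconnect W HW [::] c (c :: r) a W2 acr).
apply: IHn; last first.
  case: ww => ncw _ ew _; split=> //; apply: nc_double.
  by apply: nc_sub ncw; exact: subseq_cons.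
suff : size (undup [:: c, c & r]) < size (undup w) by move: sw; rewrite sE /=; lia.
apply: (@uniq_leq_size _ (a :: undup [:: c, c & r])).
  by rewrite cons_uniq undup_uniq andbT mem_undup; move: acr; rewrite !inE orbA orbb.
move=> x; rewrite mem_undup inE mem_undup => h; apply: uE.
by move: h; rewrite !inE => /or4P[]->; rewrite ?orbT.
Qed.

Lemma count_adjacent (s t : seq nat) (x y : nat) :
  count_mem x (s ++ [:: x, y & t]) <= 1 + (x == y) ->
  count_mem y (s ++ [:: x, y & t]) <= 1 + (x == y) ->
  x \notin s ++ t /\ y \notin s ++ t.
Proof.
rewrite !count_cat /= !eqxx; case: (eqVneq x y) => [<-|_] /= cx cy;
  by split; apply/count_memPn; rewrite count_cat /=; lia.
Qed.

(* An innermost pair encloses singletons only, an even number of them when the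
   pairs are alternating. *)
Lemma adjacent_removable S ev al w : wordset S ev al w ->
  (forall m, S m -> m <= 2) -> ev -> w != [::] ->
  (exists s x y t, [/\ w = s ++ [:: x, y & t], x \notin s ++ t & y \notin s ++ t])
  \/ (~~ al /\ exists s x a t, [/\ w = s ++ [:: x, a, x & t], a != x,
         a \notin s ++ t & count_mem x w = 2]).
Proof.
move=> [ncw Sw ew aw] S2 ev1 w0.
have le2 : {in w, forall z, count_mem z w <= 2} by move=> z /Sw /S2.
have [/allP h|] := boolP (all (fun z => count_mem z w == 1) w).
  left; case: w => [|x [|y t]] // in h w0 ew {ncw Sw aw le2} *; first by move: (ew ev1).
  have [] // := @count_adjacent [::] t x y.
  - by move: (h x); rewrite inE eqxx => /(_ isT)/eqP ->.
  - by move: (h y); rewrite !inE eqxx orbT => /(_ isT)/eqP ->.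
  by move=> xt yt; exists [::], x, y, t.
rewrite -has_predC => /hasP[y yw /= cy].
have cy2 : count_mem y w = 2.
  have : 0 < count_mem y w by rewrite -has_count has_pred1.
  by move: cy (le2 y yw) => /eqP; case: (count_mem y w) => [|[|[|?]]].
have [s0 [m0 [t0 E0]]] : exists s m t, w = s ++ y :: m ++ y :: t.
  case/splitPr: yw cy2 {ncw Sw ew aw w0 le2 cy} => s r; rewrite count_cat /= eqxx => c2.
  have [yr|yr] := boolP (y \in r).
    by case/splitPr: yr c2 => m t _; exists s, m, t.
  have ys : y \in s.
    by rewrite -has_pred1 has_count; move: c2; rewrite (count_memPn yr) /=; lia.
  by case/splitPr: ys c2 => m t _; exists m, t, r; rewrite -catA.
have [x [s [m [t [E m1]]]]] := nc_innermost ncw le2 E0.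
have xw : x \in w by rewrite E mem_cat inE eqxx orbT.
have cx : count_mem x w = 2.
  by have := le2 x xw; rewrite E count_cat /= count_cat /= eqxx /=; lia.
have xm : x \notin m by apply/negP => /m1; rewrite cx.
case: m => [|a [|b m]] in E m1 xm.
- left; have [||? ?] := @count_adjacent s t x x; rewrite -?E ?cx ?eqxx //.
  by exists s, x, x, t.
- right; have ax : a != x by move: xm; rewrite inE eq_sym.
  have ast : a \notin s ++ t.
    have := m1 a (mem_head _ _); rewrite E !count_cat /= eqxx (eq_sym x) (negPf ax) => ca.
    by apply/count_memPn; rewrite count_cat /=; lia.
  split; last by exists s, x, a, t.
  (* Legs that enclose exactly one point are two positions apart, hence of equal parity, against
     alternation. *)
  apply/negP => al1; have := aw al1 x cx; have := cx.
  rewrite E count_par !par_cat /= eqxx (negPf ax) /= !negbK.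
  by case: (odd _) => /=; lia.
- have Eab : w = (s ++ [:: x]) ++ [:: a, b & m ++ x :: t] by rewrite E -catA.
  have [] := @count_adjacent (s ++ [:: x]) (m ++ x :: t) a b.
  + by rewrite -Eab m1 ?inE ?eqxx ?orbT.
  + by rewrite -Eab m1 ?inE ?eqxx ?orbT.
  + by left; exists (s ++ [:: x]), a, b, (m ++ x :: t).
Qed.

Lemma generate_alternating w : double_singleton ->
  wordset (fun m => m <= 2) true true w -> W w.
Proof.
move=> W2; elim/size_ind: w => w IHw ww.
have [->|w0] := eqVneq w [::]; first exact: wc_nil.
have [//|[s [x [y [t [E xst yst]]]]]|[//]] := adjacent_removable ww _ isT w0.
move: ww IHw; rewrite E => ww IHw.
have Wst : W (s ++ t).
  by apply: IHw; [rewrite !size_cat /=; lia|exact: wordset_remove2 ww].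
have [xy|xy] := eqVneq x y; last exact: wc_insert_double.
by rewrite -xy; exact: wc_pair_at.
Qed.

(** The case that goes beyond [generate_alternating] is a pair around one singleton [a]. Starting
    from the word without the pair, the positioner [c x d x] is inserted after [a]; capping the
    singletons [a] and [c] leaves [x d x], and [d] is renamed to [a]. *)
Lemma generate_even_singletons w : positioner ->
  wordset (fun m => m <= 2) true false w -> W w.
Proof.
move=> Wpos; have W2 := wc_pos_double HW Wpos; elim/size_ind: w => w IHw ww.
have [->|w0] := eqVneq w [::]; first exact: wc_nil.
have [//|[s [x [y [t [E xst yst]]]]]|[_ [s [x [a [t [E ax ast cx]]]]]]] :=
  adjacent_removable ww _ isT w0.
  move: ww IHw; rewrite E => ww IHw.
  have Wst : W (s ++ t).
    by apply: IHw; [rewrite !size_cat /=; lia|exact: wordset_remove2 ww].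
  have [xy|xy] := eqVneq x y; last exact: wc_insert_double.
  by rewrite -xy; exact: wc_pair_at.
have xst : x \notin s ++ t.
  by move: cx; rewrite E !count_cat /= eqxx => cx; apply/count_memPn; rewrite count_cat /=; lia.
have Wsat : W (s ++ a :: t).
  apply: IHw; first by rewrite E !size_cat /=; lia.
  rewrite (_ : s ++ a :: t = filter (predC1 x) w); last first.
    rewrite E filter_cat /= eqxx /= ax; move: xst; rewrite mem_cat negb_or => /andP[xs xt].
    congr (_ ++ _ :: _); apply/esym/all_filterP/allP => z zs /=.
      by apply: contraNneq xs => <-.
    by apply: contraNneq xt => <-.
  by apply: wordset_filter ww; rewrite cx.
pose w' := x :: s ++ a :: t; pose c := fresh w'.
have : c \notin w' by exact: fresh_notin.
rewrite !inE mem_cat inE !negb_or => /and4P[cx' cs ca ct].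
pose d := c.+1; have : d \notin w' by apply: fresh_notin; exact: leqnSn.
rewrite !inE mem_cat inE !negb_or => /and4P[dx ds da dt].
have dc : d != c by rewrite /d; lia.
have : W ((s ++ [:: a]) ++ [:: c; x; d; x] ++ t).
  apply: (wc_insert HW); last by rewrite -catA.
    move: xst; rewrite mem_cat negb_or => /andP[xs xt].
    move=> z; rewrite !mem_cat !inE -orbA => h; apply/negP.
    move=> /or4P[] /eqP zE; move: h; rewrite zE
      ?(negPf cs, negPf ca, negPf ct, negPf ds, negPf da, negPf dt, negPf xs, negPf xt) //.
      by rewrite (eq_sym x) (negPf ax).
    by rewrite (eq_sym x) (negPf ax).
  have -> : [:: c; x; d; x] =
      map (fun z => if z == 0 then c else if z == 1 then x else d) [:: 0; 1; 2; 1] by [].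
  apply: wc_map => // y z; rewrite !inE.
  by case/or4P => /eqP-> /or4P[] /eqP-> //= /eqP; rewrite ?(negPf dc) ?(negPf dx) ?(negPf cx') //
    eq_sym ?(negPf dc) ?(negPf dx) ?(negPf cx').
rewrite -catA => /(wc_contract_at HW) /=.
rewrite map_cat /= !subst_id // /subst (negPf dc) (eq_sym x) (negPf cx') => Wd.
have := @wc_rename W HW _ d a _ Wd; rewrite map_cat /= !subst_id //.
rewrite /subst eqxx (eq_sym x) (negPf dx) E; apply.
move: ast; rewrite mem_cat negb_or => /andP[as_ at_].
by rewrite mem_cat !inE !negb_or as_ at_ ax (eq_sym a) da.
Qed.

End Generation.

(** * Sums over words *)

Local Open Scope ring_scope.

Section Words.
Variable T : finType.

Fixpoint words (n : nat) : seq (seq T) :=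
  if n is n'.+1 then [seq x :: w | x <- enum T, w <- words n'] else [:: [::]].

Lemma mem_words n w : (w \in words n) = (size w == n).
Proof.
elim: n w => [|n IHn] [|x w] //=.
  by apply/allpairsP => -[[y v] [_ _ /=]].
rewrite eqSS -IHn; apply/allpairsP/idP => [[[y v] /= [_ vn [_ ->]]] //|wn].
by exists (x, w); split; rewrite ?mem_enum.
Qed.

Lemma uniq_words n : uniq (words n).
Proof.
elim: n => //= n IHn; apply: allpairs_uniq; rewrite ?enum_uniq //.
by move=> [x w] [y v] _ _ /= [-> ->].
Qed.

Variable V : nmodType.
Implicit Types F : seq T -> V.

Lemma big_words0 F : \sum_(w <- words 0) F w = F [::].
Proof. by rewrite big_seq1. Qed.

Lemma big_wordsS n F :
  \sum_(w <- words n.+1) F w = \sum_x \sum_(w <- words n) F (x :: w).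
Proof. by rewrite [LHS]big_allpairs_dep big_enum. Qed.

Lemma big_words_cat m n F : \sum_(w <- words (m + n)) F w =
  \sum_(u <- words m) \sum_(v <- words n) F (u ++ v).
Proof.
elim: m F => [|m IHm] F; first by rewrite big_words0.
by rewrite addSn !big_wordsS; apply: eq_bigr => x _; rewrite IHm.
Qed.

Lemma big_words_rev n F : \sum_(w <- words n) F w = \sum_(w <- words n) F (rev w).
Proof.
rewrite -(big_map rev xpredT); apply: perm_big; apply: uniq_perm.
- exact: uniq_words.
- by rewrite map_inj_uniq ?uniq_words //; exact: inv_inj revK.
- move=> w; rewrite mem_words; apply/idP/mapP => [wn|[v + ->]].
    by exists (rev w); rewrite ?revK // mem_words size_rev.
  by rewrite mem_words size_rev.
Qed.

Lemma eq_big_words n F G : (forall w, size w = n -> F w = G w) ->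
  \sum_(w <- words n) F w = \sum_(w <- words n) G w.
Proof.
by move=> FG; apply: eq_big_seq => w; rewrite mem_words => /eqP; exact: FG.
Qed.

Fixpoint upto (n : nat) : seq (seq T) :=
  if n is n'.+1 then upto n' ++ words n' else [::].

Lemma mem_upto n w : (w \in upto n) = (size w < n)%N.
Proof.
elim: n => //= n IHn; rewrite mem_cat IHn mem_words [RHS]ltnS [RHS]leq_eqVlt.
by rewrite orbC.
Qed.

Lemma uniq_upto n : uniq (upto n).
Proof.
elim: n => //= n IHn; rewrite cat_uniq IHn uniq_words andbT /=.
by apply/hasPn => w; rewrite mem_words mem_upto => /eqP->; rewrite ltnn.
Qed.

Lemma big_upto n F : \sum_(w <- upto n) F w = \sum_(m < n) \sum_(w <- words m) F w.
Proof.
by elim: n => [|n IHn] /=; rewrite ?big_ord0 ?big_nil // big_cat IHn big_ord_recr.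
Qed.

Lemma big_upto_widen m n F : (m <= n)%N ->
  (forall w, (m <= size w)%N -> F w = 0) ->
  \sum_(w <- upto n) F w = \sum_(w <- upto m) F w.
Proof.
move=> mn F0; rewrite -(subnKC mn); elim: (n - m)%N => [|k IHk]; first by rewrite addn0.
rewrite addnS /= big_cat /= IHk [X in _ + X]big_seq [X in _ + X]big1 ?addr0 // => w.
by rewrite mem_words => /eqP sw; apply: F0; rewrite sw leq_addr.
Qed.

End Words.

Lemma big_words_zip (T U : finType) (V : nmodType) n (F : seq T -> seq U -> V) :
  \sum_(x <- words (T * U)%type n) F (unzip1 x) (unzip2 x) =
  \sum_(I <- words T n) \sum_(J <- words U n) F I J.
Proof.
elim: n F => [|n IHn] F; first by rewrite !big_words0.
rewrite !big_wordsS.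
transitivity (\sum_i \sum_j \sum_(I <- words T n) \sum_(J <- words U n) F (i :: I) (j :: J)).
  rewrite pair_bigA; apply: eq_bigr => -[i j] _ /=.
  exact: (IHn (fun I J => F (i :: I) (j :: J))).
apply: eq_bigr => i _; rewrite exchange_big; apply: eq_bigr => I _.
by rewrite big_wordsS.
Qed.

(** * Completion of C*-seminorms *)

Section RealLimits.
Variable R : realType.
Implicit Types (a b : nat -> R) (l m : R).

Definition tends a l : Prop :=
  forall e : R, 0 < e -> exists N, forall i, (N <= i)%N -> `|a i - l| < e.

Lemma tends_le a b l m : (forall i, a i <= b i) -> tends a l -> tends b m -> l <= m.
Proof.
move=> ab al bm; rewrite leNgt; apply/negP => ml.
have e0 : 0 < (l - m) / 2 by lra.
have [N hN] := al _ e0; have [M hM] := bm _ e0.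
have := hN (maxn N M) (leq_maxl _ _); have := hM (maxn N M) (leq_maxr _ _).
have := ab (maxn N M); rewrite !ltr_distlC => h /andP[h1 _] /andP[_ h2]; lra.
Qed.

Lemma tends_uniq a l m : tends a l -> tends a m -> l = m.
Proof.
by move=> al am; apply/eqP; rewrite eq_le !(tends_le (a := a) (b := a)).
Qed.

Lemma tends_cst l : tends (fun=> l) l.
Proof. by move=> e e0; exists 0 => i _; rewrite subrr normr0. Qed.

Lemma tendsD a b l m : tends a l -> tends b m -> tends (fun i => a i + b i) (l + m).
Proof.
move=> al bm e e0; have e2 : 0 < e / 2 by lra.
have [N hN] := al _ e2; have [M hM] := bm _ e2.
exists (maxn N M) => i; rewrite geq_max => /andP[/hN h1 /hM h2].
have -> : a i + b i - (l + m) = (a i - l) + (b i - m) by ring.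
by apply: le_lt_trans (ler_normD _ _) _; lra.
Qed.

Lemma tendsM a b l m : tends a l -> tends b m -> tends (fun i => a i * b i) (l * m).
Proof.
move=> al bm e e0.
pose K := `|l| + `|m| + 1; have K0 : 0 < K.
  by rewrite /K; have := normr_ge0 l; have := normr_ge0 m; lra.
have d0 : 0 < Num.min 1 (e / (2 * K)) by rewrite lt_min ltr01 divr_gt0 ?mulr_gt0.
have [N hN] := al _ d0; have [M hM] := bm _ d0.
exists (maxn N M) => i; rewrite geq_max => /andP[/hN h1 /hM h2].
move: h1 h2; rewrite !lt_min => /andP[_ h1] /andP[h2 h3].
have -> : a i * b i - l * m = (a i - l) * b i + l * (b i - m) by ring.
apply: le_lt_trans (ler_normD _ _) _; rewrite !normrM.
have bK : `|b i| <= K.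
  have -> : b i = (b i - m) + m by ring.
  by apply: le_trans (ler_normD _ _) _; rewrite /K; have := normr_ge0 l; lra.
have lK : `|l| <= K by rewrite /K; have := normr_ge0 m; lra.
have eE : e = e / (2 * K) * K + K * (e / (2 * K)) by field; lra.
rewrite [X in _ < X]eE.
have := normr_ge0 (a i - l); have := normr_ge0 (b i - m).
have := normr_ge0 (b i); have := normr_ge0 l.
set x := `|a i - l| in h1 *; set y := `|b i - m| in h3 *.
set d := e / _ in h1 h3 *; move=> l0 b0 y0 x0.
apply: ltr_leD; last by apply: ler_pM => //; apply: ltW.
apply: le_lt_trans (_ : x * K < _); first by rewrite ler_wpM2l.
by rewrite ltr_pM2r.
Qed.

(** The limit is the supremum of the numbers that are eventually lower bounds of the sequence. *)
Lemma cauchy_tends a :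
  (forall e : R, 0 < e -> exists N, forall i j, (N <= i)%N -> (N <= j)%N -> `|a i - a j| < e) ->
  exists l, tends a l.
Proof.
move=> ca; pose E := [set r : R | exists N, forall i, (N <= i)%N -> r <= a i]%classic.
have [N0 h0] := ca 1 ltr01.
have E0 : (E !=set0)%classic.
  exists (a N0 - 1); exists N0 => i Ni; have := h0 _ _ Ni (leqnn _).
  by rewrite ltr_distlC => /andP[]; lra.
have Eub : has_ubound E.
  exists (a N0 + 1) => r [N hN]; apply: le_trans (hN _ (leq_maxl N N0)) _.
  by have := h0 _ _ (leq_maxr N N0) (leqnn _); rewrite ltr_distlC => /andP[]; lra.
exists (sup E) => e e0; have e2 : 0 < e / 2 by lra.
have [N hN] := ca _ e2; exists N => i Ni.
have h1 : a i - e / 2 <= sup E.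
  apply: ub_le_sup => //; exists N => j Nj.
  by have := hN _ _ Ni Nj; rewrite ltr_distlC => /andP[]; lra.
have h2 : sup E <= a i + e / 2.
  apply: ge_sup => // r [M hM]; apply: le_trans (hM _ (leq_maxr N M)) _.
  by have := hN _ _ Ni (leq_maxl N M); rewrite ltr_distlC => /andP[]; lra.
by rewrite ltr_distlC; lra.
Qed.

End RealLimits.

Local Open Scope quotient_scope.

(** The modulus as an element of [R]: the norm of [R[i]] takes complex values, whereas limits,
    infima and square roots are formed in [R]. *)
Definition rnorm (R : realType) (z : R[i]) : R := complex.Re `|z|.

Lemma rnormE (R : realType) (z : R[i]) : `|z| = (rnorm z)%:C%C.
Proof. by rewrite /rnorm RRe_real // normr_real. Qed.

Lemma rnorm_ge0 (R : realType) (z : R[i]) : 0 <= rnorm z.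
Proof. by rewrite -lecR -rnormE normr_ge0. Qed.

(** A seminorm with a possibly large kernel, which the completion divides out; [seminorm1] ensures
    that the quotient is not the zero ring. *)
Record cstar_seminorm (R : realType) (A : algType R[i]) (st : A -> A) (p : A -> R) :
    Prop := CStarSeminorm {
  seminorm_starK : involutive st;
  seminorm_starD : {morph st : x y / x + y};
  seminorm_starZ : forall a x, st (a *: x) = a^* *: st x;
  seminorm_starM : forall x y, st (x * y) = st y * st x;
  seminormD : forall x y, p (x + y) <= p x + p y;
  seminormZ : forall a x, p (a *: x) = rnorm a * p x;
  seminormM : forall x y, p (x * y) <= p x * p y;
  seminorm_star : forall x, p (st x * x) = p x ^+ 2;
  seminorm1 : p 1 = 1 }.

Section Completion.
Variables (R : realType) (A : algType R[i]) (st : A -> A) (p : A -> R).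
Hypothesis Hp : cstar_seminorm st p.
Implicit Types (s t u v : nat -> A).

Lemma rnorm0 : rnorm (0 : R[i]) = 0.
Proof. by rewrite /rnorm normr0. Qed.

Lemma rnormN1 : rnorm (- 1 : R[i]) = 1.
Proof. by rewrite /rnorm normrN1. Qed.

Lemma p0 : p 0 = 0.
Proof. by have := seminormZ Hp 0 0; rewrite scale0r rnorm0 mul0r. Qed.

Lemma pN x : p (- x) = p x.
Proof. by rewrite -scaleN1r (seminormZ Hp) rnormN1 mul1r. Qed.

Lemma p_ge0 x : 0 <= p x.
Proof. by have := seminormD Hp x (- x); rewrite subrr p0 pN; lra. Qed.

Lemma p_sub_sym x y : p (x - y) = p (y - x).
Proof. by rewrite -pN opprB. Qed.

Lemma p_dist x y : `|p x - p y| <= p (x - y).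
Proof.
have := seminormD Hp (x - y) y; have := seminormD Hp (y - x) x.
by rewrite !subrK ler_distl (p_sub_sym y x) => *; apply/andP; split; lra.
Qed.

Lemma p_st_le x : p x <= p (st x).
Proof.
have [->|px] := eqVneq (p x) 0; first exact: p_ge0.
have p_gt0 : 0 < p x by rewrite lt_def px p_ge0.
have := seminormM Hp (st x) x; rewrite (seminorm_star Hp) expr2.
by rewrite ler_pM2r.
Qed.

Lemma p_st x : p (st x) = p x.
Proof.
by apply/eqP; rewrite eq_le p_st_le andbT -[X in _ <= p X](seminorm_starK Hp) p_st_le.
Qed.

Lemma stN x : st (- x) = - st x.
Proof. by rewrite -scaleN1r (seminorm_starZ Hp) rmorphN1 scaleN1r. Qed.

Definition cau s : Prop :=
  forall e : R, 0 < e -> exists N, forall i j, (N <= i)%N -> (N <= j)%N -> p (s i - s j) < e.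

Definition null s : Prop :=
  forall e : R, 0 < e -> exists N, forall i, (N <= i)%N -> p (s i) < e.

Lemma null_le s t : (forall i, p (s i) <= p (t i)) -> null t -> null s.
Proof. by move=> st_ nt e /nt[N hN]; exists N => i /hN; apply: le_lt_trans. Qed.

Lemma nullD s t : null s -> null t -> null (fun i => s i + t i).
Proof.
move=> ns nt e e0; have e2 : 0 < e / 2 by lra.
have [N hN] := ns _ e2; have [M hM] := nt _ e2.
exists (maxn N M) => i; rewrite geq_max => /andP[/hN h1 /hM h2].
by apply: le_lt_trans (seminormD Hp _ _) _; lra.
Qed.

Lemma null_bound s t (K : R) N : (forall i, (N <= i)%N -> p (s i) <= K * p (t i)) ->
  null t -> null s.
Proof.
(* [K] may fail to be positive, so it is replaced by a positive bound before dividing. *)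
move=> st_ nt e e0; pose K' := Num.max K 1.
have K0 : 0 < K' by rewrite lt_max ltr01 orbT.
have [M hM] := nt _ (divr_gt0 e0 K0).
exists (maxn N M) => i; rewrite geq_max => /andP[/st_ h1 /hM h2].
apply: le_lt_trans h1 _; apply: le_lt_trans (_ : K' * p (t i) < _).
  by rewrite ler_wpM2r ?p_ge0 // le_max lexx.
by move: h2; rewrite ltr_pdivlMr // mulrC.
Qed.

Lemma cau_bounded s : cau s -> exists K N, forall i, (N <= i)%N -> p (s i) <= K.
Proof.
move=> /(_ 1 ltr01)[N hN]; exists (p (s N) + 1), N => i /hN/(_ (leqnn _)).
have := seminormD Hp (s i - s N) (s N); rewrite subrK; lra.
Qed.

Lemma nullMl s t : cau s -> null t -> null (fun i => s i * t i).
Proof.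
move=> /cau_bounded[K [N hN]] nt; apply: (@null_bound _ t K N) => // i /hN h.
by apply: le_trans (seminormM Hp _ _) _; rewrite ler_wpM2r ?p_ge0.
Qed.

Lemma nullMr s t : null s -> cau t -> null (fun i => s i * t i).
Proof.
move=> ns /cau_bounded[K [N hN]]; apply: (@null_bound _ s K N) => // i /hN h.
by apply: le_trans (seminormM Hp _ _) _; rewrite mulrC ler_wpM2r ?p_ge0.
Qed.

Lemma cau_cst x : cau (fun=> x).
Proof. by move=> e e0; exists 0 => i j _ _; rewrite subrr p0. Qed.

Lemma cauD s t : cau s -> cau t -> cau (fun i => s i + t i).
Proof.
move=> cs ct e e0; have e2 : 0 < e / 2 by lra.
have [N hN] := cs _ e2; have [M hM] := ct _ e2.
exists (maxn N M) => i j; rewrite !geq_max => /andP[Ni Mi] /andP[Nj Mj].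
have := hN _ _ Ni Nj; have := hM _ _ Mi Mj; rewrite opprD addrACA.
by have := seminormD Hp (s i - s j) (t i - t j); lra.
Qed.

Lemma cauN s : cau s -> cau (fun i => - s i).
Proof.
by move=> cs e /cs[N hN]; exists N => i j Ni Nj; rewrite -opprD pN; exact: hN.
Qed.

Lemma cau_st s : cau s -> cau (fun i => st (s i)).
Proof.
move=> cs e /cs[N hN]; exists N => i j Ni Nj.
by rewrite -stN -(seminorm_starD Hp) p_st; exact: hN.
Qed.

Lemma cauM s t : cau s -> cau t -> cau (fun i => s i * t i).
Proof.
move=> cs ct e e0.
have [K [N hN]] := cau_bounded cs; have [K' [N' hN']] := cau_bounded ct.
pose L := Num.max (Num.max K K') 1.
have L0 : 0 < L by rewrite lt_max ltr01 orbT.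
have e2 : 0 < e / (2 * L) by rewrite divr_gt0 // mulr_gt0.
have [M hM] := cs _ e2; have [M' hM'] := ct _ e2.
exists (maxn (maxn N N') (maxn M M')) => i j; rewrite !geq_max.
move=> /andP[/andP[Ni N'i] /andP[Mi M'i]] /andP[/andP[Nj N'j] /andP[Mj M'j]].
have -> : s i * t i - s j * t j = (s i - s j) * t i + s j * (t i - t j).
  by rewrite mulrBl mulrBr addrA subrK.
apply: le_lt_trans (seminormD Hp _ _) _.
have eE : e = e / (2 * L) * L + L * (e / (2 * L)) by field; lra.
rewrite [X in _ < X]eE; apply: ltr_leD.
  apply: le_lt_trans (seminormM Hp _ _) _.
  apply: le_lt_trans (_ : p (s i - s j) * L < _); last by rewrite ltr_pM2r // hM.
  by rewrite ler_wpM2l ?p_ge0 // (le_trans (hN' _ N'i)) // !le_max lexx orbT.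
apply: le_trans (seminormM Hp _ _) _; apply: ler_pM; rewrite ?p_ge0 //.
  by rewrite (le_trans (hN _ Nj)) // !le_max lexx.
by apply: ltW; apply: hM'.
Qed.

Lemma cauZ (a : R[i]) s : cau s -> cau (fun i => a *: s i).
Proof.
move=> cs; have := cauM (cau_cst (a *: 1)) cs.
suff -> : (fun i => a *: 1 * s i) = (fun i => a *: s i) by [].
by apply/funext => i; rewrite -scalerAl mul1r.
Qed.

Record cseq := CSeq { cseq_val :> nat -> A; cseqP : cau cseq_val }.

HB.instance Definition _ := gen_eqMixin cseq.
HB.instance Definition _ := gen_choiceMixin cseq.

Lemma cseq_ext (s t : cseq) : s =1 t -> s = t.
Proof.
case: s t => [s cs] [t ct] /= /funext E; subst t.
by congr CSeq; exact: Prop_irrelevance.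
Qed.

Definition ceq (s t : cseq) : bool := `[< null (fun i => s i - t i) >].

Lemma ceq_equiv : equiv_class_of ceq.
Proof.
split.
- by move=> s; apply/asboolP => e e0; exists 0 => i _; rewrite subrr p0.
- move=> s t; apply/asboolP/asboolP => h; apply: null_le h => i;
    by rewrite p_sub_sym.
- move=> t s u /asboolP st_ /asboolP tu; apply/asboolP.
  by apply: null_le (nullD st_ tu) => i; rewrite addrA subrK.
Qed.

Canonical ceq_rel := EquivRelPack ceq_equiv.

Definition completion := {eq_quot ceq_rel}.

HB.instance Definition _ := Choice.on completion.

Definition cls (s : cseq) : completion := \pi_completion s.

Lemma clsP (s t : cseq) : cls s = cls t <-> null (fun i => s i - t i).
Proof.
split=> [/eqquotP/asboolP //|h]; apply/eqquotP; exact/asboolP.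
Qed.

Lemma cls_ext (s t : cseq) : s =1 t -> cls s = cls t.
Proof. by move=> /cseq_ext ->. Qed.

Lemma clsW (P : completion -> Prop) : (forall s : cseq, P (cls s)) -> forall x : completion, P x.
Proof. by move=> h x; rewrite -(reprK x); exact: h. Qed.

Definition emb x : completion := cls (CSeq (cau_cst x)).

Definition sD (s t : cseq) := CSeq (cauD (cseqP s) (cseqP t)).
Definition sN (s : cseq) := CSeq (cauN (cseqP s)).
Definition sM (s t : cseq) := CSeq (cauM (cseqP s) (cseqP t)).
Definition sZ a (s : cseq) := CSeq (cauZ a (cseqP s)).
Definition sS (s : cseq) := CSeq (cau_st (cseqP s)).

Definition qD (x y : completion) := cls (sD (repr x) (repr y)).
Definition qN (x : completion) := cls (sN (repr x)).
Definition qM (x y : completion) := cls (sM (repr x) (repr y)).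
Definition qZ a (x : completion) := cls (sZ a (repr x)).
Definition qS (x : completion) := cls (sS (repr x)).

Lemma repr_cls (s : cseq) : null (fun i => repr (cls s) i - s i).
Proof. by apply/clsP; rewrite /cls reprK. Qed.

Lemma qDE (s t : cseq) : qD (cls s) (cls t) = cls (sD s t).
Proof.
apply/clsP => /=; apply: null_le (nullD (repr_cls s) (repr_cls t)) => i.
by rewrite opprD addrACA.
Qed.

Lemma qNE (s : cseq) : qN (cls s) = cls (sN s).
Proof.
by apply/clsP => /=; apply: null_le (repr_cls s) => i; rewrite -opprD pN.
Qed.

Lemma qME (s t : cseq) : qM (cls s) (cls t) = cls (sM s t).
Proof.
apply/clsP => /=.
have h1 := nullMr (repr_cls s) (cseqP (repr (cls t))).
have h2 := nullMl (cseqP s) (repr_cls t).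
apply: null_le (nullD h1 h2) => i.
by rewrite mulrBl mulrBr addrA subrK.
Qed.

Lemma qZE a (s : cseq) : qZ a (cls s) = cls (sZ a s).
Proof.
apply/clsP => /=; apply: null_le (nullMl (cau_cst (a *: 1)) (repr_cls s)) => i.
by rewrite -scalerAl mul1r scalerBr.
Qed.

Lemma qSE (s : cseq) : qS (cls s) = cls (sS s).
Proof.
apply/clsP => /=; apply: null_le (repr_cls s) => i.
by rewrite -stN -(seminorm_starD Hp) p_st.
Qed.

Let qDA : associative qD.
Proof.
elim/clsW=> s; elim/clsW=> t; elim/clsW=> u; rewrite !qDE.
by apply: cls_ext => i /=; rewrite addrA.
Qed.
Let qDC : commutative qD.
Proof.
by elim/clsW=> s; elim/clsW=> t; rewrite !qDE; apply: cls_ext => i /=; rewrite addrC.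
Qed.
Let q0D : left_id (emb 0) qD.
Proof. by elim/clsW=> s; rewrite qDE; apply: cls_ext => i /=; rewrite add0r. Qed.
Let qND : left_inverse (emb 0) qN qD.
Proof. by elim/clsW=> s; rewrite qNE qDE; apply: cls_ext => i /=; rewrite addNr. Qed.

HB.instance Definition _ := GRing.isZmodule.Build completion qDA qDC q0D qND.

Let qMA : associative qM.
Proof.
elim/clsW=> s; elim/clsW=> t; elim/clsW=> u; rewrite !qME.
by apply: cls_ext => i /=; rewrite mulrA.
Qed.
Let q1M : left_id (emb 1) qM.
Proof. by elim/clsW=> s; rewrite qME; apply: cls_ext => i /=; rewrite mul1r. Qed.
Let qM1 : right_id (emb 1) qM.
Proof. by elim/clsW=> s; rewrite qME; apply: cls_ext => i /=; rewrite mulr1. Qed.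
Let qMDl : left_distributive qM qD.
Proof.
elim/clsW=> s; elim/clsW=> t; elim/clsW=> u; rewrite !(qME, qDE).
by apply: cls_ext => i /=; rewrite mulrDl.
Qed.
Let qMDr : right_distributive qM qD.
Proof.
elim/clsW=> s; elim/clsW=> t; elim/clsW=> u; rewrite !(qME, qDE).
by apply: cls_ext => i /=; rewrite mulrDr.
Qed.
Let q1_neq0 : emb 1 != 0 :> completion.
Proof.
apply/eqP => /clsP/(_ 1 ltr01)[N /(_ N (leqnn _))] /=.
by rewrite subr0 (seminorm1 Hp) ltxx.
Qed.

HB.instance Definition _ := GRing.Zmodule_isNzRing.Build completion
  qMA q1M qM1 qMDl qMDr q1_neq0.

Let qZA a b (x : completion) : qZ a (qZ b x) = qZ (a * b) x.
Proof. by elim/clsW: x => s; rewrite !qZE; apply: cls_ext => i /=; rewrite scalerA. Qed.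
Let q1Z : left_id 1 qZ.
Proof. by elim/clsW=> s; rewrite qZE; apply: cls_ext => i /=; rewrite scale1r. Qed.
Let qZDr : right_distributive qZ +%R.
Proof.
move=> a; elim/clsW=> s; elim/clsW=> t; rewrite -[_ + _]/(qD _ _) !(qZE, qDE).
by rewrite -[RHS]/(qD _ _) qDE; apply: cls_ext => i /=; rewrite scalerDr.
Qed.
Let qZDl (x : completion) : {morph qZ^~ x : a b / a + b}.
Proof.
move=> a b; elim/clsW: x => s; rewrite !qZE -[RHS]/(qD _ _) qDE.
by apply: cls_ext => i /=; rewrite scalerDl.
Qed.

HB.instance Definition _ := GRing.Zmodule_isLmodule.Build R[i] completion
  qZA q1Z qZDr qZDl.

Let qZMl a (x y : completion) : a *: (x * y) = a *: x * y.
Proof.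
elim/clsW: x => s; elim/clsW: y => t.
rewrite -[LHS]/(qZ a (qM _ _)) -[RHS]/(qM (qZ a _) _) !(qME, qZE).
by apply: cls_ext => i /=; rewrite scalerAl.
Qed.

HB.instance Definition _ := GRing.Lmodule_isLalgebra.Build R[i] completion qZMl.

Let qZMr a (x y : completion) : a *: (x * y) = x * (a *: y).
Proof.
elim/clsW: x => s; elim/clsW: y => t.
rewrite -[LHS]/(qZ a (qM _ _)) -[RHS]/(qM _ (qZ a _)) !(qME, qZE).
by apply: cls_ext => i /=; rewrite scalerAr.
Qed.

HB.instance Definition _ := GRing.Lalgebra_isAlgebra.Build R[i] completion qZMr.

Lemma p_tends (s : cseq) : exists l, tends (fun i => p (s i)) l.
Proof.
apply: cauchy_tends => e /(cseqP s)[N hN]; exists N => i j Ni Nj.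
exact: le_lt_trans (p_dist _ _) (hN _ _ Ni Nj).
Qed.

Definition qnorm (x : completion) : R := sval (cid (p_tends (repr x))).

Lemma qnormP (s : cseq) : tends (fun i => p (s i)) (qnorm (cls s)).
Proof.
move=> e e0; have e2 : 0 < e / 2 by lra.
have [N hN] := svalP (cid (p_tends (repr (cls s)))) _ e2.
have [M hM] := repr_cls s e2.
exists (maxn N M) => i; rewrite geq_max => /andP[/hN h1 /hM h2].
have := ler_normD (p (s i) - p (repr (cls s) i)) (p (repr (cls s) i) - qnorm (cls s)).
have := p_dist (s i) (repr (cls s) i); rewrite (p_sub_sym (s i)) addrA subrK.
by rewrite /qnorm in h1 *; lra.
Qed.

Lemma qnormE (s : cseq) l : tends (fun i => p (s i)) l -> qnorm (cls s) = l.
Proof. by apply: tends_uniq; exact: qnormP. Qed.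

Lemma qnorm_emb x : qnorm (emb x) = p x.
Proof. by apply: qnormE; exact: (tends_cst (p x)). Qed.

Lemma qnormD x y : qnorm (x + y) <= qnorm x + qnorm y.
Proof.
elim/clsW: x => s; elim/clsW: y => t; rewrite -[_ + _ in X in X <= _]/(qD _ _) qDE.
apply: tends_le (qnormP _) (tendsD (qnormP s) (qnormP t)) => i.
exact: (seminormD Hp).
Qed.

Lemma qnormM x y : qnorm (x * y) <= qnorm x * qnorm y.
Proof.
elim/clsW: x => s; elim/clsW: y => t; rewrite -[_ * _ in X in X <= _]/(qM _ _) qME.
apply: tends_le (qnormP _) (tendsM (qnormP s) (qnormP t)) => i.
exact: (seminormM Hp).
Qed.

Lemma qnormZ a x : qnorm (a *: x) = rnorm a * qnorm x.
Proof.
elim/clsW: x => s; rewrite -[_ *: _]/(qZ _ _) qZE; apply: qnormE.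
have := tendsM (tends_cst (rnorm a)) (qnormP s).
by under eq_fun do rewrite -(seminormZ Hp).
Qed.

Lemma qnorm_star x : qnorm (qS x * x) = qnorm x ^+ 2.
Proof.
elim/clsW: x => s; rewrite qSE -[_ * _]/(qM _ _) qME; apply: qnormE.
have := tendsM (qnormP s) (qnormP s).
by under eq_fun do rewrite -expr2 -(seminorm_star Hp).
Qed.

Lemma qnorm0_eq0 x : qnorm x = 0 -> x = 0.
Proof.
elim/clsW: x => s s0; apply/clsP => e e0.
have := qnormP s; rewrite s0 => /(_ e e0)[N hN]; exists N => i /hN.
by rewrite !subr0 ger0_norm ?p_ge0.
Qed.

Lemma qSK x : qS (qS x) = x.
Proof. by elim/clsW: x => s; rewrite !qSE; apply: cls_ext => i /=; rewrite (seminorm_starK Hp). Qed.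

Lemma qSD x y : qS (x + y) = qS x + qS y.
Proof.
elim/clsW: x => s; elim/clsW: y => t; rewrite -[_ + _]/(qD _ _) -[RHS]/(qD _ _).
by rewrite !(qSE, qDE); apply: cls_ext => i /=; rewrite (seminorm_starD Hp).
Qed.

Lemma qSZ a x : qS (a *: x) = a^* *: qS x.
Proof.
elim/clsW: x => s; rewrite -[_ *: _]/(qZ _ _) -[RHS]/(qZ _ _).
by rewrite !(qSE, qZE); apply: cls_ext => i /=; rewrite (seminorm_starZ Hp).
Qed.

Lemma qSM x y : qS (x * y) = qS y * qS x.
Proof.
elim/clsW: x => s; elim/clsW: y => t; rewrite -[_ * _]/(qM _ _) -[RHS]/(qM _ _).
by rewrite !(qSE, qME); apply: cls_ext => i /=; rewrite (seminorm_starM Hp).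
Qed.

Lemma qnormN x : qnorm (- x) = qnorm x.
Proof. by rewrite -scaleN1r qnormZ rnormN1 mul1r. Qed.

Lemma embB x y : emb (x - y) = emb x - emb y.
Proof.
by rewrite -[RHS]/(qD _ (qN _)) qNE qDE; apply: cls_ext.
Qed.

Lemma qnorm_tail (s : cseq) a d N : (forall i, (N <= i)%N -> p (s i - a) <= d) ->
  qnorm (cls s - emb a) <= d.
Proof.
move=> h; rewrite -[_ - _]/(qD _ (qN _)) qNE qDE.
apply: (@tends_le _ (fun i => p (s (N + i)%N - a)) (fun=> d)); last exact: tends_cst.
  by move=> i; apply: h; rewrite leq_addr.
move=> e e0; have [M hM] := qnormP (sD s (sN (CSeq (cau_cst a)))) e0.
by exists M => i Mi; apply: hM; rewrite (leq_trans Mi) ?leq_addl.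
Qed.

Lemma qnorm_sym x y : qnorm (x - y) = qnorm (y - x).
Proof. by rewrite -qnormN opprB. Qed.

(* Diagonal argument: approximate the k-th term by an element of [A]. *)
Lemma qcomplete (x : nat -> completion) :
  (forall e : R, 0 < e -> exists N, forall i j, (N <= i)%N -> (N <= j)%N ->
     qnorm (x i - x j) < e) ->
  exists y, forall e : R, 0 < e -> exists N, forall i, (N <= i)%N -> qnorm (x i - y) < e.
Proof.
move=> cx.
have approx z (d : R) : 0 < d -> exists a, qnorm (z - emb a) <= d.
  elim/clsW: z => s d0; have [N hN] := cseqP s d0; exists (s N).
  by apply: (@qnorm_tail _ _ _ N) => i Ni; apply/ltW/hN.
pose d k : R := k.+1%:R^-1.
have d0 k : 0 < d k by rewrite invr_gt0.
have [y hy] := choice (fun k => approx (x k) (d k) (d0 k)).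
have d_small (e : R) : 0 < e -> exists N, forall k, (N <= k)%N -> d k < e.
  move=> e0; exists (Num.truncn e^-1) => k Nk.
  rewrite /d -[X in _ < X]invrK ltf_pV2 ?posrE ?invr_gt0 //.
  by apply: lt_le_trans (truncnS_gt _) _; rewrite ler_nat ltnS.
have cy : cau y.
  move=> e e0; have e3 : 0 < e / 3 by lra.
  have [N hN] := cx _ e3; have [M hM] := d_small _ e3.
  exists (maxn N M) => i j; rewrite !geq_max => /andP[Ni Mi] /andP[Nj Mj].
  rewrite -qnorm_emb embB.
  have -> : emb (y i) - emb (y j) =
      (emb (y i) - x i) + (x i - x j) + (x j - emb (y j)).
    by rewrite (addrA (emb (y i) - x i)) subrK addrA subrK.
  have := qnormD (emb (y i) - x i + (x i - x j)) (x j - emb (y j)).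
  have := qnormD (emb (y i) - x i) (x i - x j).
  have := hN _ _ Ni Nj; have := hM _ Mi; have := hM _ Mj.
  by have := hy i; have := hy j; rewrite (qnorm_sym (emb _)); lra.
exists (cls (CSeq cy)) => e e0; have e3 : 0 < e / 3 by lra.
have [N hN] := cy _ e3; have [M hM] := d_small _ e3.
exists (maxn N M) => i; rewrite !geq_max => /andP[Ni Mi].
have h : qnorm (cls (CSeq cy) - emb (y i)) <= e / 3.
  by apply: (@qnorm_tail _ _ _ N) => j Nj /=; apply/ltW/hN.
have -> : x i - cls (CSeq cy) = (x i - emb (y i)) + (emb (y i) - cls (CSeq cy)).
  by rewrite addrA subrK.
have := qnormD (x i - emb (y i)) (emb (y i) - cls (CSeq cy)).
by rewrite (qnorm_sym (emb _)); have := hy i; have := hM _ Mi; lra.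
Qed.

(** In the order of [R[i]] a positive element has imaginary part zero, so the tolerances of the
    complex-valued norm are real. *)
Let realC (e : R[i]) : 0 < e -> e = (complex.Re e)%:C%C /\ 0 < complex.Re e.
Proof.
case: e => a b; rewrite ltcE /= => /andP[/eqP b0 a0].
by rewrite b0.
Qed.

Let cnorm_complete (x : nat -> completion) :
  (forall e : R[i], 0 < e -> exists N : nat, forall i j : nat,
     (N <= i)%N -> (N <= j)%N -> (qnorm (x i - x j))%:C%C < e) ->
  exists y, forall e : R[i], 0 < e -> exists N : nat, forall i : nat,
     (N <= i)%N -> (qnorm (x i - y))%:C%C < e.
Proof.
move=> cx; have [|y hy] := @qcomplete x.
  move=> e e0; have [|N hN] := cx e%:C%C; first by rewrite ltcR.
  by exists N => i j Ni Nj; rewrite -ltcR; exact: hN.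
exists y => e /realC[-> e0]; have [N hN] := hy _ e0.
by exists N => i Ni; rewrite ltcR; exact: hN.
Qed.

Let cnormD (x y : completion) : (qnorm (x + y))%:C%C <= (qnorm x)%:C%C + (qnorm y)%:C%C :> R[i].
Proof. by rewrite -rmorphD lecR qnormD. Qed.
Let cnormZ (a : R[i]) (x : completion) : (qnorm (a *: x))%:C%C = `|a| * (qnorm x)%:C%C.
Proof. by rewrite rnormE -rmorphM qnormZ. Qed.
Let cnorm0_eq0 (x : completion) : (qnorm x)%:C%C = 0 -> x = 0.
Proof. by move=> /complexI /qnorm0_eq0. Qed.
Let cnormM (x y : completion) : (qnorm (x * y))%:C%C <= (qnorm x)%:C%C * (qnorm y)%:C%C :> R[i].
Proof. by rewrite -rmorphM lecR qnormM. Qed.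
Let cnorm_star (x : completion) : (qnorm (qS x * x))%:C%C = (qnorm x)%:C%C ^+ 2 :> R[i].
Proof. by rewrite -rmorphXn qnorm_star. Qed.

HB.instance Definition _ := isCStarAlgebra.Build R[i] completion
  qSK qSD qSZ qSM cnormD cnormZ cnorm0_eq0 cnormM cnorm_star cnorm_complete.

Lemma cstar_completion : exists (B : cstarType R[i]) (f : A -> B),
  [/\ forall x y, f (x + y) = f x + f y, forall a x, f (a *: x) = a *: f x,
      forall x y, f (x * y) = f x * f y, f 1 = 1 /\ (forall x, f (st x) = star (f x))
    & forall x, f x = 0 <-> p x = 0].
Proof.
exists completion, emb; split.
- by move=> x y; rewrite -[RHS]/(qD _ _) qDE; apply: cls_ext.
- by move=> a x; rewrite -[RHS]/(qZ _ _) qZE; apply: cls_ext.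
- by move=> x y; rewrite -[RHS]/(qM _ _) qME; apply: cls_ext.
- by split=> // x; rewrite -[RHS]/(qS _) qSE; apply: cls_ext.
- move=> x; rewrite -qnorm_emb; split=> [->|/qnorm0_eq0 //].
  by rewrite -[0]/(emb 0) qnorm_emb p0.
Qed.

End Completion.

(** * Operators on a semi-inner product space *)

Record semi_inner (R : realType) (E : lmodType R[i]) (phi : E -> E -> R[i]) : Prop :=
  SemiInner {
  semi_innerD : forall x y z, phi x (y + z) = phi x y + phi x z;
  semi_innerZ : forall a x y, phi x (a *: y) = a * phi x y;
  semi_innerC : forall x y, phi y x = (phi x y)^*;
  semi_inner_ge0 : forall x, 0 <= phi x x }.

Section Operators.
Variables (R : realType) (E : lmodType R[i]) (phi : E -> E -> R[i]).
Hypothesis Hphi : semi_inner phi.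
Variable e0 : E.
Hypothesis e0_unit : phi e0 e0 = 1.

Let phiDr := semi_innerD Hphi.
Let phiZr := semi_innerZ Hphi.
Let phiC := semi_innerC Hphi.

Lemma phiDl x y z : phi (x + y) z = phi x z + phi y z.
Proof. by rewrite phiC phiDr rmorphD /= -!phiC. Qed.

Lemma phiZl a x y : phi (a *: x) y = a^* * phi x y.
Proof. by rewrite phiC phiZr rmorphM /= -phiC. Qed.

Definition sqn x : R := complex.Re (phi x x).

Lemma sqnE x : phi x x = (sqn x)%:C%C.
Proof. by rewrite /sqn RRe_real // ger0_real ?semi_inner_ge0. Qed.

Lemma sqn_ge0 x : 0 <= sqn x.
Proof. by rewrite -lecR -sqnE semi_inner_ge0. Qed.

Definition nn x : R := Num.sqrt (sqn x).

Lemma nn_ge0 x : 0 <= nn x. Proof. exact: sqrtr_ge0. Qed.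

Lemma nn_sqr x : nn x ^+ 2 = sqn x.
Proof. by rewrite sqr_sqrtr ?sqn_ge0. Qed.

Lemma rnorm_sqr (z : R[i]) : (rnorm z ^+ 2)%:C%C = z * z^*.
Proof. by rewrite rmorphXn /= -rnormE normCK. Qed.

Lemma conjRC (t : R) : (t%:C%C)^* = t%:C%C :> R[i].
Proof. by rewrite -[LHS]/(conjc _) conjc_real. Qed.

Lemma cauchy_schwarz_sqr x y : rnorm (phi x y) ^+ 2 <= sqn x * sqn y.
Proof.
set c := phi x y; set D := _ ^+ 2.
(* The square of the vector [y - (t c) x] is nonnegative for each real [t]; this is its
   expansion. *)
have h (t : R) : 0 <= sqn y - 2 * t * D + t ^+ 2 * D * sqn x.
  have := semi_inner_ge0 Hphi (y + (- (t%:C%C * c)) *: x).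
  rewrite phiDl !phiDr !phiZl !phiZr (phiC x y) -/c !sqnE rmorphN rmorphM /= conjRC.
  set X := (X in 0 <= X -> _); suff -> : X = (sqn y - 2 * t * D + t ^+ 2 * D * sqn x)%:C%C.
    by rewrite ler0c.
  have rr : (rnorm c)%:C%C * (rnorm c)%:C%C = c * c^*.
    by rewrite -rnorm_sqr rmorphXn expr2.
  rewrite !rmorphD rmorphN !rmorphM /= rr /X rmorph_nat.
  ring.
have D0 : 0 <= D by rewrite exprn_ge0 ?rnorm_ge0.
have x0 := sqn_ge0 x; have y0 := sqn_ge0 y.
(* If [x] is a null vector, a large [t] rules out [D > 0]; otherwise [t = 1 / sqn x] minimises the
   quadratic. *)
have [x00|xn0] := eqVneq (sqn x) 0.
  rewrite x00 mul0r; rewrite leNgt; apply/negP => Dp.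
  have := h ((sqn y + 1) / (2 * D)); rewrite x00 mulr0 addr0.
  have -> : 2 * ((sqn y + 1) / (2 * D)) * D = sqn y + 1 by field; lra.
  lra.
have xp : 0 < sqn x by rewrite lt_def xn0.
have := h (sqn x)^-1; rewrite -(pmulr_lge0 _ xp).
have -> : (sqn y - 2 * (sqn x)^-1 * D + (sqn x)^-1 ^+ 2 * D * sqn x) * sqn x =
  sqn x * sqn y - D by field; lra.
by rewrite subr_ge0.
Qed.

Lemma cauchy_schwarz x y : rnorm (phi x y) <= nn x * nn y.
Proof.
rewrite -(@ler_pXn2r _ 2) ?nnegrE ?rnorm_ge0 ?mulr_ge0 ?nn_ge0 //.
by rewrite exprMn !nn_sqr cauchy_schwarz_sqr.
Qed.

Lemma Re_le_rnorm (z : R[i]) : complex.Re z <= rnorm z.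
Proof.
by rewrite -lecR -rnormE; apply: le_trans (normc_ge_Re z); rewrite lecR ler_norm.
Qed.

Lemma nnD x y : nn (x + y) <= nn x + nn y.
Proof.
rewrite -(@ler_pXn2r _ 2) ?nnegrE ?addr_ge0 ?nn_ge0 // nn_sqr.
have -> : sqn (x + y) = sqn x + 2 * complex.Re (phi x y) + sqn y.
  rewrite /sqn phiDl !phiDr (phiC x y).
  case: (phi x x) (phi x y) (phi y y) => [? ?] [? ?] [? ?] /=; ring.
have := cauchy_schwarz x y; have := Re_le_rnorm (phi x y).
by rewrite -!nn_sqr => h1 h2; nra.
Qed.

Lemma nnZ a x : nn (a *: x) = rnorm a * nn x.
Proof.
apply/eqP; rewrite -(@eqrXn2 _ 2) ?mulr_ge0 ?rnorm_ge0 ?nn_ge0 //; apply/eqP.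
apply: complexI; rewrite exprMn !nn_sqr rmorphM /= rnorm_sqr -!sqnE phiZl phiZr.
ring.
Qed.

Definition bounded_by (T : E -> E) (K : R) : Prop :=
  0 <= K /\ forall x, nn (T x) <= K * nn x.

(** The space is neither separated nor complete: an adjoint need not exist, and where it exists it
    is determined only up to null vectors. It is therefore part of the data, with its own bound. *)
Record adjointable := Adjointable {
  op_fun :> E -> E;
  op_adj : E -> E;
  op_lin : forall a x y, op_fun (a *: x + y) = a *: op_fun x + op_fun y;
  adj_lin : forall a x y, op_adj (a *: x + y) = a *: op_adj x + op_adj y;
  op_adjP : forall x y, phi (op_fun x) y = phi x (op_adj y);
  op_bounded : exists K, bounded_by op_fun K;
  adj_bounded : exists K, bounded_by op_adj K }.

HB.instance Definition _ := gen_eqMixin adjointable.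
HB.instance Definition _ := gen_choiceMixin adjointable.

Lemma adjointable_ext (T S : adjointable) :
  T =1 S -> op_adj T =1 op_adj S -> T = S.
Proof.
case: T S => [T T' a b c d e] [S S' a' b' c' d' e'] /= /funext TS /funext TS'.
by subst; congr Adjointable; exact: Prop_irrelevance.
Qed.

Lemma bounded_by_comp T S K L : bounded_by T K -> bounded_by S L ->
  bounded_by (T \o S) (K * L).
Proof.
move=> [K0 TK] [L0 SL]; split=> [|x /=]; first exact: mulr_ge0.
by apply: le_trans (TK _) _; rewrite -mulrA ler_wpM2l.
Qed.

Lemma bounded_by_add T S K L : bounded_by T K -> bounded_by S L ->
  bounded_by (fun x => T x + S x) (K + L).
Proof.
move=> [K0 TK] [L0 SL]; split=> [|x /=]; first exact: addr_ge0.
by apply: le_trans (nnD _ _) _; rewrite mulrDl lerD.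
Qed.

Lemma bounded_by_scale a T K : bounded_by T K ->
  bounded_by (fun x => a *: T x) (rnorm a * K).
Proof.
move=> [K0 TK]; split=> [|x]; first by rewrite mulr_ge0 ?rnorm_ge0.
by rewrite nnZ -mulrA ler_wpM2l ?rnorm_ge0.
Qed.

Lemma bounded_by_id : bounded_by id 1.
Proof. by split=> // x; rewrite mul1r. Qed.

Lemma bounded_by_zero : bounded_by (fun=> 0) 0.
Proof.
by split=> // x; rewrite -(scale0r 0) nnZ rnorm0 !mul0r.
Qed.

Section Operations.
Variables (a : R[i]) (T S : adjointable).

Let addT_lin b x y : T (b *: x + y) + S (b *: x + y) = b *: (T x + S x) + (T y + S y).
Proof. by rewrite !op_lin scalerDr addrACA. Qed.
Let addT'_lin b x y : op_adj T (b *: x + y) + op_adj S (b *: x + y) =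
  b *: (op_adj T x + op_adj S x) + (op_adj T y + op_adj S y).
Proof. by rewrite !adj_lin scalerDr addrACA. Qed.
Let addT_adj x y : phi (T x + S x) y = phi x (op_adj T y + op_adj S y).
Proof. by rewrite phiDl phiDr !op_adjP. Qed.
Let addT_bd : exists K, bounded_by (fun x => T x + S x) K.
Proof.
have [K hK] := op_bounded T; have [L hL] := op_bounded S.
by exists (K + L); exact: bounded_by_add.
Qed.
Let addT'_bd : exists K, bounded_by (fun x => op_adj T x + op_adj S x) K.
Proof.
have [K hK] := adj_bounded T; have [L hL] := adj_bounded S.
by exists (K + L); exact: bounded_by_add.
Qed.
Definition addT := Adjointable addT_lin addT'_lin addT_adj addT_bd addT'_bd.

Let mulT_lin b x y : T (S (b *: x + y)) = b *: T (S x) + T (S y).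
Proof. by rewrite !op_lin. Qed.
Let mulT'_lin b x y :
  op_adj S (op_adj T (b *: x + y)) = b *: op_adj S (op_adj T x) + op_adj S (op_adj T y).
Proof. by rewrite !adj_lin. Qed.
Let mulT_adj x y : phi (T (S x)) y = phi x (op_adj S (op_adj T y)).
Proof. by rewrite !op_adjP. Qed.
Let mulT_bd : exists K, bounded_by (fun x => T (S x)) K.
Proof.
have [K hK] := op_bounded T; have [L hL] := op_bounded S.
by exists (K * L); exact: bounded_by_comp.
Qed.
Let mulT'_bd : exists K, bounded_by (fun x => op_adj S (op_adj T x)) K.
Proof.
have [K hK] := adj_bounded T; have [L hL] := adj_bounded S.
by exists (L * K); exact: bounded_by_comp.
Qed.
Definition mulT := Adjointable mulT_lin mulT'_lin mulT_adj mulT_bd mulT'_bd.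

Let scaleT_lin b x y : a *: T (b *: x + y) = b *: (a *: T x) + a *: T y.
Proof. by rewrite op_lin scalerDr !scalerA mulrC. Qed.
Let scaleT'_lin b x y :
  a^* *: op_adj T (b *: x + y) = b *: (a^* *: op_adj T x) + a^* *: op_adj T y.
Proof. by rewrite adj_lin scalerDr !scalerA mulrC. Qed.
Let scaleT_adj x y : phi (a *: T x) y = phi x (a^* *: op_adj T y).
Proof. by rewrite phiZl phiZr op_adjP. Qed.
Let scaleT_bd : exists K, bounded_by (fun x => a *: T x) K.
Proof.
have [K hK] := op_bounded T; exists (rnorm a * K); exact: bounded_by_scale.
Qed.
Let scaleT'_bd : exists K, bounded_by (fun x => a^* *: op_adj T x) K.
Proof.
have [K hK] := adj_bounded T; exists (rnorm a^* * K); exact: bounded_by_scale.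
Qed.
Definition scaleT := Adjointable scaleT_lin scaleT'_lin scaleT_adj scaleT_bd scaleT'_bd.

Let starT_adj x y : phi (op_adj T x) y = phi x (T y).
Proof. by rewrite phiC -op_adjP -phiC. Qed.
Definition starT := Adjointable (@adj_lin T) (@op_lin T) starT_adj
  (@adj_bounded T) (@op_bounded T).

End Operations.

Let zeroT_lin (a : R[i]) (x y : E) : 0 = a *: 0 + 0 :> E.
Proof. by rewrite scaler0 addr0. Qed.
Let zeroT_adj (x y : E) : phi 0 y = phi x 0.
Proof. by rewrite -(scale0r 0) phiZl phiZr rmorph0 !mul0r. Qed.
Definition zeroT := Adjointable zeroT_lin zeroT_lin zeroT_adj
  (ex_intro _ _ bounded_by_zero) (ex_intro _ _ bounded_by_zero).
Definition oneT := @Adjointable id id (fun _ _ _ => erefl) (fun _ _ _ => erefl)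
  (fun _ _ => erefl) (ex_intro _ _ bounded_by_id) (ex_intro _ _ bounded_by_id).

Lemma op0 (T : adjointable) : T 0 = 0.
Proof. by have := op_lin T (-1) 0 0; rewrite scaleN1r oppr0 addr0 scaleN1r addNr. Qed.
Lemma adj0 (T : adjointable) : op_adj T 0 = 0.
Proof. by have := adj_lin T (-1) 0 0; rewrite scaleN1r oppr0 addr0 scaleN1r addNr. Qed.
Lemma opD (T : adjointable) x y : T (x + y) = T x + T y.
Proof. by rewrite -[x]scale1r op_lin !scale1r. Qed.
Lemma adjD (T : adjointable) x y : op_adj T (x + y) = op_adj T x + op_adj T y.
Proof. by rewrite -[x]scale1r adj_lin !scale1r. Qed.
Lemma opZ (T : adjointable) a x : T (a *: x) = a *: T x.
Proof. by rewrite -[a *: x]addr0 op_lin op0 !addr0. Qed.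
Lemma adjZ (T : adjointable) a x : op_adj T (a *: x) = a *: op_adj T x.
Proof. by rewrite -[a *: x]addr0 adj_lin adj0 !addr0. Qed.

Let addTA : associative addT.
Proof. by move=> T S U; apply: adjointable_ext => x /=; rewrite addrA. Qed.
Let addTC : commutative addT.
Proof. by move=> T S; apply: adjointable_ext => x /=; rewrite addrC. Qed.
Let add0T : left_id zeroT addT.
Proof. by move=> T; apply: adjointable_ext => x /=; rewrite add0r. Qed.
Let addNT : left_inverse zeroT (scaleT (-1)) addT.
Proof.
by move=> T; apply: adjointable_ext => x /=; rewrite ?rmorphN1 scaleN1r addNr.
Qed.
HB.instance Definition _ := GRing.isZmodule.Build adjointable addTA addTC add0T addNT.

Let mulTA : associative mulT.
Proof. by move=> T S U; apply: adjointable_ext. Qed.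
Let mul1T : left_id oneT mulT.
Proof. by move=> T; apply: adjointable_ext. Qed.
Let mulT1 : right_id oneT mulT.
Proof. by move=> T; apply: adjointable_ext. Qed.
Let mulTDl : left_distributive mulT addT.
Proof. by move=> T S U; apply: adjointable_ext => x //=; rewrite adjD. Qed.
Let mulTDr : right_distributive mulT addT.
Proof. by move=> T S U; apply: adjointable_ext => x //=; rewrite opD. Qed.
Let oneT_neq0 : oneT != 0.
Proof.
apply/eqP => /(congr1 (fun T : adjointable => phi (T e0) e0)) /=.
rewrite e0_unit; have := phiZl 0 e0 e0; rewrite scale0r rmorph0 mul0r => -> /eqP.
by rewrite oner_eq0.
Qed.
HB.instance Definition _ := GRing.Zmodule_isNzRing.Build adjointable
  mulTA mul1T mulT1 mulTDl mulTDr oneT_neq0.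

Let scaleTA a b (T : adjointable) : scaleT a (scaleT b T) = scaleT (a * b) T.
Proof. by apply: adjointable_ext => x /=; rewrite scalerA ?rmorphM. Qed.
Let scale1T : left_id 1 scaleT.
Proof. by move=> T; apply: adjointable_ext => x /=; rewrite ?rmorph1 scale1r. Qed.
Let scaleTDr : right_distributive scaleT +%R.
Proof. by move=> a T S; apply: adjointable_ext => x /=; rewrite scalerDr. Qed.
Let scaleTDl (T : adjointable) : {morph scaleT^~ T : a b / a + b}.
Proof. by move=> a b; apply: adjointable_ext => x /=; rewrite ?rmorphD scalerDl. Qed.
HB.instance Definition _ := GRing.Zmodule_isLmodule.Build R[i] adjointable
  scaleTA scale1T scaleTDr scaleTDl.

Let scaleTMl a (T S : adjointable) : a *: (T * S) = a *: T * S.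
Proof. by apply: adjointable_ext => x //=; rewrite adjZ. Qed.
HB.instance Definition _ := GRing.Lmodule_isLalgebra.Build R[i] adjointable scaleTMl.
Let scaleTMr a (T S : adjointable) : a *: (T * S) = T * (a *: S).
Proof. by apply: adjointable_ext => x //=; rewrite opZ. Qed.
HB.instance Definition _ := GRing.Lalgebra_isAlgebra.Build R[i] adjointable scaleTMr.

Definition opn (T : adjointable) : R := inf [set K | bounded_by T K]%classic.

Lemma opn_set (T : adjointable) : ([set K | bounded_by T K] !=set0)%classic.
Proof. by have [K hK] := op_bounded T; exists K. Qed.

Lemma opn_le (T : adjointable) K : bounded_by T K -> opn T <= K.
Proof. by move=> hK; apply: ge_inf => //; exists 0 => L []. Qed.

Lemma opn_ge0 (T : adjointable) : 0 <= opn T.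
Proof. by apply: lb_le_inf; [exact: opn_set|move=> K []]. Qed.

Lemma opn_bound (T : adjointable) : bounded_by T (opn T).
Proof.
split=> [|x]; first exact: opn_ge0.
(* On a null vector one cannot divide by [nn x], but any single bound already gives
   [nn (T x) <= 0]. *)
have [x0|x0] := eqVneq (nn x) 0.
  by have [K [_ /(_ x)]] := op_bounded T; rewrite x0 !mulr0.
have xp : 0 < nn x by rewrite lt_def x0 nn_ge0.
rewrite -ler_pdivrMr //; apply: lb_le_inf; first exact: opn_set.
by move=> K [K0 hK]; rewrite ler_pdivrMr.
Qed.

(** The square [sqn (op_adj T x)] is [phi (T (op_adj T x)) x]; Cauchy-Schwarz bounds it by [opn T]
    times [nn (op_adj T x) * nn x], and one factor cancels. *)
Lemma opn_star_le (T : adjointable) : opn (starT T) <= opn T.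
Proof.
apply: opn_le; split=> [|x /=]; first exact: opn_ge0.
have [->|x0] := eqVneq (nn (op_adj T x)) 0; first by rewrite mulr_ge0 ?opn_ge0 ?nn_ge0.
have xp : 0 < nn (op_adj T x) by rewrite lt_def x0 nn_ge0.
rewrite -(ler_pM2l xp) -expr2 nn_sqr.
have -> : sqn (op_adj T x) = complex.Re (phi (T (op_adj T x)) x) by rewrite op_adjP.
apply: le_trans (Re_le_rnorm _) _; apply: le_trans (cauchy_schwarz _ _) _.
by rewrite [X in _ <= X]mulrCA mulrA ler_wpM2r ?nn_ge0 //; case: (opn_bound T).
Qed.

Lemma adjointable_seminorm : cstar_seminorm starT opn.
Proof.
split.
- by move=> T; apply: adjointable_ext.
- by move=> T S; apply: adjointable_ext.
- by move=> a T; apply: adjointable_ext => x //=; rewrite conjCK.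
- by move=> T S; apply: adjointable_ext.
- by move=> T S; apply: opn_le; apply: bounded_by_add; exact: opn_bound.
- have le a T : opn (a *: T) <= rnorm a * opn T.
    by apply: opn_le; apply: bounded_by_scale; exact: opn_bound.
  move=> a T; apply/eqP; rewrite eq_le le /=.
  have [->|a0] := eqVneq a 0; first by rewrite rnorm0 mul0r opn_ge0.
  have ap : 0 < rnorm a by rewrite -ltcR -rnormE normr_gt0.
  rewrite -(ler_pM2l (_ : 0 < rnorm a^-1)); last first.
    by rewrite -ltcR -rnormE normr_gt0 invr_eq0.
  have := le a^-1 (a *: T); rewrite scalerA mulVf // scale1r mulrA.
  suff -> : rnorm a^-1 * rnorm a = 1 by rewrite mul1r.
  by apply: complexI; rewrite rmorphM /= -!rnormE -normrM mulVf // normr1.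
- by move=> T S; apply: opn_le; apply: bounded_by_comp; exact: opn_bound.
- move=> T; apply/eqP; rewrite eq_le; apply/andP; split.
    apply: (@le_trans _ _ (opn (starT T) * opn T)).
      by apply: opn_le; apply: bounded_by_comp; exact: opn_bound.
    by rewrite expr2 ler_wpM2r ?opn_ge0 ?opn_star_le.
  (* The hard half of the C*-identity: [phi (T x) (T x)] equals [phi x] of [op_adj T (T x)], so the
     square root of [opn (starT T * T)] is a bound for [T]. *)
  have h0 : 0 <= opn (starT T * T) by exact: opn_ge0.
  rewrite -(sqr_sqrtr h0) ler_pXn2r ?nnegrE ?opn_ge0 ?sqrtr_ge0 //.
  apply: opn_le; split=> [|x]; first exact: sqrtr_ge0.
  rewrite -(@ler_pXn2r _ 2) ?nnegrE ?mulr_ge0 ?sqrtr_ge0 ?nn_ge0 //.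
  rewrite exprMn !nn_sqr sqr_sqrtr // {1}/sqn op_adjP.
  apply: le_trans (Re_le_rnorm _) _; apply: le_trans (cauchy_schwarz _ _) _.
  rewrite -nn_sqr expr2 mulrA [X in X <= _]mulrC ler_wpM2r ?nn_ge0 //.
  by case: (opn_bound (starT T * T)) => _; apply.
- apply/eqP; rewrite eq_le; apply/andP; split; first exact: (@opn_le 1 1 bounded_by_id).
  have [_ /(_ e0) /=] := opn_bound 1.
  have -> : nn e0 = 1 by rewrite /nn /sqn e0_unit sqrtr1.
  by rewrite mulr1.
Qed.

Lemma adjointable_cstar : exists (B : cstarType R[i]) (F : adjointable -> B),
  [/\ forall T S, F (addT T S) = F T + F S, forall a T, F (scaleT a T) = a *: F T,
      forall T S, F (mulT T S) = F T * F S,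
      [/\ F oneT = 1, F zeroT = 0 & forall T, F (starT T) = star (F T)]
    & forall T, F T = 0 <-> forall x, nn (T x) = 0].
Proof.
have [B [F [FD FZ FM [F1 FS] F0]]] := cstar_completion adjointable_seminorm.
exists B, F; split=> //.
  by split=> //; apply/F0; exact: p0 adjointable_seminorm.
move=> T; split=> [/F0 T0 x|h].
  apply/eqP; rewrite eq_le nn_ge0 andbT.
  by have [_ /(_ x)] := opn_bound T; rewrite T0 mul0r.
apply/F0/eqP; rewrite eq_le opn_ge0 andbT; apply: opn_le; split=> // x.
by rewrite h mul0r.
Qed.

End Operators.

(** * The GNS construction *)

Section FiniteSupport.
Variables (R : realType) (T : finType).

(** As [T] is finite, bounding the lengths makes the support finite: these functions are the
    noncommutative polynomials in the letters [T], given by their coefficients. *)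
Definition fin_supp : {pred seq T -> R[i]} :=
  fun f => `[< exists L, forall w, (L <= size w)%N -> f w = 0 >].

Lemma fin_supp_submod : submod_closed fin_supp.
Proof.
split; first by apply/asboolP; exists 0.
move=> a f g /asboolP[L hL] /asboolP[M hM]; apply/asboolP; exists (maxn L M) => w.
by rewrite geq_max fctE => /andP[/hL + /hM ->]; rewrite fctE => ->; rewrite scaler0 addr0.
Qed.

HB.instance Definition _ := GRing.isSubmodClosed.Build _ _ fin_supp fin_supp_submod.

Record fsfun := FSFun { fsfun_val :> seq T -> R[i]; _ : fsfun_val \in fin_supp }.

HB.instance Definition _ := [isSub for fsfun_val].
HB.instance Definition _ := [Choice of fsfun by <:].
HB.instance Definition _ := [SubChoice_isSubLmodule of fsfun by <:].

Lemma fsfun_ext (f g : fsfun) : f =1 g -> f = g.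
Proof. by move=> /funext fg; apply: val_inj. Qed.

Lemma fsfunD (f g : fsfun) w : (f + g) w = f w + g w.
Proof. by []. Qed.

Lemma fsfunZ a (f : fsfun) w : (a *: f) w = a * f w.
Proof. by []. Qed.

Lemma fsfun_sum I (r : seq I) (F : I -> fsfun) w :
  (\sum_(i <- r) F i) w = \sum_(i <- r) F i w.
Proof. by elim: r => [|i r IHr]; rewrite ?big_nil // !big_cons fsfunD IHr. Qed.

(** Some strict bound for the lengths in the support, obtained by choice; it need not be the least
    one. *)
Definition degree (f : fsfun) : nat :=
  let: FSFun _ fP := f in sval (cid (asboolW fP)).

Lemma degreeP (f : fsfun) w : (degree f <= size w)%N -> f w = 0.
Proof. by case: f => f fP /=; apply: (svalP (cid (asboolW fP))). Qed.

Lemma dirac_fin_supp (a : seq T) : (fun w => (w == a)%:R : R[i]) \in fin_supp.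
Proof.
apply/asboolP; exists (size a).+1 => w; case: eqP => // ->; by rewrite ltnn.
Qed.

Definition dirac (a : seq T) : fsfun := FSFun (dirac_fin_supp a).

Lemma dirac_expand (f : fsfun) L : (degree f <= L)%N ->
  f = \sum_(a <- upto T L) f a *: dirac a.
Proof.
move=> fL; apply: fsfun_ext => w; rewrite fsfun_sum.
have [wL|wL] := ltnP (size w) L.
  rewrite (bigD1_seq w) ?mem_upto ?uniq_upto // fsfunZ /= eqxx mulr1 big1 ?addr0 //.
  by move=> a aw; rewrite -[LHS]/(f a * (w == a)%:R) eq_sym (negPf aw) mulr0.
rewrite (degreeP (leq_trans fL wL)) big_seq big1 // => a.
rewrite mem_upto fsfunZ /= => aL; case: eqP => wa; last by rewrite mulr0.
by move: aL; rewrite -wa ltnNge wL.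
Qed.

End FiniteSupport.

Arguments dirac {R T}.

Section GNS.
Variables (R : realType) (T : finType) (h : seq T -> R[i]).

(* A state on the free *-algebra in self-adjoint letters, given on words;
   [state_bound] makes the letters act as contractions on the GNS space. *)
Record state : Prop := State {
  state1 : h [::] = 1;
  state_herm : forall w, h (rev w) = (h w)^*;
  state_ge0 : forall L (c : seq T -> R[i]),
    0 <= \sum_(x <- upto T L) \sum_(y <- upto T L) (c x)^* * c y * h (rev x ++ y);
  state_bound : forall g L (c : seq T -> R[i]),
    \sum_(x <- upto T L) \sum_(y <- upto T L) (c x)^* * c y * h (rev x ++ [:: g, g & y])
    <= \sum_(x <- upto T L) \sum_(y <- upto T L) (c x)^* * c y * h (rev x ++ y) }.

Hypothesis Hh : state.

Local Notation E := (fsfun R T).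
Implicit Types f g : E.

Definition formL L f g : R[i] :=
  \sum_(x <- upto T L) \sum_(y <- upto T L) (f x)^* * g y * h (rev x ++ y).

Definition form f g : R[i] := formL (maxn (degree f) (degree g)) f g.

(** The truncation level is immaterial once it reaches both degrees, so that sums and multiples can
    be compared at a common level. *)
Lemma formLE L f g : (degree f <= L)%N -> (degree g <= L)%N -> form f g = formL L f g.
Proof.
move=> fL gL; rewrite /form /formL; set M := maxn _ _.
have ML : (M <= L)%N by rewrite geq_max fL.
symmetry; transitivity (\sum_(x <- upto T L) \sum_(y <- upto T M) (f x)^* * g y * h (rev x ++ y)).
  apply: eq_bigr => x _; apply: big_upto_widen => // w Mw.
  by rewrite (degreeP (leq_trans (leq_maxr _ _) Mw)) mulr0 mul0r.
apply: big_upto_widen => // w Mw; apply: big1 => y _.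
by rewrite (degreeP (leq_trans (leq_maxl _ _) Mw)) rmorph0 !mul0r.
Qed.

Lemma form_semi_inner : semi_inner form.
Proof.
split.
- move=> f g k; pose L := maxn (degree f) (maxn (degree g) (maxn (degree k) (degree (g + k)))).
  have [fL gL kL gkL] : [/\ (degree f <= L)%N, (degree g <= L)%N, (degree k <= L)%N & (degree (g + k)%R <= L)%N].
    by rewrite /L !leq_max !leqnn !orbT.
  rewrite !(@formLE L) // /formL -big_split; apply: eq_bigr => x _ /=.
  by rewrite -big_split; apply: eq_bigr => y _ /=; rewrite mulrDr mulrDl.
- move=> a f g; pose L := maxn (degree f) (maxn (degree g) (degree (a *: g))).
  have [fL gL agL] : [/\ (degree f <= L)%N, (degree g <= L)%N & (degree (a *: g)%R <= L)%N].
    by rewrite /L !leq_max !leqnn !orbT.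
  rewrite !(@formLE L) // /formL mulr_sumr; apply: eq_bigr => x _.
  by rewrite mulr_sumr; apply: eq_bigr => y _; rewrite fsfunZ; ring.
- move=> f g; pose L := maxn (degree f) (degree g).
  rewrite !(@formLE L) ?leq_maxl ?leq_maxr // /formL rmorph_sum /= exchange_big.
  apply: eq_bigr => y _; rewrite rmorph_sum; apply: eq_bigr => x _ /=.
  rewrite !rmorphM /= conjCK -(state_herm Hh) rev_cat revK; ring.
- by move=> f; exact: (state_ge0 Hh).
Qed.

Lemma form_dirac a b : form (dirac a) (dirac b) = h (rev a ++ b).
Proof.
pose L := maxn (maxn (degree (@dirac R T a)) (degree (@dirac R T b))) (maxn (size a).+1 (size b).+1).
have [aL bL aL' bL'] : [/\ (degree (@dirac R T a) <= L)%N, (degree (@dirac R T b) <= L)%N,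
    (size a < L)%N & (size b < L)%N].
  by rewrite /L !leq_max !leqnn !orbT.
rewrite (@formLE L) // /formL (bigD1_seq a) ?mem_upto ?uniq_upto //=.
rewrite [X in _ + X]big1 ?addr0 => [|x xa]; last first.
  by apply: big1 => y _; rewrite (negPf xa) rmorph0 !mul0r.
rewrite (bigD1_seq b) ?mem_upto ?uniq_upto //= !eqxx rmorph1 !mul1r.
by rewrite big1 ?addr0 // => y yb; rewrite (negPf yb) mulr0 mul0r.
Qed.

Let formDr := semi_innerD form_semi_inner.
Let formZr := semi_innerZ form_semi_inner.

Lemma form_sumr I (r : seq I) f (F : I -> E) :
  form f (\sum_(i <- r) F i) = \sum_(i <- r) form f (F i).
Proof.
elim: r => [|i r IHr]; last by rewrite !big_cons formDr IHr.
by rewrite !big_nil -(scale0r 0) formZr mul0r.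
Qed.

Lemma form_suml I (r : seq I) f (F : I -> E) :
  form (\sum_(i <- r) F i) f = \sum_(i <- r) form (F i) f.
Proof.
rewrite (semi_innerC form_semi_inner) form_sumr rmorph_sum.
by apply: eq_bigr => i _ /=; rewrite -(semi_innerC form_semi_inner).
Qed.

Lemma form_expand (A : E -> E) f g : (forall a x y, A (a *: x + y) = a *: A x + A y) ->
  forall L, (degree f <= L)%N -> (degree g <= L)%N ->
  form f (A g) = \sum_(x <- upto T L) \sum_(y <- upto T L)
    (f x)^* * g y * form (dirac x) (A (dirac y)).
Proof.
move=> Alin L fL gL.
have A0 : A 0 = 0.
  by have := Alin (-1) 0 0; rewrite scaleN1r oppr0 addr0 scaleN1r addNr.
have Asum (r : seq (seq T)) (F : seq T -> R[i]) :
    A (\sum_(y <- r) F y *: dirac y) = \sum_(y <- r) F y *: A (dirac y).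
  by elim: r => [|y r IHr]; rewrite ?big_nil // !big_cons Alin IHr.
rewrite {1}(dirac_expand fL) {1}(dirac_expand gL) Asum form_suml.
apply: eq_bigr => x _; rewrite form_sumr; apply: eq_bigr => y _.
by rewrite formZr (phiZl form_semi_inner); ring.
Qed.

Lemma form_expandl (A : E -> E) f g : (forall a x y, A (a *: x + y) = a *: A x + A y) ->
  forall L, (degree f <= L)%N -> (degree g <= L)%N ->
  form (A f) g = \sum_(x <- upto T L) \sum_(y <- upto T L)
    (f x)^* * g y * form (A (dirac x)) (dirac y).
Proof.
move=> Alin L fL gL.
rewrite (semi_innerC form_semi_inner) (form_expand Alin gL fL) rmorph_sum /=.
under eq_bigr do rewrite rmorph_sum /=.
rewrite exchange_big; apply: eq_bigr => y _; apply: eq_bigr => x _ /=.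
by rewrite !rmorphM /= conjCK -(semi_innerC form_semi_inner); ring.
Qed.

(** On noncommutative polynomials this is left multiplication by the letter [g]. *)
Definition shift_fun (g : T) (f : seq T -> R[i]) (w : seq T) : R[i] :=
  if w is x :: w' then if x == g then f w' else 0 else 0.

Lemma shift_fin_supp c f : shift_fun c f \in @fin_supp R T.
Proof.
apply/asboolP; exists (degree f).+1 => -[|x w] //=; rewrite ltnS => fw.
by case: ifP => // _; exact: degreeP.
Qed.

Definition shift c f : E := FSFun (shift_fin_supp c f).

Lemma shift_lin c a (x y : E) : shift c (a *: x + y) = a *: shift c x + shift c y.
Proof.
apply: fsfun_ext => w; rewrite fsfunD fsfunZ; case: w => [|z w] /=.
  by rewrite mulr0 addr0.
by case: ifP => // _; rewrite mulr0 addr0.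
Qed.

Lemma shift_dirac c w : shift c (dirac w) = dirac (c :: w).
Proof.
apply: fsfun_ext => -[|z v] //=.
by rewrite eqseq_cons; case: eqP.
Qed.

(** Letters are self-adjoint because [rev (c :: x) ++ y] and [rev x ++ (c :: y)] are the same
    word. *)
Lemma shift_adj c f g : form (shift c f) g = form f (shift c g).
Proof.
pose L := maxn (degree f) (degree g).
rewrite (form_expand (@shift_lin c) (leq_maxl _ _ : (_ <= L)%N) (leq_maxr _ _)).
rewrite (form_expandl (@shift_lin c) (leq_maxl _ _ : (_ <= L)%N) (leq_maxr _ _)).
apply: eq_bigr => x _; apply: eq_bigr => y _; rewrite !shift_dirac !form_dirac.
by rewrite rev_cons cat_rcons.
Qed.

Lemma shift_bound c : bounded_by form (shift c) 1.
Proof.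
split=> // f; rewrite mul1r ler_psqrt ?nnegrE ?(sqn_ge0 form_semi_inner) //.
rewrite -lecR -!(sqnE form_semi_inner) shift_adj.
rewrite (@form_expand (fun f => shift c (shift c f)) f f _ (degree f)) //; last first.
  by move=> a x y; rewrite !shift_lin.
rewrite [X in _ <= X](@formLE (degree f)) //.
apply: le_trans (state_bound Hh c (degree f) f).
rewrite le_eqVlt; apply/orP; left; apply/eqP.
apply: eq_bigr => x _; apply: eq_bigr => y _.
by rewrite !shift_dirac form_dirac.
Qed.

Definition shift_op c : adjointable form :=
  Adjointable (@shift_lin c) (@shift_lin c) (@shift_adj c)
    (ex_intro _ _ (shift_bound c)) (ex_intro _ _ (shift_bound c)).

Let unit_vector : form (dirac [::]) (dirac [::]) = 1.
Proof. by rewrite form_dirac /= (state1 Hh). Qed.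

Definition shift_word (t : seq T) : adjointable form :=
  foldr (fun c U => mulT (shift_op c) U) (oneT form) t.

Lemma shift_word_dirac t b : shift_word t (dirac b) = dirac (t ++ b).
Proof. by elim: t => //= c t ->; rewrite shift_dirac. Qed.

Definition shift_comb (s : seq (R[i] * seq T)) : adjointable form :=
  foldr (fun ct U => addT form_semi_inner (scaleT form_semi_inner ct.1 (shift_word ct.2)) U)
    (zeroT form_semi_inner) s.

Lemma form_shift_comb s a b :
  form (dirac a) (shift_comb s (dirac b)) = \sum_(ct <- s) ct.1 * h (rev a ++ ct.2 ++ b).
Proof.
elim: s => [|ct s IHs] /=.
  by rewrite big_nil -(scale0r 0) formZr mul0r.
by rewrite big_cons formDr formZr shift_word_dirac form_dirac IHs.
Qed.

(** A polynomial [s] vanishes in [B] exactly if [h] kills every product of [s] with words on both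
    sides. These values are the matrix coefficients of the operator between the vectors
    [dirac (rev a)] and [dirac b], and by Cauchy-Schwarz they vanish if its seminorm does. *)
Lemma gns : exists (B : cstarType R[i]) (v : T -> B),
  (forall c, star (v c) = v c) /\
  forall s : seq (R[i] * seq T),
    \sum_(ct <- s) ct.1 *: \prod_(c <- ct.2) v c = 0 <->
    forall a b, \sum_(ct <- s) ct.1 * h (a ++ ct.2 ++ b) = 0.
Proof.
have [B [F [FD FZ FM [F1 F0 FS] Fnn]]] := adjointable_cstar form_semi_inner unit_vector.
exists B, (fun c => F (shift_op c)); split=> [c|s].
  by rewrite -FS; congr F; apply: adjointable_ext.
have -> : \sum_(ct <- s) ct.1 *: \prod_(c <- ct.2) F (shift_op c) = F (shift_comb s).
  elim: s => [|ct s IHs] /=; first by rewrite big_nil F0.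
  rewrite big_cons IHs FD FZ; congr (_ *: _ + _).
  elim: (ct.2) => [|c t IHt] /=; first by rewrite big_nil F1.
  by rewrite big_cons IHt FM.
split=> [/Fnn h0 a b|h0].
  rewrite -[a]revK -form_shift_comb; apply/eqP; rewrite -normr_eq0 rnormE.
  apply/eqP; congr (_%:C%C); apply/eqP; rewrite eq_le rnorm_ge0 andbT.
  by apply: le_trans (cauchy_schwarz form_semi_inner _ _) _; rewrite h0 mulr0.
apply/Fnn => f; apply/eqP; rewrite sqrtr_eq0 -lecR -(sqnE form_semi_inner).
pose A x := shift_comb s x; pose L := maxn (degree (A f)) (degree f).
rewrite (@form_expand A _ _ _ L) ?leq_maxl ?leq_maxr //; last first.
  exact: (op_lin (shift_comb s)).
rewrite big1 // => x _; apply: big1 => y _.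
by rewrite /A form_shift_comb h0 mulr0.
Qed.

End GNS.

(** * The vectors of words *)

Section Compat.
Variables (T : finType) (d0 : T).
Implicit Types (w s t : seq nat) (X Y A B : seq T).

(** The indices [X], placed on the points of [w], are constant on blocks: the analogue of [delta]
    for words. *)
Definition compat w X : bool := `[< exists g : nat -> T, X = map g w >].

Lemma compat_map (g : nat -> T) w : compat w (map g w).
Proof. by apply/asboolP; exists g. Qed.

Lemma compatP w X : size X = size w ->
  reflect (forall i j, (i < size w)%N -> (j < size w)%N ->
             nth 0%N w i = nth 0%N w j -> nth d0 X i = nth d0 X j) (compat w X).
Proof.
move=> sX; apply: (iffP (asboolP _)) => [[g ->] i j iw jw wij|h].
  by rewrite !(nth_map 0%N) // wij.
exists (fun a => nth d0 X (index a w)).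
apply: (@eq_from_nth _ d0); rewrite ?size_map // => i; rewrite sX => iw.
rewrite (nth_map 0%N) //; apply: h => //; last by rewrite nth_index ?mem_nth.
by rewrite index_mem mem_nth.
Qed.

Lemma compat_rename (f : nat -> nat) w X : {in w &, injective f} ->
  compat (map f w) X = compat w X.
Proof.
move=> inj; apply/asboolP/asboolP => -[g ->].
  by exists (g \o f); rewrite map_comp.
exists (fun a => g (nth 0%N w (index a (map f w)))).
rewrite -map_comp; apply/eq_in_map => a aw /=; congr g.
by apply: inj; rewrite ?mem_nth // -?(nth_map _ 0%N) ?nth_index ?map_f //
   -(size_map f) index_mem map_f.
Qed.

Lemma compat_catC s t A B : size A = size s -> size B = size t ->
  compat (s ++ t) (A ++ B) = compat (t ++ s) (B ++ A).
Proof.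
have imp u v D E : size D = size u -> compat (u ++ v) (D ++ E) -> compat (v ++ u) (E ++ D).
  move=> sD /asboolP[g]; rewrite map_cat => /eqP.
  rewrite eqseq_cat ?size_map // => /andP[/eqP-> /eqP->].
  by rewrite -map_cat; exact: compat_map.
by move=> sA sB; apply/idP/idP; exact: imp.
Qed.

Lemma compat_cat s t A B : {in s, forall x, x \notin t} -> size A = size s ->
  compat (s ++ t) (A ++ B) = compat s A && compat t B.
Proof.
move=> dis sA; apply/asboolP/andP => [[g]|[/asboolP[g ->] /asboolP[g' ->]]].
  rewrite map_cat => /eqP; rewrite eqseq_cat ?size_map // => /andP[/eqP-> /eqP->].
  by split; exact: compat_map.
exists (fun a => if a \in s then g a else g' a); rewrite map_cat; congr cat.
  by apply/eq_in_map => a ->.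
by apply/eq_in_map => a at_; case: ifP => // /dis; rewrite at_.
Qed.

Lemma compat_rev w X : compat (rev w) (rev X) = compat w X.
Proof.
apply/asboolP/asboolP => -[g E]; exists g; last by rewrite E map_rev.
by rewrite -[X]revK E map_rev revK.
Qed.

(* The number of loops removed when two adjacent letters are capped. *)
Lemma sum_compat_cap (C : nzRingType) a b s X : size X = size s ->
  \sum_i (compat [:: a, b & s] [:: i, i & X])%:R =
  (if (a \in s) || (b \in s) then 1 else #|T|%:R) * (compat (map (subst b a) s) X)%:R :> C.
Proof.
move=> sX; have [/asboolP[g XE]|nc] := boolP (compat (map (subst b a) s) X); last first.
  rewrite mulr0; apply: big1 => i _; rewrite /compat; case: asboolP => // -[g [/= ga gb XE]].
  case/asboolP: nc; exists g; rewrite -map_comp XE; apply/eq_in_map => x _ /=.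
  by rewrite /subst; case: eqP => // ->; rewrite -ga -gb.
rewrite -map_comp in XE; rewrite mulr1.
have gi i : ~~ ((a \in s) || (b \in s)) || (i == g a) -> compat [:: a, b & s] [:: i, i & X].
  move=> h; apply/asboolP.
  exists (fun x => if (x == a) || (x == b) then i else g (subst b a x)).
  rewrite /= !eqxx orbT /=; congr [:: _, _ & _]; rewrite XE; apply/eq_in_map => x xs /=.
  case: eqP => [xa|_] /=.
    move: h; rewrite -xa xs /= => /eqP->; rewrite /subst.
    by case: ifP => // _; rewrite xa.
  case: eqP => // xb; move: h; rewrite -xb xs orbT /= => /eqP->.
  by rewrite /subst xb eqxx.
case: ifP => abs; last first.
  rewrite (eq_bigr (fun=> 1)) ?sumr_const // => i _.
  by rewrite gi ?abs.
rewrite (bigD1 (g a)) //= gi ?eqxx ?orbT // big1 ?addr0 // => i /negPf ia.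
rewrite /compat; case: asboolP => // -[g' [/= ga gb]]; rewrite XE => /eq_in_map gg'.
move: ia; case/orP: abs => [as_|bs].
  by rewrite ga -(gg' _ as_) /= /subst if_same eqxx.
by rewrite gb -(gg' _ bs) /= /subst eqxx eqxx.
Qed.

End Compat.

(** * Subspaces spanned by the vectors of a class of words *)

Section FixSpaces.
Variables (C : numClosedFieldType) (T : finType) (W : seq nat -> Prop).
Implicit Types (w s t : seq nat) (X Y A B I J : seq T) (f g : seq T -> C).

Definition xi w X : C := (compat w X)%:R.

(* The span of the vectors attached to the words of [W] of length [N]; functions
   are only considered on words of length [N]. *)
Definition Fix (N : nat) f : Prop :=
  exists2 s : seq (C * seq nat), {in s, forall ct, W ct.2 /\ size ct.2 = N}
    & forall X, size X = N -> f X = \sum_(ct <- s) ct.1 * xi ct.2 X.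

Lemma Fix_ext N f g : (forall X, size X = N -> f X = g X) -> Fix N f -> Fix N g.
Proof. by move=> fg [s sW sE]; exists s => // X sX; rewrite -fg // sE. Qed.

Lemma Fix0 N : Fix N (fun=> 0).
Proof. by exists [::] => // X _; rewrite big_nil. Qed.

Lemma FixD N f g : Fix N f -> Fix N g -> Fix N (fun X => f X + g X).
Proof.
move=> [s sW sE] [t tW tE]; exists (s ++ t); last by move=> X sX; rewrite big_cat sE ?tE.
by move=> ct; rewrite mem_cat => /orP[/sW|/tW].
Qed.

Lemma FixZ N a f : Fix N f -> Fix N (fun X => a * f X).
Proof.
move=> [s sW sE]; exists (map (fun ct => (a * ct.1, ct.2)) s).
  by move=> _ /mapP[ct /sW ? ->].
by move=> X sX; rewrite big_map sE // mulr_sumr; apply: eq_bigr => ct _ /=; rewrite mulrA.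
Qed.

Lemma Fix_sum N (I : eqType) (r : seq I) (F : I -> seq T -> C) :
  {in r, forall i, Fix N (F i)} -> Fix N (fun X => \sum_(i <- r) F i X).
Proof.
elim: r => [|i r IHr] h.
  by apply: Fix_ext (Fix0 N) => X _; rewrite big_nil.
apply: (@Fix_ext _ (fun X => F i X + \sum_(i <- r) F i X)).
  by move=> X _; rewrite big_cons.
by apply: FixD; [apply: h|apply: IHr => j jr; apply: h]; rewrite inE ?eqxx ?jr ?orbT.
Qed.

Lemma Fix_xi w : W w -> Fix (size w) (xi w).
Proof.
move=> Ww; exists [:: (1, w)] => [ct|X _]; first by rewrite inE => /eqP->.
by rewrite big_seq1 mul1r.
Qed.

(** By linearity, a map given by summing over reindexed arguments has to be checked only on the
    vectors of words. *)
Lemma Fix_pull N N' (r : seq T -> seq (seq T)) f :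
  (forall X, size X = N' -> {in r X, forall Y, size Y = N}) ->
  (forall w, W w -> size w = N -> Fix N' (fun X => \sum_(Y <- r X) xi w Y)) ->
  Fix N f -> Fix N' (fun X => \sum_(Y <- r X) f Y).
Proof.
move=> rN Wr [s sW sE].
apply: (@Fix_ext _ (fun X => \sum_(ct <- s) ct.1 * \sum_(Y <- r X) xi ct.2 Y)).
  move=> X sX; rewrite [RHS]big_seq.
  under [RHS]eq_bigr => Y Yr do rewrite sE ?(rN X sX Y Yr) //.
  rewrite -[RHS]big_seq exchange_big; apply: eq_bigr => ct _.
  by rewrite mulr_sumr.
by apply: Fix_sum => ct /sW[? ?]; apply: FixZ; exact: Wr.
Qed.

Hypotheses (HW : word_class W) (Wrev : forall w, W w -> W (rev w)).
Variable d0 : T.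

Lemma Fix_rot m k f g : Fix (m + k) f ->
  (forall A B, size A = m -> size B = k -> g (B ++ A) = f (A ++ B)) -> Fix (k + m) g.
Proof.
move=> ff gf.
apply: (@Fix_ext _ (fun X => \sum_(Y <- [:: drop k X ++ take k X]) f Y)).
  move=> X sX; rewrite big_seq1 -gf ?cat_take_drop ?size_drop ?sX ?addKn //.
  by rewrite size_takel // sX leq_addr.
apply: (@Fix_pull (m + k)) ff.
  move=> X sX Y; rewrite inE => /eqP->.
  by rewrite size_cat size_drop size_takel ?sX ?leq_addr // addKn.
move=> w Ww sw; have := Fix_xi (wc_catC HW (_ : W (take m w ++ drop m w))).
rewrite cat_take_drop => /(_ Ww); rewrite size_cat size_drop size_takel sw ?leq_addr // addKn.
apply: Fix_ext => X sX; rewrite big_seq1 /xi.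
have := @compat_catC _ (drop m w) (take m w) (take k X) (drop k X).
rewrite !cat_take_drop => -> //.
  by rewrite size_takel ?size_drop ?sX ?sw ?addKn ?leq_addr.
by rewrite size_drop size_takel ?sX ?sw ?addKn ?leq_addr.
Qed.

Lemma Fix_rev N f : Fix N f -> Fix N (fun X => f (rev X)).
Proof.
move=> [s sW sE]; exists (map (fun ct => (ct.1, rev ct.2)) s).
  by move=> _ /mapP[ct /sW[Wct sct] ->]; split; [exact: Wrev|rewrite size_rev].
move=> X sX; rewrite big_map sE ?size_rev //; apply: eq_bigr => ct _ /=.
by rewrite -{2}[X]revK /xi compat_rev.
Qed.

Lemma Fix_cat M N f g h : Fix M f -> Fix N g ->
  (forall A B, size A = M -> size B = N -> h (A ++ B) = f A * g B) -> Fix (M + N) h.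
Proof.
move=> [s sW sE] [t tW tE] hE.
pose mv (w v : seq nat) := map (addn (fresh w)) v.
exists [seq (c.1 * d.1, c.2 ++ mv c.2 d.2) | c <- s, d <- t].
  move=> _ /allpairsP[[c d] /= [/sW[Wc sc] /tW[Wd sd] ->]] /=; split; last first.
    by rewrite size_cat size_map sc sd.
  apply: wc_cat => //; last by apply: wc_map => // x y _ _ /addnI.
  move=> x /fresh_bound xf; apply/negP => /mapP[y _ xE]; lia.
move=> X sX; rewrite -(cat_take_drop M X).
have sA : size (take M X) = M by rewrite size_takel // sX leq_addr.
have sB : size (drop M X) = N by rewrite size_drop sX addKn.
rewrite hE // sE // tE // [RHS]big_allpairs_dep mulr_suml.
rewrite [LHS]big_seq [RHS]big_seq; apply: eq_bigr => c /sW[Wc sc].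
rewrite mulr_sumr; apply: eq_bigr => d _ /=.
rewrite /xi compat_cat ?sA ?sc //; last first.
  by move=> x /fresh_bound xf; apply/negP => /mapP[y _ xE]; lia.
rewrite compat_rename; last by move=> x y _ _ /addnI.
by rewrite mulrACA -natrM mulnb.
Qed.

Lemma Fix_cap N f : Fix N.+2 f -> Fix N (fun X => \sum_i f [:: i, i & X]).
Proof.
move=> ff; apply: (@Fix_ext _ (fun X => \sum_(Y <- [seq [:: i, i & X] | i <- enum T]) f Y)).
  by move=> X _; rewrite big_map big_enum.
apply: Fix_pull ff; first by move=> X sX _ /mapP[i _ ->] /=; rewrite sX.
move=> [|a [|b w]] // Ww [sw]; have := FixZ (if (a \in w) || (b \in w) then 1 else #|T|%:R)
  (Fix_xi (wc_contract HW Ww)).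
rewrite size_map sw; apply: Fix_ext => X sX.
by rewrite /xi -sum_compat_cap ?sX // big_map big_enum.
Qed.

Lemma Fix_cap_at a b f g : Fix (a + b.+2) f ->
  (forall A B, size A = a -> size B = b -> g (A ++ B) = \sum_i f (A ++ [:: i, i & B])) ->
  Fix (a + b) g.
Proof.
move=> ff gf.
have h1 : Fix (b.+2 + a) (fun X => f (drop b.+2 X ++ take b.+2 X)).
  by apply: Fix_rot ff _ => A B sA sB; rewrite -sB take_size_cat // drop_size_cat.
have h2 := @Fix_cap (b + a) _ h1; apply: Fix_rot h2 _ => B A sB sA.
rewrite gf //; apply: eq_bigr => i _; congr f.
by rewrite /= take_size_cat // drop_size_cat.
Qed.

(** [rev I] and [I] are mirror images, so the two middle points carry the same index and the caps
    are nested; each induction step caps the innermost pair. *)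
Lemma Fix_caps k a b f g : Fix (a + (k + (k + b))) f ->
  (forall A B, size A = a -> size B = b ->
     g (A ++ B) = \sum_(I <- words T k) f (A ++ rev I ++ I ++ B)) ->
  Fix (a + b) g.
Proof.
elim: k f => [|k IHk] f ff gf.
  by apply: Fix_ext ff => X sX; rewrite -(cat_take_drop a X) gf ?big_words0 ?size_drop
    ?sX ?addKn // size_takel // sX leq_addr.
pose f' X := \sum_i f (take (a + k) X ++ [:: i, i & drop (a + k) X]).
apply: (IHk f').
  rewrite addnA; apply: (@Fix_cap_at (a + k) (k + b) f) => [|A B sA sB].
    by rewrite (_ : a + k + (k + b).+2 = a + (k.+1 + (k.+1 + b)))%N //; lia.
  by rewrite /f'; apply: eq_bigr => i _; rewrite take_size_cat ?drop_size_cat.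
move=> A B sA sB; rewrite gf // big_wordsS exchange_big; apply: eq_big_words => I sI.
rewrite /f'; apply: eq_bigr => i _; congr f.
have sAI : size (A ++ rev I) = (a + k)%N by rewrite size_cat size_rev sA sI.
by rewrite (catA A (rev I)) take_size_cat // drop_size_cat // rev_cons cat_rcons -!catA.
Qed.

(* The action of a morphism, given by the vector [tau], on [k] consecutive
   tensor factors. *)
Lemma Fix_act a k l b tau f g : Fix (k + l) tau -> Fix (a + (k + b)) f ->
  (forall A J B, size A = a -> size J = l -> size B = b ->
     g (A ++ J ++ B) = \sum_(I <- words T k) tau (rev I ++ J) * f (A ++ I ++ B)) ->
  Fix (a + (l + b)) g.
Proof.
move=> ft ff gE.
have h1 : Fix (l + k) (fun X => tau (drop l X ++ take l X)).
  by apply: Fix_rot ft _ => A B sA sB; rewrite take_size_cat // drop_size_cat.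
have h2 : Fix (k + b + a) (fun X => f (drop (k + b) X ++ take (k + b) X)).
  by apply: Fix_rot ff _ => A B sA sB; rewrite take_size_cat // drop_size_cat.
(* Placed side by side, the rotated [tau] reads [J ++ rev I] and the rotated [f] reads
   [I ++ B ++ A]. The two copies of [I] now face each other in mirror order and can be capped. *)
pose f' X := tau (drop l (take (l + k) X) ++ take l (take (l + k) X)) *
  f (drop (k + b) (drop (l + k) X) ++ take (k + b) (drop (l + k) X)).
have h3 : Fix (l + k + (k + b + a)) f'.
  by apply: Fix_cat h1 h2 _ => A B sA sB; rewrite /f' -sA take_size_cat // drop_size_cat.
pose g' X := g (drop (l + b) X ++ take (l + b) X).
have h4 : Fix (l + (b + a)) g'.
  apply: (@Fix_caps k l (b + a) f') => [|J Y sJ sY].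
    by rewrite -!addnA in h3 *.
  have [B [A [YE sB sA]]] : exists B A, [/\ Y = B ++ A, size B = b & size A = a].
    by exists (take b Y), (drop b Y); rewrite cat_take_drop size_drop size_takel sY ?addKn ?leq_addr.
  rewrite /g' YE catA take_size_cat ?drop_size_cat ?size_cat ?sJ ?sB // gE //.
  apply: eq_big_words => I sI; rewrite /f'.
  have sJI : size (J ++ rev I) = (l + k)%N by rewrite size_cat size_rev sJ sI.
  have sIB : size (I ++ B) = (k + b)%N by rewrite size_cat sI sB.
  rewrite (catA J) (take_size_cat _ sJI) (drop_size_cat _ sJI).
  rewrite (take_size_cat _ sJ) (drop_size_cat _ sJ).
  by rewrite (catA I) (take_size_cat _ sIB) (drop_size_cat _ sIB).
rewrite addnA in h4; apply: Fix_rot h4 _ => Y A sY sA.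
by rewrite /g' take_size_cat // drop_size_cat.
Qed.

End FixSpaces.

(** * Orthogonal projections *)

Section Projection.
Variables (C : numClosedFieldType) (X : eqType) (ws : seq X).
Implicit Types (f g v : X -> C) (x y z : X) (Q : (X -> C) -> Prop).

(** Membership in a span is expressed as membership in every such [Q] that contains the
    generators. *)
Definition lin_closed Q : Prop :=
  Q (fun=> 0) /\ forall a f g, Q f -> Q g -> Q (fun x => a * f x + g x).

Lemma lin_closed_sum Q (I : eqType) (r : seq I) (c : I -> C) (F : I -> X -> C) :
  lin_closed Q -> {in r, forall i, Q (F i)} -> Q (fun x => \sum_(i <- r) c i * F i x).
Proof.
move=> [Q0 QD]; elim: r => [|i r IHr] h.
  by under eq_fun do rewrite big_nil.
under eq_fun do rewrite big_cons.
by apply: QD; [apply: h|apply: IHr => j jr; apply: h]; rewrite inE ?eqxx ?jr ?orbT.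
Qed.

Definition dot f g : C := \sum_(y <- ws) f y * g y.

Lemma dot_lin_closed f : lin_closed (fun g => dot f g = 0).
Proof.
split; first by rewrite /dot big1 // => y _; rewrite mulr0.
move=> a g h g0 h0; rewrite -[RHS](mulr0 a) -[RHS]addr0 -{2}h0 -{1}g0 /dot mulr_sumr -big_split.
by apply: eq_bigr => y _ /=; ring.
Qed.

(* [P] is the matrix of the orthogonal projection onto the span of the [G i]. *)
Record projector (I : eqType) (r : seq I) (G : I -> X -> C) (P : X -> X -> C) : Prop :=
  Projector {
  projector_sym : forall x y, P x y = P y x;
  projector_real : forall x y, (P x y)^* = P x y;
  projector_span : forall Q, lin_closed Q -> {in r, forall i, Q (G i)} ->
    forall y, Q (fun x => P x y);
  projector_fix : {in r, forall i, {in ws, forall x, dot (P x) (G i) = G i x}} }.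

(** Gram-Schmidt: [eta] is the component of the new vector orthogonal to the earlier ones, and the
    matrix grows by [eta x * eta y / dot eta eta]. Since the vectors are real, the bilinear [dot] of
    [eta] with itself is a sum of squares. *)
Lemma projector_exists (I : eqType) (r : seq I) (G : I -> X -> C) :
  {in r, forall i x, (G i x)^* = G i x} -> exists P, projector r G P.
Proof.
elim: r => [|i r IHr] Greal.
  exists (fun _ _ => 0); split=> // [x y|Q [Q0 _] _ y //]; exact: rmorph0.
have [|P [Psym Preal Pspan Pfix]] := IHr.
  by move=> j jr; apply: Greal; rewrite inE jr orbT.
have Gi := Greal i (mem_head _ _).
pose eta x := G i x - dot (P x) (G i).
have eta_real x : (eta x)^* = eta x.
  rewrite /eta rmorphB /= Gi rmorph_sum; congr (_ - _); apply: eq_bigr => y _.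
  by rewrite rmorphM /= Preal Gi.
have Qeta Q : lin_closed Q -> {in i :: r, forall j, Q (G j)} -> Q eta.
  move=> Qlin QG; have [_ QD] := Qlin.
  have Qr : {in r, forall j, Q (G j)} by move=> j jr; apply: QG; rewrite inE jr orbT.
  have h1 : Q (fun x => \sum_(y <- ws) G i y * P x y).
    by apply: (@lin_closed_sum Q _ ws (G i) (fun y x => P x y)) => // y _; exact: Pspan.
  have := QD (-1) _ _ h1 (QG i (mem_head _ _)).
  suff -> : (fun x => -1 * (\sum_(y <- ws) G i y * P x y) + G i x) = eta by [].
  apply/funext => x; rewrite mulN1r addrC; congr (_ - _).
  by apply: eq_bigr => y _; rewrite mulrC.
have eta_orth j : j \in r -> dot eta (G j) = 0.
  move=> jr.
  have -> : dot eta (G j) = dot (G i) (G j) - \sum_(z <- ws) G i z * dot (P z) (G j).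
    rewrite /dot; under [X in _ = _ - X]eq_bigr do rewrite mulr_sumr.
    rewrite exchange_big -sumrB; apply: eq_bigr => y _ /=.
    rewrite mulrBl; congr (_ - _); rewrite /dot mulr_suml; apply: eq_bigr => z _.
    by rewrite (Psym z); ring.
  apply/eqP; rewrite subr_eq0; apply/eqP; apply: eq_big_seq => z zw.
  by rewrite Pfix.
have eta_P z : dot eta (fun x => P x z) = 0.
  by apply: (Pspan (fun f => dot eta f = 0)) => //; exact: dot_lin_closed.
have eta_i : dot eta (G i) = dot eta eta.
  have -> : dot eta (G i) = dot eta eta + \sum_(z <- ws) G i z * dot eta (fun x => P x z).
    rewrite /dot; under [X in _ = _ + X]eq_bigr do rewrite mulr_sumr.
    rewrite exchange_big -big_split; apply: eq_bigr => y _ /=.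
    rewrite -{1}(subrK (dot (P y) (G i)) (G i y)) mulrDr; congr (_ + _).
    by rewrite /dot mulr_sumr; apply: eq_bigr => z _; ring.
  by rewrite big1 ?addr0 // => z _; rewrite eta_P mulr0.
have eta_sq : dot eta eta = \sum_(y <- ws) `|eta y| ^+ 2.
  by apply: eq_bigr => y _; rewrite normCK eta_real.
(* If [eta] vanishes on [ws], the new vector is already fixed there and the old matrix serves
   again. *)
have [N0|N0] := eqVneq (dot eta eta) 0.
  exists P; split=> // [Q Qlin QG y|j].
    by apply: Pspan => // j jr; apply: QG; rewrite inE jr orbT.
  rewrite inE => /predU1P[-> x xw|]; last exact: Pfix.
  apply/esym/eqP; rewrite -subr_eq0 -/(eta x) -normr_eq0 -sqrf_eq0.
  move: N0; rewrite eta_sq => /eqP; rewrite psumr_eq0 => [/allP/(_ x xw)//|y _].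
  exact: exprn_ge0.
have Nreal : (dot eta eta)^* = dot eta eta.
  by rewrite rmorph_sum; apply: eq_bigr => y _; rewrite rmorphM /= eta_real.
exists (fun x y => P x y + eta x * eta y / dot eta eta); split.
- by move=> x y; rewrite Psym (mulrC (eta x)).
- by move=> x y; rewrite rmorphD rmorphM fmorphV rmorphM /= Preal !eta_real Nreal.
- move=> Q Qlin QG y; have [_ QD] := Qlin.
  have := QD (eta y / dot eta eta) _ _ (Qeta Q Qlin QG) (Pspan Q Qlin _ y).
  have -> : (fun x => P x y + eta x * eta y / dot eta eta) =
    (fun x => eta y / dot eta eta * eta x + P x y) by apply/funext => x; ring.
  by apply=> j jr; apply: QG; rewrite inE jr orbT.
- have E j x : dot (fun y => P x y + eta x * eta y / dot eta eta) (G j) =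
      dot (P x) (G j) + eta x / dot eta eta * dot eta (G j).
    rewrite /dot mulr_sumr -big_split; apply: eq_bigr => y _ /=; ring.
  move=> j; rewrite inE => /predU1P[-> x xw|jr x xw].
    by rewrite /= E eta_i divfK // addrC subrK.
  by rewrite /= E eta_orth // mulr0 addr0 Pfix.
Qed.

Section ProjectorTheory.
Variables (I : eqType) (r : seq I) (G : I -> X -> C) (P : X -> X -> C).
Hypothesis HP : projector r G P.

Lemma dot_fix_lin_closed :
  lin_closed (fun f => {in ws, forall x, dot (P x) f = f x}).
Proof.
split; first by move=> x _; rewrite /dot big1 // => y _; rewrite mulr0.
move=> a f g hf hg x xw; rewrite -hf // -hg // /dot mulr_sumr -big_split.
by apply: eq_bigr => y _ /=; ring.
Qed.

Lemma projector_idem x y : x \in ws -> \sum_(z <- ws) P x z * P z y = P x y.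
Proof.
move=> xw; have := projector_span HP dot_fix_lin_closed (projector_fix HP) y.
exact.
Qed.

(** By idempotence and symmetry the form is the squared norm of the projection of [v]. *)
Lemma projector_ge0 v :
  0 <= \sum_(x <- ws) \sum_(y <- ws) (v x)^* * v y * P x y.
Proof.
have -> : \sum_(x <- ws) \sum_(y <- ws) (v x)^* * v y * P x y =
    \sum_(z <- ws) `|dot (P z) v| ^+ 2.
  under [RHS]eq_bigr do rewrite normCKC /dot rmorph_sum /= mulr_suml.
  rewrite [RHS]exchange_big; apply: eq_big_seq => x xw /=.
  under [RHS]eq_bigr do rewrite mulr_sumr.
  rewrite [RHS]exchange_big; apply: eq_bigr => y _ /=.
  rewrite -projector_idem // mulr_sumr; apply: eq_bigr => z _.
  by rewrite rmorphM /= (projector_real HP) (projector_sym HP x); ring.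
by apply: sumr_ge0 => z _; exact: exprn_ge0.
Qed.

End ProjectorTheory.

End Projection.

Fixpoint nat_words (K n : nat) : seq (seq nat) :=
  if n is n'.+1 then [seq x :: w | x <- iota 0 K, w <- nat_words K n'] else [:: [::]].

Lemma mem_nat_words K n w :
  (w \in nat_words K n) = (size w == n) && all (fun x => x < K)%N w.
Proof.
elim: n w => [|n IHn] [|x w] //=.
  by apply/allpairsP => -[[y v] [_ _ /=]].
rewrite eqSS andbCA -IHn; apply/allpairsP/andP => [[[y v] /= [yK vn [-> ->]]]|[xK wn]].
  by rewrite vn; move: yK; rewrite mem_iota.
by exists (x, w); rewrite mem_iota.
Qed.

(** * Projections onto the spans of word vectors *)

Section FixProjector.
Variables (C : numClosedFieldType) (T : finType) (W : seq nat -> Prop).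
Hypotheses (HW : word_class W) (Wrev : forall w, W w -> W (rev w)).
Variable d0 : T.
Implicit Types (X Y A B I J : seq T) (f g : seq T -> C).

Local Notation Fix := (@Fix C T W).
Local Notation xi := (@xi C T).

(** Up to renaming, a word of length [N] uses only letters below [N]; this makes the spanning family
    finite. *)
Definition spanning_words N := [seq w <- nat_words N N | `[< W w >]].

Lemma projector_sub N : exists P, projector (words T N) (spanning_words N) xi P.
Proof. by apply: projector_exists => w _ X; exact: conjC_nat. Qed.

Definition proj N : seq T -> seq T -> C := sval (cid (projector_sub N)).

Lemma projP N : projector (words T N) (spanning_words N) xi (proj N).
Proof. exact: (svalP (cid (projector_sub N))). Qed.

Lemma Fix_lin_closed N : lin_closed (Fix N).
Proof. by split=> [|a f g ff fg]; [exact: Fix0|apply: FixD => //; exact: FixZ]. Qed.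

Lemma Fix_proj N Y : Fix N (fun X => proj N X Y).
Proof.
apply: (projector_span (projP N)); first exact: Fix_lin_closed.
move=> w; rewrite mem_filter => /andP[/asboolP Ww].
by rewrite mem_nat_words => /andP[/eqP sw _]; rewrite -{1}sw; exact: Fix_xi.
Qed.

Lemma Fix_projr N X : Fix N (fun Y => proj N X Y).
Proof.
by under eq_fun do rewrite (projector_sym (projP N)); exact: Fix_proj.
Qed.

Lemma proj_fix N f X : Fix N f -> size X = N ->
  \sum_(Y <- words T N) proj N X Y * f Y = f X.
Proof.
move=> [s sW sE] sX; have Xw : X \in words T N by rewrite mem_words sX.
transitivity (\sum_(ct <- s) ct.1 * dot (words T N) (proj N X) (xi ct.2)).
  rewrite (eq_big_words (G := fun Y => proj N X Y * \sum_(ct <- s) ct.1 * xi ct.2 Y)).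
    under eq_bigr do rewrite mulr_sumr.
    rewrite exchange_big; apply: eq_bigr => ct _; rewrite /dot mulr_sumr.
    by apply: eq_bigr => Y _; ring.
  by move=> Y sY; rewrite sE.
rewrite sE //; apply: eq_big_seq => ct /sW[Wct sct]; congr (_ * _).
(* Replacing each letter by its first position gives a word among the [spanning_words] with the same
   vector. *)
pose w := map (index^~ ct.2) ct.2.
have inj : {in ct.2 &, injective (index^~ ct.2)}.
  by move=> a b ain bin E; rewrite -(nth_index 0%N ain) E nth_index.
have xiE : xi ct.2 = xi w by apply/funext => Y; rewrite /xi compat_rename.
rewrite xiE (projector_fix (projP N)) // mem_filter mem_nat_words size_map sct eqxx.
apply/and3P; split=> //; first by apply/asboolP; exact: (wc_map HW).
by apply/allP => _ /mapP[a ain ->]; rewrite -sct index_mem.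
Qed.

(** If [o] maps [Fix M] into [Fix N], then [o] after the projection at [M] is not changed by
    projecting again at [N]. The transpose gives the mirror statement, so both sides equal the
    product of the two projections with [o] between them. *)
Lemma proj_commute M N (o : seq T -> seq T -> C) :
  (forall f, Fix M f -> Fix N (fun X => \sum_(Y <- words T M) o X Y * f Y)) ->
  (forall f, Fix N f -> Fix M (fun Y => \sum_(X <- words T N) o X Y * f X)) ->
  forall X Y, size X = N -> size Y = M ->
  \sum_(Z <- words T M) o X Z * proj M Z Y = \sum_(Z <- words T N) proj N X Z * o Z Y.
Proof.
move=> oMN oNM X Y sX sY.
have h1 := proj_fix (oMN _ (Fix_proj M Y)) sX.
have h2 := proj_fix (oNM _ (Fix_projr N X)) sY.
transitivity (\sum_(Z <- words T N) \sum_(Z' <- words T M) proj N X Z * o Z Z' * proj M Z' Y).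
  rewrite -h1; apply: eq_bigr => Z _; rewrite mulr_sumr.
  by apply: eq_bigr => Z' _; rewrite mulrA.
rewrite exchange_big; transitivity (\sum_(Z <- words T N) o Z Y * proj N X Z); last first.
  by apply: eq_bigr => Z _; rewrite mulrC.
rewrite -h2; apply: eq_bigr => Z' _; rewrite mulr_sumr.
by apply: eq_bigr => Z _; rewrite (projector_sym (projP M) Y); ring.
Qed.

(** Reversal is a permutation operator which preserves the span, since the class is closed under
    [rev]; hence it commutes with the projection. *)
Lemma proj_rev N X Y : size X = N -> size Y = N -> proj N (rev X) (rev Y) = proj N X Y.
Proof.
move=> sX sY; pose o X Y : C := (X == rev Y)%:R.
have oE Z g : size Z = N -> \sum_(Y <- words T N) o Z Y * g Y = g (rev Z).
  move=> sZ; rewrite (bigD1_seq (rev Z)) ?uniq_words ?mem_words ?size_rev ?sZ //=.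
  rewrite /o revK eqxx mul1r big1 ?addr0 // => Y' Y'Z.
  by rewrite eq_sym -(inj_eq (inv_inj revK)) revK (negPf Y'Z) mul0r.
have oE' Z g : size Z = N -> \sum_(Y <- words T N) o Y Z * g Y = g (rev Z).
  move=> sZ; rewrite -oE //; apply: eq_bigr => Y' _; congr (_%:R * _).
  by rewrite -(inj_eq (inv_inj revK)) revK eq_sym.
have := @proj_commute N N o _ _ X (rev Y) sX; rewrite size_rev => /(_ _ _ sY).
rewrite oE //; under eq_bigr do rewrite mulrC; rewrite oE' ?size_rev // revK; apply.
  move=> f ff; apply: Fix_ext (Fix_rev Wrev ff) => Z sZ; by rewrite oE.
move=> f ff; apply: Fix_ext (Fix_rev Wrev ff) => Z sZ; by rewrite oE'.
Qed.

Lemma proj_act a k l b tau A J B A' I' B' : Fix (k + l) tau ->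
  size A = a -> size J = l -> size B = b -> size A' = a -> size I' = k -> size B' = b ->
  \sum_(I <- words T k) tau (rev I ++ J) *
     proj (a + (k + b)) (A ++ I ++ B) (A' ++ I' ++ B') =
  \sum_(J' <- words T l) proj (a + (l + b)) (A ++ J ++ B) (A' ++ J' ++ B') *
     tau (rev I' ++ J').
Proof.
move=> ft sA sJ sB sA' sI' sB'.
(* The matrix of the operator that acts by [tau] on the middle factors and as the identity on the
   outer [a] and [b] factors. *)
pose o X Y : C := ((take a X == take a Y) && (drop l (drop a X) == drop k (drop a Y)))%:R
  * tau (rev (take k (drop a Y)) ++ take l (drop a X)).
have parts m (D E F : seq T) : size D = a -> size E = m ->
    [/\ take a (D ++ E ++ F) = D, take m (drop a (D ++ E ++ F)) = E
      & drop m (drop a (D ++ E ++ F)) = F].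
  by move=> sD sE; rewrite take_size_cat // drop_size_cat // take_size_cat // drop_size_cat.
have sum_block m g D F : size D = a -> size F = b ->
    \sum_(X <- words T (a + (m + b)))
      ((take a X == D) && (drop m (drop a X) == F))%:R * g X =
    \sum_(E <- words T m) g (D ++ E ++ F) :> C.
  move=> sD sF; rewrite big_words_cat.
  rewrite (bigD1_seq D) ?uniq_words ?mem_words ?sD //= [X in _ + X]big_seq_cond.
  rewrite [X in _ + X]big1 ?addr0 => [|D' /andP[D'a D'D]]; last first.
    apply: big1 => Z _; rewrite take_size_cat; last by apply/eqP; rewrite -mem_words.
    by rewrite (negPf D'D) mul0r.
  rewrite big_words_cat; apply: eq_big_words => E sE.
  rewrite (bigD1_seq F) ?uniq_words ?mem_words ?sF //= [X in _ + X]big1 ?addr0.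
    by have [-> _ ->] := parts m D E F sD sE; rewrite !eqxx mul1r.
  by move=> F' F'F; have [-> _ ->] := parts m D E F' sD sE; rewrite eqxx (negPf F'F) mul0r.
have oX g D K F : size D = a -> size K = l -> size F = b ->
    \sum_(Y <- words T (a + (k + b))) o (D ++ K ++ F) Y * g Y =
    \sum_(I <- words T k) tau (rev I ++ K) * g (D ++ I ++ F).
  move=> sD sK sF; have [E1 E2 E3] := parts l D K F sD sK; rewrite /o E1 E2 E3.
  transitivity (\sum_(Y <- words T (a + (k + b)))
    ((take a Y == D) && (drop k (drop a Y) == F))%:R *
      (tau (rev (take k (drop a Y)) ++ K) * g Y)).
    by apply: eq_bigr => Y _; rewrite (eq_sym D) (eq_sym F) mulrA.
  rewrite sum_block //; apply: eq_big_words => I sI.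
  by have [_ -> _] := parts k D I F sD sI.
have oY g D K F : size D = a -> size K = k -> size F = b ->
    \sum_(X <- words T (a + (l + b))) o X (D ++ K ++ F) * g X =
    \sum_(I <- words T l) tau (rev K ++ I) * g (D ++ I ++ F).
  move=> sD sK sF; have [E1 E2 E3] := parts k D K F sD sK; rewrite /o E1 E2 E3.
  transitivity (\sum_(Y <- words T (a + (l + b)))
    ((take a Y == D) && (drop l (drop a Y) == F))%:R *
      (tau (rev K ++ take l (drop a Y)) * g Y)).
    by apply: eq_bigr => Y _; rewrite mulrA.
  rewrite sum_block //; apply: eq_big_words => I sI.
  by have [_ -> _] := parts l D I F sD sI.
rewrite -(oX (fun Z => proj (a + (k + b)) Z (A' ++ I' ++ B'))) //.
under [RHS]eq_bigr do rewrite mulrC.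
rewrite -(oY (proj (a + (l + b)) (A ++ J ++ B))) //.
rewrite (@proj_commute (a + (k + b)) (a + (l + b)) o).
- by apply: eq_bigr => Z _; rewrite mulrC.
- move=> f ff; apply: (@Fix_act C T W HW a k l b tau f) => // D K F sD sK sF.
  by rewrite oX.
- move=> f ff; apply: (@Fix_act C T W HW a l k b (fun X => tau (rev X)) f) => //.
    by rewrite addnC; exact: (Fix_rev Wrev).
  move=> D K F sD sK sF; rewrite oY //; apply: eq_bigr => I _.
  by rewrite rev_cat revK.
- by rewrite !size_cat sA sJ sB.
- by rewrite !size_cat sA' sI' sB'.
Qed.

End FixProjector.

(** * The Haar state *)

Section HaarState.
Variables (R : realType) (D : finType) (W : seq nat -> Prop).
Hypotheses (HW : word_class W) (Wrev : forall w, W w -> W (rev w)).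
Variable d0 : D.
Implicit Types (X Y A B I J : seq D) (x y z : seq (D * D)).

Local Notation C := R[i].
Local Notation Fix := (@Fix C D W).
Local Notation P X Y := (@proj C D W (size X) X Y).

(* The value of the Haar functional on a word [u i1 j1 * u i2 j2 * ...], the integral
   of the matrix [u] to a tensor power being the projection onto the fixed vectors. *)
Definition haar x : C := P (unzip1 x) (unzip2 x).

Lemma unzip_cat (T U : Type) (x y : seq (T * U)) :
  unzip1 (x ++ y) = unzip1 x ++ unzip1 y /\ unzip2 (x ++ y) = unzip2 x ++ unzip2 y.
Proof. by rewrite /unzip1 /unzip2 !map_cat. Qed.

Lemma unzip_rev (T U : Type) (x : seq (T * U)) :
  unzip1 (rev x) = rev (unzip1 x) /\ unzip2 (rev x) = rev (unzip2 x).
Proof. by rewrite /unzip1 /unzip2 !map_rev. Qed.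

Lemma haar_cat x y : haar (x ++ y) =
  P (unzip1 x ++ unzip1 y) (unzip2 x ++ unzip2 y).
Proof. by rewrite /haar; have [-> ->] := unzip_cat x y. Qed.

Lemma proj_sym N X Y : @proj C D W N X Y = @proj C D W N Y X.
Proof. exact: (projector_sym (projP C D W N)). Qed.

Lemma proj_real N X Y : (@proj C D W N X Y)^* = @proj C D W N X Y.
Proof. exact: (projector_real (projP C D W N)). Qed.

Lemma haar_real x : (haar x)^* = haar x.
Proof. exact: proj_real. Qed.

Lemma haar_rev x : haar (rev x) = haar x.
Proof.
rewrite /haar; have [-> ->] := unzip_rev x.
by rewrite size_rev proj_rev // !size_map.
Qed.

Lemma haar_act k l tau A J B A' I' B' : Fix (k + l) tau ->
  size A = size A' -> size B = size B' -> size J = l -> size I' = k ->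
  \sum_(I <- words D k) tau (rev I ++ J) * P (A ++ I ++ B) (A' ++ I' ++ B') =
  \sum_(J' <- words D l) P (A ++ J ++ B) (A' ++ J' ++ B') * tau (rev I' ++ J').
Proof.
move=> ft sA sB sJ sI'.
have := proj_act HW Wrev ft sA sJ sB erefl sI' erefl.
rewrite !size_cat sA sB sJ => <-; apply: eq_big_words => I sI.
by rewrite !size_cat sA sB sI.
Qed.

Lemma haar_nil : haar [::] = 1.
Proof.
have W0 : W [::] by exact: (wc_contract HW (wc_pair HW)).
have := @proj_fix C D W HW 0 (@xi C D [::]) [::] (Fix_xi C D W0) erefl.
rewrite big_words0 /xi (_ : compat [::] [::]) ?mulr1 //.
by apply/asboolP; exists (fun=> d0).
Qed.

Let K x y : C := haar (rev x ++ y).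

Let K_sym x y : K x y = K y x.
Proof. by rewrite /K -haar_rev rev_cat revK. Qed.

(* Kernels intertwining all morphisms of the category. *)
Definition commutant (L : nat) (e : seq (D * D) -> C) : Prop :=
  forall k l tau I'' J, (k < L)%N -> (l < L)%N -> Fix (k + l) tau ->
  size I'' = l -> size J = k ->
  \sum_(I <- words D k) tau (I ++ rev I'') * e (zip I J) =
  \sum_(J'' <- words D l) e (zip I'' J'') * tau (J ++ rev J'').

Lemma commutant_lin_closed L : lin_closed (commutant L).
Proof.
split=> [k l tau I'' J _ _ _ _ _|a f g hf hg k l tau I'' J kL lL ft sI sJ].
  by rewrite !big1 // => *; rewrite (mulr0, mul0r).
under eq_bigr do rewrite mulrDr mulrCA.
under [RHS]eq_bigr do rewrite mulrDl -mulrA.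
rewrite !big_split -!mulr_sumr /=; congr (_ * _ + _).
  exact: (hf k l tau).
exact: (hg k l tau).
Qed.

Let zipK (I J : seq D) : size I = size J -> unzip1 (zip I J) = I /\ unzip2 (zip I J) = J.
Proof. by move=> IJ; rewrite unzip1_zip ?unzip2_zip ?IJ. Qed.

Lemma KE I J I' J' : size I = size J -> size I' = size J' ->
  K (zip I J) (zip I' J') = P (rev I ++ I') (rev J ++ J').
Proof.
move=> sIJ sIJ'; rewrite /K haar_cat; have [-> ->] := unzip_rev (zip I J).
by have [-> ->] := zipK sIJ; have [-> ->] := zipK sIJ'.
Qed.

(** The kernel reads its left argument reversed; undoing this turns [haar_act] into the identity
    required by [commutant]. *)
Lemma commutant_K L y : commutant L (fun x => K x y).
Proof.
move=> k l tau I'' J kL lL ft sI'' sJ.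
have := @haar_act k l tau [::] (rev I'') (unzip1 y) [::] (rev J) (unzip2 y) ft.
rewrite !size_map !size_rev => /(_ erefl erefl sI'' sJ) /=.
rewrite big_words_rev => E.
transitivity (\sum_(I <- words D k) tau (rev (rev I) ++ rev I'') *
   P (rev I ++ unzip1 y) (rev J ++ unzip2 y)).
  apply: eq_big_words => I sI; rewrite revK /K haar_cat.
  have [-> ->] := unzip_rev (zip I J).
  by have [|-> ->] := @zipK I J; rewrite ?sI ?sJ.
rewrite E [LHS]big_words_rev; apply: eq_big_words => J'' sJ''; rewrite revK.
rewrite /K haar_cat; have [-> ->] := unzip_rev (zip I'' J'').
by have [|-> ->] := @zipK I'' J''; rewrite ?sI'' ?sJ''.
Qed.

(** A rotated column of the projection is itself the vector of a morphism. In [commutant_ge0] it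
    takes the role of [tau]. *)
Lemma Fix_P l k I J J' : size I = k ->
  Fix (l + k) (fun X => @proj C D W (k + l) (drop l X ++ take l X) (rev J ++ J')).
Proof.
move=> sI; have h := Fix_proj C W (k + l) (rev J ++ J') : Fix _ _.
apply: (Fix_rot HW h) => A B sA sB.
by rewrite -sB take_size_cat // drop_size_cat.
Qed.

Lemma big_upto_zip (V : nmodType) L (F : seq (D * D) -> V) :
  \sum_(x <- upto (D * D)%type L) F x =
  \sum_(k < L) \sum_(I <- words D k) \sum_(J <- words D k) F (zip I J).
Proof.
rewrite big_upto; apply: eq_bigr => k _.
rewrite -(big_words_zip k (fun I J => F (zip I J))).
by apply: eq_bigr => x _; rewrite zip_unzip.
Qed.

(* Moving [e] across the projection turns the sum into sums [v^* P v]. *)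
Lemma commutant_ge0 L e : commutant L e ->
  0 <= \sum_(x <- upto (D * D)%type L) \sum_(y <- upto (D * D)%type L) (e x)^* * e y * K x y.
Proof.
move=> ce; rewrite big_upto_zip; apply: sumr_ge0 => k _.
under eq_bigr => I _ do under eq_bigr => J _ do rewrite big_upto_zip.
under eq_bigr => I _ do rewrite exchange_big /=.
rewrite exchange_big; apply: sumr_ge0 => l _ /=.
rewrite big_seq; apply: sumr_ge0 => I; rewrite mem_words => /eqP sI.
have step J J' : size J = k -> size J' = l ->
    \sum_(I' <- words D l) (e (zip I J))^* * e (zip I' J') * K (zip I J) (zip I' J') =
    \sum_(Y <- words D k) (e (zip I J))^* * e (zip I Y) *
       @proj C D W (k + l) (rev Y ++ J') (rev J ++ J').
  move=> sJ sJ'.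
  have := ce l k _ I J' (ltn_ord l) (ltn_ord k) (Fix_P l J J' sI) sI sJ'.
  move=> /(congr1 (fun a : C => (e (zip I J))^* * a)); rewrite !mulr_sumr => E.
  transitivity (\sum_(I' <- words D l) (e (zip I J))^* *
     (@proj C D W (k + l) (drop l (I' ++ rev I) ++ take l (I' ++ rev I)) (rev J ++ J') *
      e (zip I' J'))).
    apply: eq_big_words => I' sI'; rewrite KE ?sI ?sI' ?sJ ?sJ' //.
    rewrite -sI' take_size_cat // drop_size_cat // size_cat size_rev sI sI'; ring.
  rewrite E; apply: eq_big_words => Y sY.
  by rewrite -sJ' take_size_cat // drop_size_cat //; ring.
under eq_bigr => J _ do rewrite exchange_big /=.
rewrite exchange_big /= big_seq; apply: sumr_ge0 => J'; rewrite mem_words => /eqP sJ'.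
rewrite (eq_big_words (G := fun J => \sum_(Y <- words D k) (e (zip I J))^* * e (zip I Y) *
       @proj C D W (k + l) (rev Y ++ J') (rev J ++ J'))); last by move=> J sJ; exact: step.
(* For fixed [I] and [J'] the remaining double sum is the value of the projection on this vector,
   which is supported on the words that end in [J']. *)
pose v X : C := (drop k X == J')%:R * e (zip I (rev (take k X))).
have := projector_ge0 (projP C D W (k + l)) v.
suff -> : \sum_(X <- words D (k + l)) \sum_(Y <- words D (k + l)) (v X)^* * v Y *
    @proj C D W (k + l) X Y =
  \sum_(J <- words D k) \sum_(Y <- words D k) (e (zip I J))^* * e (zip I Y) *
       @proj C D W (k + l) (rev Y ++ J') (rev J ++ J') by [].
have sum_v (g : seq D -> C) : \sum_(Y <- words D (k + l)) v Y * g Y =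
    \sum_(Y <- words D k) e (zip I Y) * g (rev Y ++ J').
  rewrite big_words_cat big_words_rev; apply: eq_big_words => Y sY.
  have sRY : size (rev Y) = k by rewrite size_rev.
  rewrite (bigD1_seq J') ?uniq_words ?mem_words ?sJ' //= /v big1 ?addr0.
    by rewrite (take_size_cat _ sRY) (drop_size_cat _ sRY) eqxx mul1r revK.
  by move=> Z ZJ'; rewrite (drop_size_cat _ sRY) (negPf ZJ') !mul0r.
have sum_vJ (g : seq D -> C) : \sum_(Y <- words D (k + l)) (v Y)^* * g Y =
    \sum_(Y <- words D k) (e (zip I Y))^* * g (rev Y ++ J').
  rewrite -[LHS]conjCK -[RHS]conjCK; congr (_^* ).
  rewrite !rmorph_sum; under eq_bigr do rewrite rmorphM /= conjCK.
  rewrite (sum_v (fun Y => (g Y)^* )); apply: eq_bigr => Y _.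
  by rewrite rmorphM /= conjCK.
transitivity (\sum_(X <- words D (k + l)) (v X)^* *
    \sum_(Y <- words D (k + l)) v Y * @proj C D W (k + l) X Y).
  apply: eq_bigr => X _; rewrite mulr_sumr; apply: eq_bigr => Y _; exact: esym (mulrA _ _ _).
rewrite sum_vJ; apply: eq_bigr => J _; rewrite sum_v mulr_sumr.
by apply: eq_bigr => Y _; rewrite proj_sym mulrA.
Qed.

(** An arbitrary [c] has no reason to intertwine anything. Its orthogonal projection [e] onto the
    span of the columns of [K] does, because the columns do, and the form takes the same value on
    [c] and [e]. *)
Lemma haar_ge0 L (c : seq (D * D) -> C) :
  0 <= \sum_(x <- upto (D * D)%type L) \sum_(y <- upto (D * D)%type L) (c x)^* * c y * K x y.
Proof.
set ws := upto _ L.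
have [|E HE] := @projector_exists C _ ws _ ws (fun y x => K x y).
  by move=> y _ x; exact: haar_real.
pose e x := \sum_(y <- ws) c y * E x y.
have ce : commutant L e.
  apply: (@lin_closed_sum C _ (commutant L) _ ws c (fun y x => E x y)).
    exact: commutant_lin_closed.
  move=> y _; apply: (projector_span HE); first exact: commutant_lin_closed.
  by move=> z _; exact: commutant_K.
(* [c - e] is orthogonal to the range of [K]. *)
have orth y : y \in ws -> \sum_(x <- ws) c x * K x y = \sum_(x <- ws) e x * K x y.
  move=> yw; under [RHS]eq_bigr do rewrite mulr_suml.
  rewrite [RHS]exchange_big; apply: eq_big_seq => z zw.
  rewrite -(projector_fix HE yw zw) /dot mulr_sumr; apply: eq_bigr => x _.
  by rewrite (projector_sym HE z) mulrA.
have KJ x y : (K x y)^* = K x y by exact: haar_real.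
have orthJ y : y \in ws ->
    \sum_(x <- ws) (c x)^* * K x y = \sum_(x <- ws) (e x)^* * K x y.
  move=> yw; have := congr1 Num.conj (orth y yw); rewrite !rmorph_sum /=.
  by under eq_bigr do rewrite rmorphM /= KJ;
     under [X in _ = X -> _]eq_bigr do rewrite rmorphM /= KJ.
have -> : \sum_(x <- ws) \sum_(y <- ws) (c x)^* * c y * K x y =
    \sum_(x <- ws) \sum_(y <- ws) (e x)^* * e y * K x y.
  transitivity (\sum_(y <- ws) c y * \sum_(x <- ws) (c x)^* * K x y).
    rewrite exchange_big; apply: eq_bigr => y _; rewrite mulr_sumr.
    by apply: eq_bigr => x _; ring.
  rewrite (eq_big_seq (fun y => c y * \sum_(x <- ws) (e x)^* * K x y)); last first.
    by move=> y yw; rewrite orthJ.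
  transitivity (\sum_(x <- ws) (e x)^* * \sum_(y <- ws) c y * K y x).
    under eq_bigr do rewrite mulr_sumr.
    rewrite exchange_big; apply: eq_bigr => x _; rewrite mulr_sumr.
    by apply: eq_bigr => y _; rewrite (K_sym y); ring.
  apply: eq_big_seq => x xw; rewrite orth // mulr_sumr; apply: eq_bigr => y _.
  by rewrite (K_sym y); ring.
exact: commutant_ge0.
Qed.

(* Capping a pair: the relation [\sum_i u i j * u i j' = (j == j')]. *)
Lemma haar_cap j x y :
  \sum_i haar (x ++ [:: (i, j), (i, j) & y]) = haar (x ++ y).
Proof.
have ft : Fix (2 + 0) (@xi C D [:: 0; 0]%N) by exact: Fix_xi (wc_pair HW).
have xi2 (a b : D) : @xi C D [:: 0; 0]%N [:: a; b] = (a == b)%:R.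
  rewrite /xi; congr (_%:R); congr nat_of_bool; apply/asboolP/eqP => [[g [-> ->]] //|->].
  by exists (fun=> b).
have := @haar_act 2 0 _ (unzip1 x) [::] (unzip1 y) (unzip2 x) [:: j; j] (unzip2 y) ft.
rewrite !size_map => /(_ erefl erefl erefl erefl).
rewrite big_words0 xi2 eqxx mulr1 haar_cat => <-.
rewrite !big_wordsS; apply: eq_bigr => i _.
rewrite big_wordsS (bigD1 i) //= big_words0 [rev _]/= xi2 eqxx mul1r big1 ?addr0.
  by rewrite haar_cat.
by move=> i' i'i; rewrite big_words0 xi2 (negPf i'i) mul0r.
Qed.

(** By [haar_cap] the right side is the sum, over the rows [i], of the left sides for the letters
    [(i, j)]. All terms are nonnegative, so a single one is at most the sum. *)
Lemma haar_bound g L (c : seq (D * D) -> C) :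
  \sum_(x <- upto (D * D)%type L) \sum_(y <- upto (D * D)%type L)
     (c x)^* * c y * haar (rev x ++ [:: g, g & y])
  <= \sum_(x <- upto (D * D)%type L) \sum_(y <- upto (D * D)%type L)
     (c x)^* * c y * haar (rev x ++ y).
Proof.
case: g => i j; pose F i := \sum_(x <- upto (D * D)%type L) \sum_(y <- upto (D * D)%type L)
   (c x)^* * c y * haar (rev x ++ [:: (i, j), (i, j) & y]).
have -> : \sum_(x <- upto (D * D)%type L) \sum_(y <- upto (D * D)%type L)
     (c x)^* * c y * haar (rev x ++ y) = \sum_i F i.
  rewrite /F [RHS]exchange_big; apply: eq_bigr => x _; rewrite [RHS]exchange_big.
  by apply: eq_bigr => y _; rewrite -mulr_sumr haar_cap.
rewrite -[X in X <= _]/(F i) (bigD1 i) //= lerDl; apply: sumr_ge0 => i' _.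
(* The polynomial [c] multiplied from the left by the letter [(i', j)]; lengths grow by one, hence
   the level [L.+1]. *)
pose c' x := if x is g :: x' then if g == (i', j) then c x' else 0 else 0.
suff -> : F i' = \sum_(x <- upto (D * D)%type L.+1) \sum_(y <- upto (D * D)%type L.+1)
    (c' x)^* * c' y * K x y by exact: haar_ge0.
have sum_c' (G : seq (D * D) -> C) : \sum_(y <- upto (D * D)%type L.+1) c' y * G y =
    \sum_(y <- upto (D * D)%type L) c y * G ((i', j) :: y).
  rewrite big_upto big_ord_recl big_words0 mul0r add0r big_upto; apply: eq_bigr => k _.
  rewrite big_wordsS (bigD1 (i', j)) //= eqxx [X in _ + X]big1 ?addr0 // => g' g'i.
  by rewrite (negPf g'i) big1 // => y _; rewrite mul0r.
have sum_c'J (G : seq (D * D) -> C) : \sum_(y <- upto (D * D)%type L.+1) (c' y)^* * G y =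
    \sum_(y <- upto (D * D)%type L) (c y)^* * G ((i', j) :: y).
  rewrite -[LHS]conjCK -[RHS]conjCK; congr (_^* ).
  rewrite !rmorph_sum; under eq_bigr do rewrite rmorphM /= conjCK.
  rewrite (sum_c' (fun z => (G z)^* )); apply: eq_bigr => Y _.
  by rewrite rmorphM /= conjCK.
transitivity (\sum_(x <- upto (D * D)%type L.+1) (c' x)^* *
    \sum_(y <- upto (D * D)%type L.+1) c' y * K x y); last first.
  by apply: eq_bigr => x _; rewrite mulr_sumr; apply: eq_bigr => y _; rewrite mulrA.
rewrite sum_c'J; apply: eq_bigr => x _; rewrite sum_c' mulr_sumr.
apply: eq_bigr => y _; rewrite mulrA /K rev_cons cat_rcons //.
Qed.

Lemma haar_state : state haar.
Proof.
split; first exact: haar_nil.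
- by move=> x; rewrite haar_real haar_rev.
- exact: haar_ge0.
- exact: haar_bound.
Qed.

End HaarState.

(** * Fixed vectors and intertwiners *)

Section FixedVectors.
Variables (C : numClosedFieldType) (A : algType C) (D : finType) (u : D -> D -> A).
Hypothesis u_row : forall i j, \sum_k u i k * u j k = (i == j)%:R.
Hypothesis u_col : forall i j, \sum_k u k i * u k j = (i == j)%:R.
Implicit Types (I J K X Y : seq D) (f g : seq D -> C).

Definition uprod I J : A := \prod_(ij <- zip I J) u ij.1 ij.2.

Lemma uprod_cons i I j J : uprod (i :: I) (j :: J) = u i j * uprod I J.
Proof. by rewrite /uprod /= big_cons. Qed.

Lemma uprod_nil : uprod [::] [::] = 1.
Proof. by rewrite /uprod big_nil. Qed.

Lemma uprod_cat I J I' J' : size I = size J ->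
  uprod (I ++ I') (J ++ J') = uprod I J * uprod I' J'.
Proof. by move=> IJ; rewrite /uprod zip_cat // big_cat. Qed.

Lemma uprod_rcons I i J j : size I = size J ->
  uprod (rcons I i) (rcons J j) = uprod I J * u i j.
Proof. by move=> IJ; rewrite -!cats1 uprod_cat // /uprod /= big_seq1. Qed.

(** The entries need not commute, so the first factor is written in reverse order: its last entry
    then meets the first entry of the second factor, and they cancel from the inside outwards. *)
Lemma uprod_row k I J : size I = k -> size J = k ->
  \sum_(K <- words D k) uprod (rev I) (rev K) * uprod J K = (I == J)%:R.
Proof.
elim: k I J => [|k IHk] [|i I] [|j J] //=; first by rewrite big_seq1 uprod_nil mulr1.
move=> [sI] [sJ]; rewrite (big_wordsS k (fun K => uprod (rev (i :: I)) (rev K) * uprod (j :: J) K)).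
rewrite exchange_big /=.
transitivity (\sum_(K <- words D k) uprod (rev I) (rev K) * (i == j)%:R * uprod J K).
  apply: eq_big_words => K sK; rewrite -u_row mulr_sumr mulr_suml.
  apply: eq_bigr => k0 _; rewrite !rev_cons uprod_rcons ?size_rev ?sK //.
  by rewrite uprod_cons !mulrA.
rewrite eqseq_cons; case: eqP => _ /=; last by rewrite big1 // => K _; rewrite mulr0 mul0r.
by rewrite -IHk //; apply: eq_bigr => K _; rewrite mulr1.
Qed.

Lemma uprod_col k I J : size I = k -> size J = k ->
  \sum_(K <- words D k) uprod (rev K) (rev I) * uprod K J = (I == J)%:R.
Proof.
elim: k I J => [|k IHk] [|i I] [|j J] //=; first by rewrite big_seq1 uprod_nil mulr1.
move=> [sI] [sJ]; rewrite (big_wordsS k (fun K => uprod (rev K) (rev (i :: I)) * uprod K (j :: J))).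
rewrite exchange_big /=.
transitivity (\sum_(K <- words D k) uprod (rev K) (rev I) * (i == j)%:R * uprod K J).
  apply: eq_big_words => K sK; rewrite -u_col mulr_sumr mulr_suml.
  apply: eq_bigr => k0 _; rewrite !rev_cons uprod_rcons ?size_rev ?sK //.
  by rewrite uprod_cons !mulrA.
rewrite eqseq_cons; case: eqP => _ /=; last by rewrite big1 // => K _; rewrite mulr0 mul0r.
by rewrite -IHk //; apply: eq_bigr => K _; rewrite mulr1.
Qed.

Definition fixed (N : nat) f : Prop :=
  forall I, size I = N -> \sum_(J <- words D N) f J *: uprod I J = (f I)%:A.

Lemma fixed_ext N f g : (forall X, size X = N -> f X = g X) -> fixed N f -> fixed N g.
Proof.
move=> fg hf I sI; rewrite -fg // -hf //; apply: eq_big_words => J sJ.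
by rewrite fg.
Qed.

Lemma fixed_sum N (T : eqType) (r : seq T) (F : T -> seq D -> C) :
  {in r, forall i, fixed N (F i)} -> fixed N (fun X => \sum_(i <- r) F i X).
Proof.
move=> h I sI; under eq_bigr do rewrite scaler_suml.
by rewrite exchange_big scaler_suml; apply: eq_big_seq => i ir; exact: h.
Qed.

Lemma fixedZ N a f : fixed N f -> fixed N (fun X => a * f X).
Proof.
move=> h I sI; under eq_bigr do rewrite -scalerA.
by rewrite -scaler_sumr h // scalerA.
Qed.

Lemma fixed_cat M N f g h : fixed M f -> fixed N g ->
  (forall X Y, size X = M -> size Y = N -> h (X ++ Y) = f X * g Y) -> fixed (M + N) h.
Proof.
move=> hf hg hE X sX; rewrite -(cat_take_drop M X).
have sA : size (take M X) = M by rewrite size_takel // sX leq_addr.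
have sB : size (drop M X) = N by rewrite size_drop sX addKn.
rewrite hE // -scalerA -[(g _)%:A]mul1r scalerAl -hf // -hg // big_words_cat mulr_suml.
apply: eq_big_words => Y sY; rewrite mulr_sumr; apply: eq_big_words => Z sZ.
by rewrite hE // uprod_cat ?sA ?sY // -scalerAl -scalerAr scalerA.
Qed.

(** Multiplying the fixed-point equation from the left by [u k a] and summing over [k] removes the
    first tensor factor, by [u_col]. Multiplying from the right by [u i a] and summing over [a] puts
    it at the end, by [u_row]. *)
Lemma fixed_rot N f g : fixed N.+1 f ->
  (forall i X, size X = N -> g (rcons X i) = f (i :: X)) -> fixed N.+1 g.
Proof.
move=> hf gE X sX; case/lastP: X sX => [//|X i]; rewrite size_rcons => -[sX].
have move_first (a : D) :
    \sum_(J <- words D N) f (a :: J) *: uprod X J = \sum_k f (k :: X) *: u k a.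
  transitivity (\sum_j \sum_(J <- words D N) f (j :: J) *: ((a == j)%:R * uprod X J)).
    rewrite (bigD1 a) //= [X in _ = _ + X]big1 ?addr0 => [|j ja].
      by apply: eq_bigr => J _; rewrite eqxx mul1r.
    by apply: big1 => J _; rewrite eq_sym (negPf ja) mul0r scaler0.
  transitivity (\sum_k u k a * (f (k :: X))%:A); last first.
    by apply: eq_bigr => k _; rewrite mulr_algr.
  under [RHS]eq_bigr => k _ do rewrite -hf ?big_wordsS /= ?sX // mulr_sumr.
  rewrite [RHS]exchange_big; apply: eq_bigr => j _ /=.
  under [RHS]eq_bigr do rewrite mulr_sumr.
  rewrite [RHS]exchange_big; apply: eq_bigr => J _ /=.
  rewrite -u_col mulr_suml scaler_sumr; apply: eq_bigr => k _.
  by rewrite uprod_cons -scalerAr mulrA.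
rewrite gE // -addn1 big_words_cat.
transitivity (\sum_a (\sum_(J <- words D N) f (a :: J) *: uprod X J) * u i a).
  under [RHS]eq_bigr do rewrite mulr_suml.
  rewrite [RHS]exchange_big; apply: eq_big_words => J sJ.
  rewrite big_wordsS; apply: eq_bigr => a _.
  by rewrite big_words0 cats1 gE // uprod_rcons ?sJ // -scalerAl.
under eq_bigr do rewrite move_first mulr_suml.
rewrite exchange_big (bigD1 i) //= [X in _ + X]big1 ?addr0 => [|k ki].
  under eq_bigr do rewrite -scalerAl.
  by rewrite -scaler_sumr u_row eqxx.
under eq_bigr do rewrite -scalerAl.
by rewrite -scaler_sumr u_row (negPf ki) scaler0.
Qed.

Lemma fixed_cap N f : fixed N.+2 f -> fixed N (fun X => \sum_i f [:: i, i & X]).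
Proof.
move=> hf X sX; rewrite scaler_suml.
transitivity (\sum_i \sum_(J <- words D N.+2) f J *: uprod [:: i, i & X] J); last first.
  by apply: eq_bigr => i _; rewrite hf //= sX.
under [RHS]eq_bigr do rewrite big_wordsS.
under [LHS]eq_bigr do rewrite /= scaler_suml.
rewrite exchange_big [RHS]exchange_big; apply: eq_bigr => j _ /=.
under [RHS]eq_bigr do rewrite big_wordsS.
rewrite [RHS]exchange_big /= (bigD1 j) //= [X in _ = _ + X]big1 ?addr0 => [|j' j'j].
  rewrite [RHS]exchange_big; apply: eq_bigr => J _ /=.
  under eq_bigr do rewrite !uprod_cons mulrA.
  by rewrite -scaler_sumr -mulr_suml u_col eqxx mul1r.
rewrite exchange_big big1 // => J _ /=.
under eq_bigr do rewrite !uprod_cons mulrA.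
by rewrite -scaler_sumr -mulr_suml u_col eq_sym (negPf j'j) mul0r scaler0.
Qed.

Definition Wfixed (w : seq nat) : Prop := fixed (size w) (@xi C D w).

Lemma fixed_Fix N f : Fix Wfixed N f -> fixed N f.
Proof.
move=> [s sW sE]; apply: (@fixed_ext _ (fun X => \sum_(ct <- s) ct.1 * xi C ct.2 X)).
  by move=> X sX; rewrite sE.
by apply: fixed_sum => ct /sW[Wct <-]; exact: fixedZ.
Qed.

Lemma fixed_word_class : #|D| != 0%N -> word_class Wfixed.
Proof.
move=> D0; split.
- move=> h w inj; rewrite /Wfixed size_map; apply: fixed_ext => X _.
  by rewrite /xi compat_rename.
- move=> s t dis ws wt; rewrite /Wfixed size_cat; apply: fixed_cat ws wt _ => X Y sX sY.
  by rewrite /xi compat_cat // -natrM mulnb.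
- move=> a s ws; rewrite /Wfixed size_rcons; apply: fixed_rot ws _ => i X sX.
  rewrite /xi -!cats1 compat_catC ?sX //.
- move=> a b s /fixed_cap hs; rewrite /Wfixed size_map.
  (* The factor left by capping has to be divided out; it is nonzero because [D] is nonempty. *)
  set c : C := if (a \in s) || (b \in s) then 1 else #|D|%:R.
  have c0 : c != 0 by rewrite /c; case: ifP => _; rewrite ?oner_eq0 // pnatr_eq0.
  apply: fixed_ext (fixedZ c^-1 hs) => X sX.
  by rewrite /xi sum_compat_cap // -/c mulKf.
- move=> [|i [|j [|? ?]]] // _; rewrite !big_wordsS.
  under eq_bigr do rewrite big_wordsS.
  have xi2 (a b : D) : xi C [:: 0; 0]%N [:: a; b] = (a == b)%:R.
    rewrite /xi; congr (_%:R); congr nat_of_bool; apply/asboolP/eqP => [[g [-> ->]] //|->].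
    by exists (fun=> b).
  rewrite xi2 scaler_nat -[1 *+ _]/((i == j)%:R) -u_row; apply: eq_bigr => k _.
  rewrite (bigD1 k) //= big_words0 xi2 eqxx scale1r !uprod_cons uprod_nil mulr1.
  rewrite big1 ?addr0 // => k' k'k; rewrite big_words0 xi2 eq_sym (negPf k'k) scale0r //.
Qed.

End FixedVectors.

(** * Frobenius reciprocity *)

Section Frobenius.
Variables (C : numClosedFieldType) (D : finType).
Implicit Types (I J K X Y : seq D) (t : seq D -> seq D -> C).

(* Frobenius reciprocity: the coefficients of a map from the k-th to the l-th
   tensor power, read along the boundary of the diagram. *)
Definition frob k t X : C := t (drop k X) (rev (take k X)).

Lemma frob_cat k t I J : size I = k -> frob k t (I ++ J) = t J (rev I).
Proof. by move=> sI; rewrite /frob take_size_cat // drop_size_cat. Qed.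

Variables (A : algType C) (u : D -> D -> A).
Hypothesis u_row : forall i j, \sum_k u i k * u j k = (i == j)%:R.
Hypothesis u_col : forall i j, \sum_k u k i * u k j = (i == j)%:R.

Definition intertwines k l t : Prop := forall J I, size J = l -> size I = k ->
  \sum_(I' <- words D k) t J I' *: uprod u I' I =
  \sum_(J' <- words D l) t J' I *: uprod u J J'.

Lemma sum_delta (T : eqType) (V : lmodType C) (s : seq T) (F : T -> V) a :
  uniq s -> a \in s -> \sum_(b <- s) (a == b)%:R *: F b = F a.
Proof.
move=> us as_; rewrite (bigD1_seq a) //= eqxx scale1r big1 ?addr0 // => b ba.
by rewrite eq_sym (negPf ba) scale0r.
Qed.

Lemma natb_alg (b : bool) : b%:R = b%:R *: 1 :> A.
Proof. by case: b; rewrite ?scale1r ?scale0r. Qed.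

(** Products of [u] with both index words reversed invert the [k]-th tensor power of [u], on one
    side by [uprod_row] and on the other by [uprod_col]. Multiplying by them moves the upper points
    to the lower row and back. *)
Lemma intertwines_fixed k l t : intertwines k l t <-> fixed u (k + l) (frob k t).
Proof.
split=> [ht X sX|hf J I sJ sI].
  rewrite -(cat_take_drop k X); set I := take k X; set J := drop k X.
  have sI : size I = k by rewrite size_takel // sX leq_addr.
  have sJ : size J = l by rewrite size_drop sX addKn.
  rewrite frob_cat // big_words_cat big_words_rev.
  transitivity (\sum_(I' <- words D k) uprod u I (rev I') *
      \sum_(J' <- words D l) t J' I' *: uprod u J J').
    apply: eq_big_words => I' sI'; rewrite mulr_sumr; apply: eq_big_words => J' sJ'.
    by rewrite frob_cat ?size_rev // revK uprod_cat ?size_rev ?sI ?sI' // -scalerAr.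
  transitivity (\sum_(I' <- words D k) uprod u I (rev I') *
      \sum_(I'' <- words D k) t J I'' *: uprod u I'' I').
    by apply: eq_big_words => I' sI'; rewrite ht.
  transitivity (\sum_(I'' <- words D k) t J I'' *: ((rev I == I'')%:R : A)).
    under eq_bigr do rewrite mulr_sumr.
    rewrite exchange_big; apply: eq_big_words => I'' sI'' /=.
    rewrite -(uprod_row u_row (_ : size (rev I) = k) sI'') ?size_rev // revK scaler_sumr.
    by apply: eq_bigr => I' _; rewrite scalerAr.
  rewrite -[RHS](@sum_delta _ A (words D k) (fun I'' => (t J I'')%:A)); last first.
  - by rewrite mem_words size_rev sI.
  - exact: uniq_words.
  by apply: eq_bigr => I'' _; rewrite natb_alg !scalerA mulrC.
have hX I' : size I' = k -> \sum_(K <- words D k) uprod u (rev I') (rev K) *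
    \sum_(J' <- words D l) t J' K *: uprod u J J' = (t J I')%:A.
  move=> sI'; rewrite -[RHS](@sum_delta _ A (words D k) (fun I'' => (t J I'')%:A) I'); last first.
  - by rewrite mem_words sI'.
  - exact: uniq_words.
  have := hf (rev I' ++ J); rewrite size_cat size_rev sI' sJ => /(_ erefl).
  rewrite frob_cat ?size_rev // revK big_words_cat big_words_rev.
  rewrite sum_delta ?uniq_words ?mem_words ?sI' // => <-.
  apply: eq_big_words => K sK; rewrite mulr_sumr; apply: eq_big_words => J' sJ'.
  by rewrite frob_cat ?size_rev // revK uprod_cat ?size_rev ?sI' ?sK // -scalerAr.
transitivity (\sum_(I' <- words D k) uprod u I' I * (t J I')%:A).
  by apply: eq_bigr => I' _; rewrite mulr_algr.
transitivity (\sum_(I' <- words D k) uprod u I' I *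
    \sum_(K <- words D k) uprod u (rev I') (rev K) *
      \sum_(J' <- words D l) t J' K *: uprod u J J').
  by apply: eq_big_words => I' sI'; rewrite hX.
rewrite -(@sum_delta _ A (words D k) (fun K => \sum_(J' <- words D l) t J' K *: uprod u J J') I);
  rewrite ?uniq_words ?mem_words ?sI //.
under eq_bigr do rewrite mulr_sumr.
rewrite exchange_big; apply: eq_big_words => K sK /=.
under eq_bigr do rewrite mulrA.
rewrite -mulr_suml.
suff -> : \sum_(I' <- words D k) uprod u I' I * uprod u (rev I') (rev K) = (I == K)%:R.
  by rewrite natb_alg -scalerAl mul1r.
have := @uprod_col _ _ _ _ u_col k (rev I) (rev K); rewrite !size_rev.
move=> /(_ sI sK); rewrite big_words_rev revK (inj_eq (inv_inj revK)) => <-.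
by apply: eq_bigr => I' _; rewrite revK.
Qed.

End Frobenius.

(** * Multi-indices as words *)

Section MultiIndex.
Variables (C : numClosedFieldType) (n : nat).
Hypothesis n0 : (0 < n)%N.
Local Notation D := ('I_n).

Definition d0 : D := Ordinal n0.

Definition mi k (I : seq D) : multi_index n k := [ffun a : 'I_k => nth d0 I a].

Definition wd k (i : multi_index n k) : seq D := [seq i a | a <- enum 'I_k].

Lemma size_wd k (i : multi_index n k) : size (wd i) = k.
Proof. by rewrite size_map size_enum_ord. Qed.

Lemma nth_wd k (i : multi_index n k) (a : 'I_k) : nth d0 (wd i) a = i a.
Proof. by rewrite (nth_map a) ?size_enum_ord // nth_ord_enum. Qed.

Lemma wdK k (i : multi_index n k) : mi k (wd i) = i.
Proof. by apply/ffunP => a; rewrite ffunE nth_wd. Qed.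

Lemma miK k I : size I = k -> wd (mi k I) = I.
Proof.
move=> sI; apply: (@eq_from_nth _ d0); rewrite size_wd // => a ak.
by rewrite -[a]/(nat_of_ord (Ordinal ak)) nth_wd ffunE.
Qed.

Lemma sum_multi_index k (V : nmodType) (F : multi_index n k -> V) :
  \sum_i F i = \sum_(I <- words D k) F (mi k I).
Proof.
rewrite -(big_map (mi k) xpredT F); apply: perm_big; apply: uniq_perm.
- exact: index_enum_uniq.
- rewrite map_inj_in_uniq ?uniq_words // => I J; rewrite !mem_words => /eqP sI /eqP sJ E.
  by rewrite -(miK sI) E miK.
- move=> i; rewrite mem_index_enum; apply/esym/mapP.
  by exists (wd i); rewrite ?wdK // mem_words size_wd.
Qed.

Lemma upowerE (A : cstarType C) (u : D -> D -> A) k (i j : multi_index n k) :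
  upower u i j = uprod u (wd i) (wd j).
Proof.
by rewrite /upower /uprod /wd zip_map big_map enumT [index_enum _]unlock.
Qed.

Definition coefw k l (T : 'Hom(tensor_power C n k, tensor_power C n l)) J I : C :=
  coef T (mi l J) (mi k I).

Lemma intertwinerE (A : cstarType C) (u : D -> D -> A) k l
    (T : 'Hom(tensor_power C n k, tensor_power C n l)) :
  intertwiner u T <-> intertwines u k l (coefw T).
Proof.
split=> [h J I sJ sI|h j i].
  have := h (mi l J) (mi k I); rewrite !sum_multi_index => E.
  transitivity (\sum_(I' <- words D k) coef T (mi l J) (mi k I') *: upower u (mi k I') (mi k I)).
    by apply: eq_big_words => I' sI'; rewrite upowerE !miK.
  rewrite E; apply: eq_big_words => J' sJ'.
  by rewrite upowerE !miK.
have := h (wd j) (wd i); rewrite !size_wd => /(_ erefl erefl) E.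
rewrite !sum_multi_index.
transitivity (\sum_(I' <- words D k) coefw T (wd j) I' *: uprod u I' (wd i)).
  by apply: eq_big_words => I' sI'; rewrite upowerE miK // /coefw wdK.
rewrite E; apply: eq_big_words => J' sJ'.
by rewrite upowerE miK // /coefw wdK.
Qed.

Lemma coef_ext k l (T S : 'Hom(tensor_power C n k, tensor_power C n l)) :
  (forall j i, coef T j i = coef S j i) -> T = S.
Proof.
move=> TS; apply/lfunP => v.
have vE : v = \sum_i (v i : C) *: basis_vector C i.
  apply/ffunP => j; rewrite sum_ffunE (bigD1 j) //= !ffunE eqxx.
  rewrite big1 ?addr0 => [|i ij]; first by rewrite [RHS]mulr1.
  by rewrite !ffunE eq_sym (negPf ij) [LHS]mulr0.
rewrite vE !linear_sum; apply: eq_bigr => i _; rewrite !linearZ; congr (_ *: _).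
by apply/ffunP => j; exact: TS.
Qed.

Lemma coef_T k l (p : blocks k l) (j : multi_index n l) (i : multi_index n k) :
  coef (T_ C n p) j i = (delta p i j)%:R.
Proof.
rewrite /coef T_basis_vector sum_ffunE (bigD1 j) //= !ffunE eqxx.
rewrite big1 ?addr0 => [|j' j'j]; first by rewrite [LHS]mulr1.
by rewrite !ffunE eq_sym (negPf j'j) [LHS]mulr0.
Qed.

End MultiIndex.

(** * Partitions and words *)

Local Close Scope ring_scope.

Section Classes.
Variable T : finType.

Definition classes (c : T -> nat) : {set {set T}} :=
  [set [set y | c y == c x] | x in [set: T]].

Lemma in_classes c x : [set y | c y == c x] \in classes c.
Proof. by apply/imsetP; exists x. Qed.

Lemma classesP c (B : {set T}) :
  reflect (exists x, B = [set y | c y == c x]) (B \in classes c).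
Proof.
by apply: (iffP imsetP) => [[x _ ->]|[x ->]]; exists x.
Qed.

Lemma eq_classes c c' : (forall x y, (c x == c y) = (c' x == c' y)) ->
  classes c = classes c'.
Proof.
move=> E; apply/setP => B; apply/classesP/classesP => -[x ->]; exists x;
  by apply/setP => y; rewrite !inE E.
Qed.

Lemma classes_inj c c' : classes c = classes c' ->
  forall x y, (c x == c y) = (c' x == c' y).
Proof.
move=> E x y; have := in_classes c y; rewrite E => /classesP[z /setP h].
have := h x; have := h y; rewrite !inE eqxx => /esym/eqP <- ->.
by [].
Qed.

Lemma partition_classes c : partition (classes c) [set: T].
Proof.
have -> : classes c = preim_partition c [set: T].
  rewrite /classes /preim_partition /equivalence_partition; apply: eq_imset => x.
  by apply/setP => y; rewrite !inE eq_sym.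
exact: preim_partitionP.
Qed.

Lemma classes_pblock (p : {set {set T}}) : partition p [set: T] ->
  p = classes (fun x => enum_rank (pblock p x) : nat).
Proof.
move=> /and3P[/eqP cov triv n0].
have cl x : [set y | (enum_rank (pblock p y) : nat) == enum_rank (pblock p x)] = pblock p x.
  apply/setP => y; rewrite inE val_eqE (inj_eq enum_rank_inj) eq_sym eq_pblock //.
  by rewrite cov inE.
apply/setP => B; apply/idP/classesP => [Bp|[x ->]].
  have [x xB] : exists x, x \in B by apply/set0Pn; apply: contraNneq n0 => <-.
  by exists x; rewrite cl; apply/esym/def_pblock.
by rewrite cl pblock_mem // cov inE.
Qed.

End Classes.

(** * Boundary words of partitions and the category operations *)

Lemma pos_lt k l (x : point k l) : pos x < k + l.
Proof. by case: x => [[a ak]|[b bl]] /=; lia. Qed.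

Lemma pos_inj k l : injective (@pos k l).
Proof.
move=> [a|b] [a'|b'] /=.
- by have := ltn_ord a; have := ltn_ord a'; move=> ? ? ?; congr inl; apply: val_inj => /=; lia.
- by case: a b' => [a ?] [b ?] /=; lia.
- by case: a' b => [a ?] [b ?] /=; lia.
- by move=> /eqP; rewrite eqn_add2l => /eqP/val_inj ->.
Qed.

Lemma pos_surj k l m : m < k + l -> exists x : point k l, pos x = m.
Proof.
move=> ml; have [mk|km] := ltnP m k.
  by exists (inl (rev_ord (Ordinal mk))) => /=; lia.
have mkl : m - k < l by lia.
by exists (inr (Ordinal mkl)) => /=; lia.
Qed.

Definition lab k l (w : seq nat) (x : point k l) : nat := nth 0 w (pos x).

(* The word [w] spells the partition [p] along the boundary of the diagram:
   two points lie in the same block iff they carry the same letter. *)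
Definition spells k l (w : seq nat) (p : blocks k l) : Prop :=
  size w = k + l /\ p = classes (lab w).

Definition of_word k l (w : seq nat) : blocks k l := classes (lab w).

Lemma spells_of_word k l w : size w = k + l -> spells w (of_word k l w).
Proof. by []. Qed.

Lemma spells_part k l w (p : blocks k l) : spells w p -> p \in Part k l.
Proof. by move=> [_ ->]; rewrite inE partition_classes. Qed.

Lemma spells_ex k l (p : blocks k l) : p \in Part k l -> exists w, spells w p.
Proof.
rewrite inE => /classes_pblock pE.
pose c (x : point k l) : nat := enum_rank (pblock p x).
pose w := [seq if [pick x : point k l | pos x == m] is Some x then c x else 0 | m <- iota 0 (k + l)].
exists w; split; first by rewrite size_map size_iota.
rewrite {1}pE -/c; apply: eq_classes => x y.
have labE z : lab w z = c z.
  rewrite /lab (nth_map 0) ?size_iota ?pos_lt // nth_iota ?pos_lt // add0n.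
  by case: pickP => [z' /eqP/pos_inj ->|/(_ z)] //; rewrite eqxx.
by rewrite !labE.
Qed.

Lemma nth_pos k l w : size w = k + l ->
  forall m, m < size w -> exists x : point k l, nth 0 w m = lab w x.
Proof. by move=> -> m /(@pos_surj k l)[x <-]; exists x. Qed.

(** Closure under injective renaming means that membership depends only on which positions carry
    equal letters. *)
Lemma word_class_kernel W w w' : word_class W -> size w = size w' ->
  (forall i j, i < size w -> j < size w ->
    (nth 0 w i == nth 0 w j) = (nth 0 w' i == nth 0 w' j)) -> W w -> W w'.
Proof.
move=> HW sw ker Ww; pose f a := nth 0 w' (index a w).
have -> : w' = map f w.
  apply: (@eq_from_nth _ 0) => [|i]; rewrite ?size_map // -sw => iw.
  rewrite (nth_map 0) // /f; apply/eqP; rewrite -ker ?index_mem ?mem_nth //.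
  by rewrite nth_index ?mem_nth.
apply: wc_map => // a b aw bw; rewrite /f => /eqP.
by rewrite -ker ?index_mem // !nth_index // => /eqP.
Qed.

Lemma spells_class W k l w w' (p : blocks k l) : word_class W ->
  spells w p -> spells w' p -> W w -> W w'.
Proof.
move=> HW [sw ->] [sw' E]; apply: (word_class_kernel HW); first by rewrite sw sw'.
move=> i j; rewrite sw => /(@pos_surj k l)[x <-] /(@pos_surj k l)[y <-].
exact: (classes_inj E).
Qed.

Lemma spells_relabel k l k' l' (f : point k l -> point k' l') (g : point k' l' -> point k l)
    w w' (p : blocks k l) : cancel f g -> cancel g f -> k + l = k' + l' ->
  (forall x, lab w' (f x) = lab w x) -> size w' = size w ->
  spells w p -> spells w' (relabel f p).
Proof.
move=> fg gf kl fw sw [sp ->]; split; first by rewrite sw sp.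
apply/setP => B; apply/imsetP/classesP => [[_ /classesP[x ->] ->]|[x ->]].
  exists (f x); apply/setP => y; rewrite inE fw; apply/imsetP/eqP => [[z + ->]|yx].
    by rewrite inE fw => /eqP.
  by exists (g y); rewrite ?gf // inE -yx -{2}(gf y) fw.
exists [set y | lab w y == lab w (g x)]; first exact: in_classes.
apply/setP => y; rewrite inE -{1}(gf x) fw; apply/eqP/imsetP => [yx|[z + ->]].
  by exists (g y); rewrite ?gf // inE -yx -{2}(gf y) fw.
by rewrite inE fw => /eqP.
Qed.

Lemma flipK k l : cancel (@flip k l) (@flip l k).
Proof. by case. Qed.

Lemma spells_involution k l w (p : blocks k l) : spells w p ->
  spells (rev w) (involution p).
Proof.
move=> h; have [sw _] := h.
apply: (@spells_relabel _ _ _ _ (@flip k l) (@flip l k) w) h; rewrite ?size_rev //.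
- exact: flipK.
- exact: flipK.
- exact: addnC.
move=> x; rewrite /lab nth_rev ?sw; last by rewrite addnC pos_lt.
by congr nth; case: x => [[a ?]|[b ?]] /=; lia.
Qed.

Lemma move_downK k l h h' : cancel (@move_down k l h h') (@move_up k l h h').
Proof.
move=> [a|b] /=; last by rewrite liftK.
by case: unliftP => [a' ->|->] //=; rewrite unlift_none.
Qed.

Lemma move_upK k l h h' : cancel (@move_up k l h h') (@move_down k l h h').
Proof.
move=> [a|b] /=; first by rewrite liftK.
by case: unliftP => [a' ->|->] //=; rewrite unlift_none.
Qed.

(** The boundary is read from the right end of the upper row around to the right end of the lower
    row, so moving a point around the left side leaves the word unchanged. *)
Lemma pos_left k l (x : point k.+1 l) : pos (move_down ord0 ord0 x) = pos x.
Proof.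
case: x => [a|b] /=; last by rewrite /bump /=; lia.
by case: unliftP => [a' ->|->] /=; rewrite /bump /=; lia.
Qed.

(** On the right side the reading begins and ends: the first point becomes the last, and the others
    move forward by one. *)
Lemma pos_right k l (x : point k.+1 l) :
  pos (move_down ord_max ord_max x) = if pos x is m.+1 then m else k + l.
Proof.
case: x => [a|b] /=; last by rewrite /bump leqNgt ltn_ord.
case: unliftP => [a' ->|->] /=; last by rewrite subnn.
rewrite /bump leqNgt ltn_ord /=; case: a' => a' /= ak.
by rewrite add0n subSS -(subnSK ak).
Qed.

Lemma spells_left_down k l w (p : blocks k.+1 l) : spells w p ->
  spells w (rotate_left_down p).
Proof.
apply: spells_relabel (move_downK _ _) (move_upK _ _) _ _ _ => //; first by rewrite addnS.
by move=> x; rewrite /lab pos_left.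
Qed.

Lemma spells_left_up k l w (p : blocks k l.+1) : spells w p ->
  spells w (rotate_left_up p).
Proof.
apply: spells_relabel (move_upK _ _) (move_downK _ _) _ _ _ => //; first by rewrite addnS.
by move=> x; rewrite /lab -pos_left move_upK.
Qed.

Lemma spells_right_down k l a s (p : blocks k.+1 l) : spells (a :: s) p ->
  spells (rcons s a) (rotate_right_down p).
Proof.
move=> h; have [[ss] _] := h; move: h.
apply: spells_relabel (move_downK _ _) (move_upK _ _) _ _ _; rewrite ?size_rcons ?addnS //.
move=> x; rewrite /lab pos_right nth_rcons; have := pos_lt x.
case: (pos x) => [|m]; first by rewrite ss ltnn eqxx.
by rewrite addSn ltnS -ss => ->.
Qed.

Lemma spells_right_up k l a s (p : blocks k l.+1) : spells (rcons s a) p ->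
  spells (a :: s) (rotate_right_up p).
Proof.
move=> h; have [] := h; rewrite size_rcons addnS => -[ss] _; move: h.
apply: spells_relabel (move_upK _ _) (move_downK _ _) _ _ _; rewrite ?size_rcons ?addnS //.
move=> x; rewrite /lab -[x in RHS](move_upK ord_max ord_max) pos_right nth_rcons.
have := pos_lt (move_up ord_max ord_max x).
case: (pos (move_up _ _ _)) => [|m]; first by rewrite ss ltnn eqxx.
by rewrite addSn ltnS -ss => ->.
Qed.

Lemma pos_tensor_left k l k' l' (x : point k l) :
  pos (tensor_left k' l' x) = k' + pos x.
Proof. by case: x => [[a ?]|[b ?]] /=; lia. Qed.

Lemma pos_tensor_right k l k' l' (x : point k' l') :
  pos (tensor_right k l x) = if pos x < k' then pos x else k + l + pos x.
Proof. by case: x => [[a ?]|[b ?]] /=; case: ifP; lia. Qed.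

Lemma tensor_cover k l k' l' (z : point (k + k') (l + l')) :
  (exists x : point k l, z = tensor_left k' l' x) \/
  (exists x : point k' l', z = tensor_right k l x).
Proof.
case: z => [a|b].
  case: (split_ordP a) => a' ->; first by left; exists (inl a').
  by right; exists (inl a').
case: (split_ordP b) => b' ->; first by left; exists (inr b').
by right; exists (inr b').
Qed.

Lemma relabel_classes k l k' l' (f : point k l -> point k' l') w w' (B : {set point k' l'}) :
  injective f -> (forall x, lab w' (f x) = lab w x) ->
  (forall (x : point k l) (z : point k' l'), lab w' z = lab w x -> exists y, z = f y) ->
  reflect (exists x : point k l, B = [set z | lab w' z == lab w x]) (B \in relabel f (classes (lab w))).
Proof.
move=> inj fw ran; apply: (iffP imsetP) => [[_ /classesP[x ->] ->]|[x ->]].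
  exists x; apply/setP => z; rewrite inE; apply/imsetP/eqP => [[y + ->]|zx].
    by rewrite inE fw => /eqP.
  by have [y zE] := ran _ _ zx; exists y => //; rewrite inE -zx zE fw.
exists [set y | lab w y == lab w x]; first exact: in_classes.
apply/setP => z; rewrite inE; apply/eqP/imsetP => [zx|[y + ->]].
  by have [y zE] := ran _ _ zx; exists y => //; rewrite inE -zx zE fw.
by rewrite inE fw => /eqP.
Qed.

(** The left factor [p] occupies one stretch of the boundary of [tensor p q], between the upper part
    [s] and the lower part [t] of the word of [q]. *)
Lemma spells_tensor k l k' l' w s t (p : blocks k l) (q : blocks k' l') :
  size s = k' -> {in w, forall a, a \notin s ++ t} ->
  spells w p -> spells (s ++ t) q -> spells (s ++ w ++ t) (tensor p q).
Proof.
move=> ss dis [sw ->] [sst ->]; set v := s ++ w ++ t.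
split; first by rewrite /v !size_cat; move: sst; rewrite size_cat; lia.
have labl (x : point k l) : lab v (tensor_left k' l' x) = lab w x.
  rewrite /lab pos_tensor_left nth_cat ss ltnNge leq_addr /= addKn nth_cat.
  by rewrite sw pos_lt.
have labr (x : point k' l') : lab v (tensor_right k l x) = lab (s ++ t) x.
  rewrite /lab pos_tensor_right !nth_cat ss.
  have [xk|xk] := ltnP (pos x) k'; first by rewrite xk.
  rewrite (_ : _ < k' = false); last by apply/negbTE; rewrite -leqNgt; lia.
  rewrite sw (_ : _ < k + l = false); last by apply/negbTE; rewrite -leqNgt; lia.
  by congr nth; lia.
have dis_lab (x : point k l) (y : point k' l') : lab w x <> lab (s ++ t) y.
  move=> E; have := dis (lab w x); rewrite mem_nth ?sw ?pos_lt // => /(_ isT).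
  by rewrite E mem_nth ?sst ?pos_lt.
have injl : injective (@tensor_left k l k' l').
  move=> x y /(congr1 (@pos _ _)); rewrite !pos_tensor_left => /eqP.
  by rewrite eqn_add2l => /eqP/pos_inj.
have injr : injective (@tensor_right k l k' l').
  move=> x y /(congr1 (@pos _ _)); rewrite !pos_tensor_right => E; apply: pos_inj.
  by move: E; case: ifP; case: ifP; lia.
have ranl (x : point k l) (z : point (k + k') (l + l')) :
    lab v z = lab w x -> exists y : point k l, z = tensor_left k' l' y.
  have [//|[y ->]] := tensor_cover z.
  by rewrite labr => /esym /dis_lab.
have ranr (x : point k' l') (z : point (k + k') (l + l')) :
    lab v z = lab (s ++ t) x -> exists y : point k' l', z = tensor_right k l y.
  have [[y ->]|//] := tensor_cover z.
  by rewrite labl => /dis_lab.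
apply/setP => B; rewrite inE; apply/orP/classesP.
  case=> [/(relabel_classes _ injl labl ranl)[x ->]|/(relabel_classes _ injr labr ranr)[x ->]].
    by exists (tensor_left k' l' x); rewrite labl.
  by exists (tensor_right k l x); rewrite labr.
move=> [z ->]; have [[x ->]|[x ->]] := tensor_cover z.
  by left; apply/(relabel_classes _ injl labl ranl); exists x; rewrite labl.
by right; apply/(relabel_classes _ injr labr ranr); exists x; rewrite labr.
Qed.

(* Contracting nested pairs: the letters of each pair in [ms] get identified, and
   no other identification occurs. *)
Lemma contract_nested W ms u d : word_class W ->
  W (u ++ unzip1 ms ++ rev (unzip2 ms) ++ d) ->
  exists f : nat -> nat, [/\ W (map f (u ++ d)),
    forall ab, ab \in ms -> f ab.1 = f ab.2
    & forall E : nat -> nat -> Prop, (forall x, E x x) -> (forall x y, E x y -> E y x) ->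
      (forall x y z, E x y -> E y z -> E x z) ->
      (forall ab, ab \in ms -> E ab.1 ab.2) -> forall x y, f x = f y -> E x y].
Proof.
move=> HW; have [n] := ubnP (size ms); elim: n ms u d => // n IHn ms u d.
case/lastP: ms => [|ms [a b]] sm.
  move=> Wud; exists id; split=> //; first by rewrite map_id.
  by move=> E Er _ _ _ x _ <-.
(* The last pair of [ms] is the innermost one. It is capped first, and its identification is carried
   out in the remaining pairs before the induction hypothesis applies. *)
rewrite /unzip1 /unzip2 !map_rcons rev_rcons /= cat_rcons => Wud.
pose ta := subst b a; pose tms := map (fun cd => (ta cd.1, ta cd.2)) ms.
have : W (map ta (u ++ map fst ms ++ rev (map snd ms) ++ d)).
  rewrite (catA u); apply: (wc_contract_at HW); by rewrite -catA.
have E1 : map ta (map fst ms) = unzip1 tms by rewrite /unzip1 -!map_comp.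
have E2 : map ta (map snd ms) = unzip2 tms by rewrite /unzip2 -!map_comp.
rewrite !map_cat map_rev E1 E2 => /IHn[|f [Wf feq fmin]].
  by move: sm; rewrite size_rcons size_map.
exists (f \o ta); split.
- by rewrite map_comp map_cat.
- move=> ab; rewrite mem_rcons inE => /predU1P[->|abm] /=.
    by congr f; rewrite /ta /subst eqxx if_same.
  by apply: (feq (ta ab.1, ta ab.2)); apply/mapP; exists ab.
- move=> E Er Es Et Em x y /= fxy.
  have Ea z : E z (ta z).
    rewrite /ta /subst; case: eqP => // ->; apply: Es; apply: (Em (a, b)).
    by rewrite mem_rcons mem_head.
  have Exy : E (ta x) (ta y).
    apply: (fmin E) => // _ /mapP[cd cdm ->] /=.
    apply: (Et _ _ _ (Es _ _ (Ea _))); apply: (Et _ _ _ _ (Ea _)); apply: Em.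
    by rewrite mem_rcons inE cdm orbT.
  exact: Et (Ea x) (Et _ _ _ Exy (Es _ _ (Ea y))).
Qed.

(** The hypotheses say that the fibres of [f] are the classes of the equivalence generated by the
    middle pairs. These classes match the connected components of the stacked diagram; minimality of
    [f] is what produces the paths. *)
Lemma spells_compose k l m u ms d (f : nat -> nat) (p : blocks k l) (q : blocks l m) :
  size u = k -> size ms = l -> size d = m ->
  {in u ++ unzip1 ms, forall a, a \notin rev (unzip2 ms) ++ d} ->
  spells (u ++ unzip1 ms) p -> spells (rev (unzip2 ms) ++ d) q ->
  (forall ab, ab \in ms -> f ab.1 = f ab.2) ->
  (forall E : nat -> nat -> Prop, (forall x, E x x) -> (forall x y, E x y -> E y x) ->
      (forall x y z, E x y -> E y z -> E x z) ->
      (forall ab, ab \in ms -> E ab.1 ab.2) -> forall x y, f x = f y -> E x y) ->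
  spells (map f (u ++ d)) (compose p q).
Proof.
move=> su sms sd dis [sp pE] [sq qE] feq fmin.
set w1 := u ++ unzip1 ms in dis sp pE *; set w2 := rev (unzip2 ms) ++ d in dis sq qE *.
split; first by rewrite size_map size_cat su sd.
(* [z] carries the letter [x]; middle points carry one letter of each word. *)
pose carries (z : stacked k l m) (x : nat) : Prop :=
  (exists2 y : point k l, z = stack_top m y & x = lab w1 y) \/
  (exists2 y : point l m, z = stack_bottom k y & x = lab w2 y).
have top_inj : injective (@stack_top k l m) by move=> x y [].
have bot_inj : injective (@stack_bottom k l m) by move=> [x|x] [y|y] // [->].
have link_top (y y' : point k l) : lab w1 y = lab w1 y' ->
    linked p q (stack_top m y) (stack_top m y').
  move=> yy'; apply/orP; left; apply/existsP; exists [set x | lab w1 x == lab w1 y].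
  by rewrite pE in_classes !mem_imset // !inE yy' eqxx.
have link_bot (y y' : point l m) : lab w2 y = lab w2 y' ->
    linked p q (stack_bottom k y) (stack_bottom k y').
  move=> yy'; apply/orP; right; apply/existsP; exists [set x | lab w2 x == lab w2 y].
  by rewrite qE in_classes !mem_imset // !inE yy' eqxx.
have same_letter z z' x : carries z x -> carries z' x -> connect (linked p q) z z'.
  have disl (y : point k l) (y' : point l m) : lab w1 y <> lab w2 y'.
    move=> yy'; have := dis (lab w1 y); rewrite mem_nth ?sp ?pos_lt // => /(_ isT).
    by rewrite yy' mem_nth ?sq ?pos_lt.
  case=> [[y -> ->]|[y -> ->]] [[y' -> E]|[y' -> E]]; apply: connect1.
  - exact: link_top.
  - by case: (disl _ _ E).
  - by case: (disl _ _ (esym E)).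
  - exact: link_bot.
have csym : symmetric (linked p q).
  by move=> z z'; rewrite /linked; congr (_ || _); apply: eq_existsb => B;
    congr (_ && _); rewrite andbC.
(* The middle row is read from left to right as the lower row of [p], but from right to left as the
   upper row of [q]. *)
have mid b : b < l -> nth 0 w1 (k + b) = (nth (0, 0) ms b).1 /\
    nth 0 w2 (l - b.+1) = (nth (0, 0) ms b).2.
  move=> bl; split.
    by rewrite nth_cat su ltnNge leq_addr /= addKn (nth_map (0, 0)) ?sms.
  rewrite nth_cat size_rev size_map sms (_ : l - b.+1 < l); last by lia.
  rewrite nth_rev ?size_map ?sms; last by lia.
  by rewrite (_ : l - (l - b.+1).+1 = b) ?(nth_map (0, 0)) ?sms //; lia.
(* The diagonal is added because a letter need not be carried by any point. *)
pose E x y := x = y \/ exists z z', [/\ carries z x, carries z' y & connect (linked p q) z z'].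
have conn z z' x y : carries z x -> carries z' y -> f x = f y -> connect (linked p q) z z'.
  move=> zx z'y fxy; have [] : E x y.
  - apply: (fmin E) fxy => //.
    + by left.
    + move=> a b [->|[t [t' [h1 h2 h3]]]]; [by left|right; exists t', t; split=> //].
      by rewrite (sym_connect_sym csym).
    + move=> a b c [->//|[t [t' [h1 h2 h3]]]] [<-|[s [s' [h4 h5 h6]]]].
        by right; exists t, t'.
      right; exists t, s'; split=> //; apply: connect_trans h3 _.
      by apply: connect_trans h6; exact: same_letter h2 h4.
    + move=> ab abm; right.
      have [b bl abE] : exists2 b, b < l & ab = nth (0, 0) ms b.
        by exists (index ab ms); rewrite ?nth_index // -sms index_mem.
      have [h1 h2] := mid b bl; rewrite abE -h1 -h2.
      pose z0 : stacked k l m := inl (inr (Ordinal bl)).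
      exists z0, z0; split=> //.
        by left; exists (inr (Ordinal bl)).
      by right; exists (inl (Ordinal bl)).
  - by move=> xy; apply: same_letter zx _; rewrite xy.
  - move=> [t [t' [h1 h2 h3]]]; apply: connect_trans (same_letter _ _ _ zx h1) _.
    by apply: connect_trans h3 _; exact: same_letter h2 z'y.
(* Conversely, [f] of the letter is constant along links. *)
pose phi (z : stacked k l m) : nat :=
  match z with inl y => f (lab w1 y) | inr c => f (nth 0 w2 (l + c)) end.
have phi_bot (y : point l m) : phi (stack_bottom k y) = f (lab w2 y).
  case: y => [b|c] //=; rewrite /lab /=; have [-> ->] := mid b (ltn_ord b).
  by apply/feq/mem_nth; rewrite sms.
have phi_link z z' : linked p q z z' -> phi z = phi z'.
  rewrite /linked pE qE => /orP[] /existsP[_ /and3P[/classesP[x ->]]].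
    by move=> /imsetP[y + ->] /imsetP[y' + ->]; rewrite !inE /= => /eqP-> /eqP->.
  by move=> /imsetP[y + ->] /imsetP[y' + ->]; rewrite !inE !phi_bot => /eqP-> /eqP->.
have phi_conn z z' : connect (linked p q) z z' -> phi z = phi z'.
  move=> /connectP[r path_r ->]; elim: r z path_r => //= z1 r IHr z /andP[/phi_link -> /IHr].
  done.
have outer (x : point k m) : phi (stack_outer l x) = lab (map f (u ++ d)) x.
  rewrite /lab (nth_map 0) ?size_cat ?su ?sd ?pos_lt //.
  case: x => [a|c] /=; rewrite /lab /= !nth_cat su.
    by rewrite (_ : k - a.+1 < k) //; have := ltn_ord a; lia.
  by rewrite size_rev size_map sms !ltnNge !leq_addr /= !addKn.
have carr (x : point k m) : exists2 y, carries (stack_outer l x) y & phi (stack_outer l x) = f y.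
  case: x => [a|c] /=.
    by exists (lab w1 (inl a : point k l)) => //; left; exists (inl a).
  by exists (lab w2 (inr c : point l m)) => //; right; exists (inr c).
rewrite /compose /equivalence_partition /classes; apply: eq_imset => x.
apply/setP => y; rewrite !inE /= -!outer; apply/idP/eqP => [/phi_conn ->//|E'].
have [a ca pa] := carr x; have [b cb pb] := carr y.
by apply: conn ca cb _; rewrite -pa -pb E'.
Qed.

Lemma spells_uniq k l w (p q : blocks k l) : spells w p -> spells w q -> p = q.
Proof. by move=> [_ ->] [_ ->]. Qed.

Lemma spells_map k l w (p : blocks k l) (f : nat -> nat) : {in w &, injective f} ->
  spells w p <-> spells (map f w) p.
Proof.
move=> inj; have E : size w = k + l -> classes (@lab k l w) = classes (lab (map f w)).
  move=> sw; apply: eq_classes => x y.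
  rewrite /lab !(nth_map 0) ?sw ?pos_lt //; apply/eqP/eqP => [->//|].
  by apply: inj; rewrite mem_nth ?sw ?pos_lt.
by split=> -[sw pE]; split; move: sw pE; rewrite ?size_map // => sw ->; rewrite E.
Qed.

(** * From word classes to categories and back *)

Definition coll (W : seq nat -> Prop) : collection := fun k l =>
  [set p : blocks k l | `[< exists2 w, spells w p & W w >]].

Lemma in_coll W k l w (p : blocks k l) : word_class W -> spells w p ->
  (p \in coll W k l) <-> W w.
Proof.
move=> HW wp; rewrite inE; split=> [/asboolP[w' w'p Ww']|Ww].
  exact: spells_class HW w'p wp Ww'.
by apply/asboolP; exists w.
Qed.

Lemma collP W k l (p : blocks k l) :
  reflect (exists2 w, spells w p & W w) (p \in coll W k l).
Proof. by rewrite inE; exact: asboolP. Qed.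

Lemma spells_disjoint k l (w v : seq nat) (p : blocks k l) : spells v p ->
  exists f, [/\ spells (map f v) p, {in v &, injective f}
    & {in w, forall a, a \notin map f v}].
Proof.
move=> vp; exists (addn (fresh w)); split.
- by apply: (@spells_map _ _ v p (addn (fresh w)) _).1 vp => x y _ _ /addnI.
- by move=> x y _ _ /addnI.
- by move=> a /fresh_bound aw; apply/negP => /mapP[b _]; lia.
Qed.

Lemma spells_one_block k l : 0 < k + l -> spells (nseq (k + l) 0) (one_block k l).
Proof.
move=> kl; split; first by rewrite size_nseq.
have labE x : @lab k l (nseq (k + l) 0) x = 0 by rewrite /lab nth_nseq if_same.
apply/setP => B; rewrite inE; apply/eqP/classesP => [->|[x ->]].
  have [x _] := @pos_surj k l 0 kl; exists x; apply/setP => y.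
  by rewrite !inE !labE.
by apply/setP => y; rewrite !inE !labE.
Qed.

Lemma coll_category W : word_class W -> (forall w, W w -> W (rev w)) ->
  is_category (coll W).
Proof.
move=> HW Wrev; split.
- by move=> k l; apply/subsetP => p /collP[w wp _]; exact: spells_part wp.
- move=> k l k' l' p q /collP[w wp Ww] /collP[v vq Wv].
  have [f [fvq finj dis]] := spells_disjoint w vq.
  have Wfv : W (map f v) by exact: wc_map.
  have [svq _] := vq; set v' := map f v in dis fvq Wfv.
  apply/collP; exists (take k' v' ++ w ++ drop k' v').
    apply: spells_tensor => //; rewrite ?cat_take_drop //.
    by rewrite size_takel // size_map svq leq_addr.
  apply: wc_insert => //; rewrite cat_take_drop // => x xv.
  by apply: contraTN xv; exact: dis.
- move=> k l m p q /collP[w wp Ww] /collP[v vq Wv].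
  have [f [fvq finj dis]] := spells_disjoint w vq.
  have Wfv : W (map f v) by exact: wc_map.
  have [swp _] := wp; have [svq _] := fvq; set v' := map f v in dis fvq Wfv svq.
  pose ms := zip (drop k w) (rev (take l v')).
  have s1 : size (drop k w) = l by rewrite size_drop swp addKn.
  have s2 : size (take l v') = l by rewrite size_takel // svq leq_addr.
  have E1 : unzip1 ms = drop k w by rewrite unzip1_zip // size_rev s1 s2.
  have E2 : rev (unzip2 ms) = take l v' by rewrite unzip2_zip ?revK // size_rev s1 s2.
  have [|g [Wg geq gmin]] := @contract_nested W ms (take k w) (drop l v') HW.
    rewrite E1 E2 cat_take_drop catA cat_take_drop; exact: wc_cat.
  apply/collP; exists (map g (take k w ++ drop l v')) => //.
  apply: (@spells_compose k l m _ ms _ g) => //; rewrite ?E1 ?E2 ?cat_take_drop //.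
  + by rewrite size_takel // swp leq_addr.
  + by rewrite size1_zip ?size_rev ?s1 ?s2.
  + by rewrite size_drop svq addKn.
- move=> k l p /collP[w wp Ww]; apply/collP; exists (rev w); last exact: Wrev.
  exact: spells_involution.
- move=> k l p /collP[w wp Ww]; apply/collP; exists w => //.
  exact: spells_left_down.
- move=> k l p /collP[w wp Ww]; apply/collP; exists w => //.
  exact: spells_left_up.
- move=> k l p /collP[[|a s] wp Ww]; first by case: wp.
  apply/collP; exists (rcons s a); first exact: spells_right_down.
  exact: (wc_rot HW).
- move=> k l p /collP[w]; case/lastP: w => [|s a] wp Ww; first by case: wp; rewrite addnS.
  apply/collP; exists (a :: s); first exact: spells_right_up.
  by apply: (@wc_catC _ HW s [:: a]); rewrite cats1.
- by apply/collP; exists [:: 0; 0]; [exact: spells_one_block|exact: wc_pair HW].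
- by apply/collP; exists [:: 0; 0]; [exact: spells_one_block|exact: wc_pair HW].
Qed.

Section CategoryWords.
Variables (Y : collection) (HY : is_category Y).

Definition words_of (w : seq nat) : Prop :=
  forall k l (p : blocks k l), spells w p -> p \in Y k l.

(** Left rotations keep the word, so membership can be tested after all points have been moved to
    the lower row. *)
Lemma unroll k l w (p : blocks k l) : spells w p ->
  p \in Y k l <-> of_word 0 (size w) w \in Y 0 (size w).
Proof.
elim: k l p => [|k IHk] l p wp.
  have [sw ->] := wp; rewrite add0n in sw; by rewrite {wp p}sw.
have h := spells_left_down wp; rewrite -(IHk _ _ h).
split=> [|/(category_left_up HY)]; first exact: category_left_down.
by rewrite (spells_uniq (spells_left_up h) wp).
Qed.

Lemma words_of_ex k l w (p : blocks k l) : spells w p -> p \in Y k l -> words_of w.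
Proof. by move=> wp /(unroll wp) h k' l' q /unroll ->. Qed.

Lemma words_of_word_class : word_class words_of.
Proof.
have Yw k l w : size w = k + l -> words_of w -> of_word k l w \in Y k l.
  by move=> sw; apply; exact: spells_of_word.
split.
- by move=> f w inj Ww k l p /(spells_map _ inj); exact: Ww.
- move=> s t dis Ws Wt.
  have hs : spells s (of_word 0 (size s) s) by exact: spells_of_word.
  have ht : spells t (of_word 0 (size t) t) by exact: spells_of_word.
  apply: (words_of_ex (spells_tensor (s := [::]) erefl dis hs ht)).
  by apply: category_tensor => //; exact: Yw.
- move=> a s Ws.
  have h : spells (a :: s) (of_word 0 (size s).+1 (a :: s)) by exact: spells_of_word.
  (* The first point goes up on the left; being then the only upper point, it is also the rightmost
     one and comes down on the right. *)
  apply: (words_of_ex (spells_right_down (spells_left_up h))).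
  by apply: category_right_down => //; apply: category_left_up => //; exact: Yw.
(* Capping is composition with the pair partition, put above a diagram whose two upper points are
   the ones to be capped. *)
- move=> a b s Ws; pose c := fresh [:: a, b & s].
  have : c \notin [:: a, b & s] by exact: fresh_notin.
  rewrite !inE !negb_or => /and3P[ca cb cs].
  pose f x := if x == c then a else subst b a x.
  have fs : map f s = map (subst b a) s.
    by apply/eq_in_map => x xs; rewrite /f; case: eqP => // xc; rewrite -xc xs in cs.
  have hp : spells [:: c; c] (one_block 0 2).
    apply: (@spells_map 0 2 [:: 0; 0] _ (fun=> c) _).1; last exact: spells_one_block.
    by move=> x y; rewrite !inE !orbb => /eqP-> /eqP->.
  have hq : spells [:: a, b & s] (of_word 2 (size s) [:: a, b & s]) by exact: spells_of_word.
  rewrite -fs; apply: (@words_of_ex 0 (size s) _ (compose (one_block 0 2) (of_word 2 (size s) [:: a, b & s]))).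
    apply: (@spells_compose 0 2 (size s) [::] [:: (c, b); (c, a)] s f) => //.
    + by move=> x; rewrite /= !inE orbb => /eqP->; rewrite !negb_or ca cb.
    + move=> ab; rewrite !inE => /orP[]/eqP-> /=; rewrite /f eqxx.
        by rewrite eq_sym (negPf cb) /subst eqxx.
      by rewrite eq_sym (negPf ca) /subst if_same.
    + move=> E Er Es Et Em.
      have Ecb : E c b by apply: (Em (c, b)); rewrite !inE eqxx.
      have Eca : E c a by apply: (Em (c, a)); rewrite !inE eqxx orbT.
      have Ef z : E z (f z).
        rewrite /f; case: eqP => [->//|_]; rewrite /subst; case: eqP => [->|_ //].
        exact: Et (Es _ _ Ecb) Eca.
      by move=> x y fxy; apply: (Et _ _ _ (Ef x)); rewrite fxy; exact: Es.
  by apply: category_compose => //; [exact: category_pair|exact: Yw].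
- apply: (words_of_ex (spells_one_block (k := 0) (l := 2) isT)).
  exact: category_pair.
Qed.

End CategoryWords.

(** * Crossings, block sizes and alternation read off the word *)

Lemma subseq_consP (x : nat) t s m :
  reflect (exists i, [/\ m <= i, i < size s, nth 0 s i = x & subseq t (drop i.+1 s)])
          (subseq (x :: t) (drop m s)).
Proof.
apply: (iffP idP) => [|[i [mi si nx]]].
  elim: s m => [|y s IHs] [|m] //=.
    case: eqP => [-> h|_ h]; first by exists 0; split; rewrite //= ?drop0.
    have [|i [_ si nx h']] := IHs 0; first by rewrite drop0.
    by exists i.+1; split.
  by move=> /IHs[i [mi si nx h]]; exists i.+1; split.
have -> : drop m s = take (i - m) (drop m s) ++ x :: drop i.+1 s.
  rewrite -[LHS](cat_take_drop (i - m)) drop_drop subnK //; congr cat.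
  by rewrite (drop_nth 0) // nx.
move=> h; apply: subseq_trans (suffix_subseq _ _).
by rewrite /= eqxx.
Qed.

Lemma nc_nthP w : nc w <-> forall i j k l, i < j -> j < k -> k < l -> l < size w ->
  nth 0 w i = nth 0 w k -> nth 0 w j = nth 0 w l -> nth 0 w i = nth 0 w j.
Proof.
split=> [ncw i j k l ij jk kl lw ik jl|h a b].
  apply: ncw; rewrite -[w in subseq _ w]drop0.
  apply/subseq_consP; exists i; split=> //; first lia.
  apply/subseq_consP; exists j; split=> //; first lia.
  apply/subseq_consP; exists k; split=> //; first lia.
  apply/subseq_consP; exists l; split=> //.
  by rewrite sub0seq.
rewrite -[w in subseq _ w]drop0 => /subseq_consP[i [_ si <- /subseq_consP[j [ij sj <-]]]].
move=> /subseq_consP[k [jk sk Ek /subseq_consP[l [kl sl El _]]]].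
exact: (h i j k l).
Qed.

Lemma perm_pos k l : perm_eq [seq pos x | x <- enum {: point k l}] (iota 0 (k + l)).
Proof.
apply: uniq_perm; rewrite ?iota_uniq ?(map_inj_uniq (@pos_inj k l)) ?enum_uniq // => m.
rewrite mem_iota add0n /=; apply/mapP/idP => [[x _ ->]|/(@pos_surj k l)[x <-]].
  exact: pos_lt.
by exists x => //; rewrite mem_enum.
Qed.

Lemma card_pos k l (Q : pred nat) : #|[set x : point k l | Q (pos x)]| = count Q (iota 0 (k + l)).
Proof.
rewrite -(permP (perm_pos k l) Q) count_map cardE -size_filter /enum_mem -filter_predI.
by congr size; apply: eq_filter => x; rewrite !inE andbT.
Qed.

Lemma count_nth a w : count_mem a w = count (fun i => nth 0 w i == a) (iota 0 (size w)).
Proof. by rewrite -{1}(mkseq_nth 0 w) /mkseq count_map. Qed.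

Lemma par_nth e a w :
  par e a w = count (fun i => (nth 0 w i == a) && (e (+) odd i)) (iota 0 (size w)).
Proof.
elim: w e => //= y w IHw e; rewrite addbF IHw; congr (_ + _).
rewrite (iotaDl 1 0) count_map; apply: eq_count => i /=.
by rewrite addbN addNb.
Qed.

Section Spelled.
Variables (k l : nat) (w : seq nat) (p : blocks k l).
Hypothesis wp : spells w p.

Let sw : size w = k + l. Proof. by case: wp. Qed.
Let pE : p = classes (lab w). Proof. by case: wp. Qed.

Lemma card_class a : #|[set x : point k l | lab w x == a]| = count_mem a w.
Proof. by rewrite (card_pos k l (fun i => nth 0 w i == a)) count_nth sw. Qed.

Lemma card_class_oplus a :
  #|[set x in [set y : point k l | lab w y == a] | oplus x]| = par true a w.
Proof.
rewrite par_nth sw -card_pos; apply: eq_card => x.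
by rewrite !inE.
Qed.

Lemma blocks_forall (Q : pred {set point k l}) (Q' : pred nat) :
  (forall a, a \in w -> Q [set x | lab w x == a] = Q' a) ->
  [forall B in p, Q B] <-> {in w, forall a, Q' a}.
Proof.
move=> QQ'; split=> [/forall_inP h a aw|h].
  rewrite -QQ' //; apply: h; rewrite pE.
  have iw : index a w < size w by rewrite index_mem.
  have [x xE] := nth_pos sw iw; rewrite nth_index // in xE.
  by rewrite xE; exact: in_classes.
apply/forall_inP => B; rewrite pE => /classesP[x ->].
have xw : lab w x \in w by rewrite mem_nth // sw pos_lt.
by rewrite QQ' //; exact: h.
Qed.

Lemma spelled_sizes (S : pred nat) :
  [forall B in p, S #|B|] <-> {in w, forall x, S (count_mem x w)}.
Proof. by apply: blocks_forall => a _; rewrite card_class. Qed.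

Lemma spelled_alternating : alternating_pairs p <->
  (forall x, count_mem x w = 2 -> par true x w = par false x w).
Proof.
rewrite (@blocks_forall (fun B => (#|B| == 2) ==> (#|[set x in B | oplus x]| == 1))
  (fun a => (count_mem a w == 2) ==> (par true a w == 1))); last first.
  by move=> a _; rewrite card_class card_class_oplus.
split=> [h x c2|h a _].
  have xw : x \in w by rewrite -has_pred1 has_count c2.
  have := h x xw; rewrite c2 /= => /eqP; have := count_par x w; lia.
by apply/implyP => /eqP c2; apply/eqP; have := count_par a w; have := h a c2; lia.
Qed.

Lemma spelled_noncrossing : noncrossing p <-> nc w.
Proof.
rewrite nc_nthP; split=> [h i j m n ij jm mn nw im jn|h].
  rewrite sw in nw.
  have [a ia] : exists x : point k l, pos x = i by apply: pos_surj; lia.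
  have [b jb] : exists x : point k l, pos x = j by apply: pos_surj; lia.
  have [c mc] : exists x : point k l, pos x = m by apply: pos_surj; lia.
  have [d nd] : exists x : point k l, pos x = n by apply: pos_surj; lia.
  rewrite -ia -jb; rewrite -ia -mc in im; rewrite -jb -nd in jn.
  move: h; rewrite /noncrossing pE => /forall_inP h.
  have /forall_inP h1 := h _ (in_classes (lab w) a).
  have /implyP h2 := h1 _ (in_classes (lab w) b).
  apply/eqP; apply: contraT => ab.
  have [|] := negP (h2 _).
    apply: contraNneq ab => /setP/(_ a); rewrite !inE eqxx => /esym.
    by rewrite eq_sym.
  apply/exists_inP; exists a; first by rewrite inE.
  apply/exists_inP; exists b; first by rewrite inE.
  apply/exists_inP; exists c; first by rewrite inE /lab im.
  apply/exists_inP; exists d; first by rewrite inE /lab jn.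
  by rewrite ia jb mc nd ij jm mn.
apply/forall_inP => B; rewrite pE => /classesP[x ->].
apply/forall_inP => B' /classesP[y ->]; apply/implyP => BB'.
apply/negP => /exists_inP[a + /exists_inP[b + /exists_inP[c + /exists_inP[d + /andP[/andP[ab bc] cd]]]]].
rewrite !inE => /eqP ax /eqP by_ /eqP cx /eqP dy.
case/eqP: BB'; apply/setP => z; rewrite !inE.
have := h _ _ _ _ ab bc cd; rewrite sw pos_lt => /(_ isT).
rewrite -/(lab w a) -/(lab w b) -/(lab w c) -/(lab w d) ax by_ cx dy.
by move=> /(_ erefl erefl) ->.
Qed.

Lemma odd_sum (T : finType) (P : {set T}) (f : T -> nat) :
  odd (\sum_(x in P) f x) = odd #|[set x in P | odd (f x)]|.
Proof.
rewrite -sum1_card (big_mkcond (fun x => x \in [set _ in _ | _])) [in LHS]big_mkcond.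
elim/big_rec2: _ => // x m n _ E; rewrite !oddD E inE.
by case: (x \in P) => //=; case: (odd (f x)).
Qed.

(** Modulo two, the sum of all block sizes counts the odd blocks. Hence conditions on their number
    become conditions on the length of the word. *)
Lemma spelled_odd_blocks : odd #|[set B in p | odd #|B| ]| = odd (size w).
Proof.
have := spells_part wp; rewrite inE => /card_partition; rewrite cardsT card_sum !card_ord.
by rewrite -odd_sum sw => ->.
Qed.

Lemma spelled_even_singletons : sizes_one_two p ->
  even_singletons p = ~~ odd (size w).
Proof.
move=> /forall_inP h; rewrite -spelled_odd_blocks /even_singletons; congr (~~ odd _).
apply: eq_card => B; rewrite !inE; have [Bp|//] := boolP (B \in p).
by case/orP: (h B Bp) => /eqP ->.
Qed.

End Spelled.

(** * The seven collections as classes of words *)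

Lemma coll_eq (X : collection) S ev al : admissible S ev al ->
  (forall k l w (p : blocks k l), spells w p -> (p \in X k l) <-> wordset S ev al w) ->
  (forall k l, X k l \subset Part k l) -> X = coll (wordset S ev al).
Proof.
move=> adm h sub; apply: functional_extensionality_dep => k.
apply: functional_extensionality_dep => l; apply/setP => p.
have HW := wordset_word_class adm.
apply/idP/collP => [pX|[w wp]]; last exact: (h k l w p wp).2.
have [w wp] := spells_ex (subsetP (sub k l) p pX).
by exists w => //; exact: (h k l w p wp).1.
Qed.

Lemma in_NC k l w (p : blocks k l) : spells w p -> (p \in NC k l) <-> nc w.
Proof.
move=> wp; rewrite inE (spells_part wp) /=; exact: spelled_noncrossing.
Qed.

Lemma NC_sub_Part k l : NC k l \subset Part k l.
Proof. by apply/subsetP => p; rewrite inE => /andP[]. Qed.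

Lemma sub_NC_Part (X : collection) : subcollection X NC -> forall k l, X k l \subset Part k l.
Proof. by move=> h k l; exact: subset_trans (h k l) (NC_sub_Part k l). Qed.

Lemma NC_pairs_sub : subcollection NC_pairs NC.
Proof. by move=> k l; apply/subsetP => p; rewrite inE => /andP[]. Qed.
Lemma NC_even_sub : subcollection NC_even NC.
Proof. by move=> k l; apply/subsetP => p; rewrite inE => /andP[]. Qed.
Lemma NC_evenly_many_odd_sub : subcollection NC_evenly_many_odd NC.
Proof. by move=> k l; apply/subsetP => p; rewrite inE => /andP[]. Qed.
Lemma NC_alternating_sub : subcollection NC_alternating NC.
Proof. by move=> k l; apply/subsetP => p; rewrite inE => /andP[]. Qed.
Lemma NC_even_singletons_sub : subcollection NC_even_singletons NC.
Proof. by move=> k l; apply/subsetP => p; rewrite inE => /andP[]. Qed.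
Lemma NC_one_two_sub : subcollection NC_one_two NC.
Proof. by move=> k l; apply/subsetP => p; rewrite inE => /andP[]. Qed.

Lemma sizes_one_twoP k l w (p : blocks k l) : spells w p ->
  sizes_one_two p <-> {in w, forall x, count_mem x w <= 2}.
Proof.
move=> wp; apply: (blocks_forall wp) => a aw; rewrite (card_class wp).
have : 0 < count_mem a w by rewrite -has_count has_pred1.
by case: (count_mem a w) => [|[|[|?]]].
Qed.

Lemma NC_pairsE : NC_pairs = coll (wordset (pred1 2) false false).
Proof.
apply: coll_eq; [exact: admissible_pairs| |exact: sub_NC_Part NC_pairs_sub].
move=> k l w p wp; rewrite inE; split=> [/andP[/(in_NC wp) ncw /(spelled_sizes wp (pred1 2)) h]|[ncw h _ _]].
  by split.
by apply/andP; split; [apply/(in_NC wp)|apply/(spelled_sizes wp (pred1 2))].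
Qed.

Lemma NC_evenE : NC_even = coll (wordset (fun m => ~~ odd m) false false).
Proof.
apply: coll_eq; [exact: admissible_even| |exact: sub_NC_Part NC_even_sub].
move=> k l w p wp; rewrite inE.
split=> [/andP[/(in_NC wp) ncw /(spelled_sizes wp (fun m => ~~ odd m)) h]|[ncw h _ _]].
  by split.
by apply/andP; split; [apply/(in_NC wp)|apply/(spelled_sizes wp (fun m => ~~ odd m))].
Qed.

Lemma NC_evenly_many_oddE : NC_evenly_many_odd = coll (wordset xpredT true false).
Proof.
apply: coll_eq; [exact: admissible_all| |exact: sub_NC_Part NC_evenly_many_odd_sub].
move=> k l w p wp; rewrite inE (spelled_odd_blocks wp).
split=> [/andP[/(in_NC wp) ncw h]|[ncw _ h _]]; first by split.
by apply/andP; split; [apply/(in_NC wp)|exact: h].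
Qed.

Lemma NC_E : NC = coll (wordset xpredT false false).
Proof.
apply: coll_eq; [exact: admissible_all| |exact: NC_sub_Part].
by move=> k l w p wp; split=> [/(in_NC wp) ncw|[ncw _ _ _]]; [split|apply/(in_NC wp)].
Qed.

Lemma NC_alternatingE : NC_alternating = coll (wordset (fun m => m <= 2) true true).
Proof.
apply: coll_eq; [exact: admissible_le2| |exact: sub_NC_Part NC_alternating_sub].
move=> k l w p wp; rewrite inE; split.
  move=> /andP[/(in_NC wp) ncw /and3P[h12 /(spelled_alternating wp) ha]].
  rewrite (spelled_even_singletons wp h12) => he.
  by split=> //; apply/(sizes_one_twoP wp).
move=> [ncw /(sizes_one_twoP wp) h12 he ha].
apply/andP; split; first exact/(in_NC wp).
rewrite (spelled_even_singletons wp h12) h12 he //= andbT.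
by apply/(spelled_alternating wp); exact: ha.
Qed.

Lemma NC_even_singletonsE : NC_even_singletons = coll (wordset (fun m => m <= 2) true false).
Proof.
apply: coll_eq; [exact: admissible_le2| |exact: sub_NC_Part NC_even_singletons_sub].
move=> k l w p wp; rewrite inE; split.
  move=> /andP[/(in_NC wp) ncw /andP[h12]].
  rewrite (spelled_even_singletons wp h12) => he.
  by split=> //; apply/(sizes_one_twoP wp).
move=> [ncw /(sizes_one_twoP wp) h12 he _].
apply/andP; split; first exact/(in_NC wp).
by rewrite (spelled_even_singletons wp h12) h12 he.
Qed.

Lemma NC_one_twoE : NC_one_two = coll (wordset (fun m => m <= 2) false false).
Proof.
apply: coll_eq; [exact: admissible_le2| |exact: sub_NC_Part NC_one_two_sub].
move=> k l w p wp; rewrite inE.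
split=> [/andP[/(in_NC wp) ncw /(sizes_one_twoP wp) h]|[ncw /(sizes_one_twoP wp) h _ _]].
  by split.
by apply/andP; split; [apply/(in_NC wp)|].
Qed.

Lemma coll_nc_category S ev al : admissible S ev al ->
  is_category (coll (wordset S ev al)).
Proof.
move=> adm; apply: coll_category; first exact: wordset_word_class.
exact: wordset_rev.
Qed.

(** * Words of the generators *)

Lemma spells_singleton : spells [:: 0] p_singleton.
Proof. exact: (@spells_one_block 0 1). Qed.

Lemma spells_four : spells [:: 0; 0; 0; 0] p_four.
Proof. exact: (@spells_one_block 0 4). Qed.

Lemma spells_double_singleton : spells [:: 0; 1] p_double_singleton.
Proof.
have s1 : spells [:: 1] p_singleton.
  by apply: (@spells_map 0 1 [:: 0] _ succn _).1 spells_singleton => x y _ _ [].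
apply: (@spells_tensor 0 1 0 1 [:: 0] [::] [:: 1]) => //; last exact: spells_singleton.
by move=> x; rewrite inE => /eqP->.
Qed.

Lemma spells_pos : spells [:: 0; 1; 2; 1] p_pos.
Proof.
split=> //; have cl (a : 'I_4) : forall b : 'I_4,
  (inr b \in [set y : point 0 4 | lab [:: 0; 1; 2; 1] y == lab [:: 0; 1; 2; 1] (inr a : point 0 4)]) =
  (nth 0 [:: 0; 1; 2; 1] b == nth 0 [:: 0; 1; 2; 1] a) by move=> b; rewrite inE.
have io m : m < 4 -> nat_of_ord (inord m : 'I_4) = m by move=> h; rewrite inordK.
have eqo (b : 'I_4) m : m < 4 -> (b == inord m :> 'I_4) = (b == m :> nat).
  by move=> h; rewrite -val_eqE /= io.
have c0 : [set lower4 (inord 0)] = [set y : point 0 4 | lab [:: 0; 1; 2; 1] y == 0].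
  apply/setP => -[[]//|b]; rewrite !inE /lab /= /lower4 -[inr b == _]/(b == inord 0) eqo //.
  by case: b => [[|[|[|[|?]]]] ?].
have c1 : [set lower4 (inord 1); lower4 (inord 3)] = [set y : point 0 4 | lab [:: 0; 1; 2; 1] y == 1].
  apply/setP => -[[]//|b]; rewrite !inE /lab /= /lower4 -[inr b == inr (inord 1)]/(b == inord 1).
  rewrite -[inr b == inr (inord 3)]/(b == inord 3) !eqo //.
  by case: b => [[|[|[|[|?]]]] ?].
have c2 : [set lower4 (inord 2)] = [set y : point 0 4 | lab [:: 0; 1; 2; 1] y == 2].
  apply/setP => -[[]//|b]; rewrite !inE /lab /= /lower4 -[inr b == _]/(b == inord 2) eqo //.
  by case: b => [[|[|[|[|?]]]] ?].
have labm m : m < 4 -> lab [:: 0; 1; 2; 1] (inr (inord m) : point 0 4) = nth 0 [:: 0; 1; 2; 1] m.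
  by move=> h; rewrite /lab /= io.
rewrite /p_pos c0 c1 c2; apply/setP => B; rewrite !inE; apply/idP/classesP.
  case/orP => [/orP[]|] /eqP->.
  - by exists (inr (inord 0)); rewrite labm.
  - by exists (inr (inord 1)); rewrite labm.
  - by exists (inr (inord 2)); rewrite labm.
case=> -[[]//|b] ->; rewrite /lab /=.
by case: b => [[|[|[|[|?]]]] ?] //=; rewrite eqxx ?orbT.
Qed.

Lemma nc_short w : size w < 4 -> nc w.
Proof. by move=> sw a b /size_subseq /=; lia. Qed.

Lemma nc_four : nc [:: 0; 0; 0; 0].
Proof.
move=> a b h; have m x : x \in [:: a; b; a; b] -> x = 0.
  by move/(mem_subseq h); rewrite !inE !orbb => /eqP.
have -> : a = 0 by apply: m; rewrite !inE eqxx.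
by apply/esym/m; rewrite !inE eqxx orbT.
Qed.

Lemma nc_pos : nc [:: 0; 1; 2; 1].
Proof.
move=> a b /size_subseq_leqif[_]; rewrite eqxx => /esym/eqP[-> _].
by [].
Qed.

Lemma generated_coll gs W : is_category (coll W) ->
  contains (coll W) gs ->
  (forall Y, is_category Y -> contains Y gs -> forall w, W w -> words_of Y w) ->
  generated_by gs (coll W).
Proof.
move=> cW gW min; split=> // Y cY gY k l; apply/subsetP => p /collP[w wp Ww].
exact: (min Y cY gY w Ww).
Qed.

Lemma wordset_four (S : pred nat) ev : S 4 -> wordset S ev false [:: 0; 0; 0; 0].
Proof.
move=> S4; split=> //; first exact: nc_four.
by move=> x; rewrite !inE !orbb => /eqP->.
Qed.

Lemma wordset_singleton (S : pred nat) : S 1 -> wordset S false false [:: 0].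
Proof.
by move=> S1; split=> //; [exact: nc_short|move=> x; rewrite inE => /eqP->].
Qed.

Lemma wordset_double (S : pred nat) ev al : S 1 -> wordset S ev al [:: 0; 1].
Proof.
move=> S1; split=> //; first exact: nc_short.
  by move=> x; rewrite !inE => /orP[]/eqP->.
by move=> _ x; case: x => [|[|x]].
Qed.

Lemma wordset_pos (S : pred nat) ev : S 1 -> S 2 -> wordset S ev false [:: 0; 1; 2; 1].
Proof.
move=> S1 S2; split=> //; first exact: nc_pos.
by move=> x; rewrite !inE => /or4P[]/eqP->.
Qed.

Lemma contains1 (X : collection) k l (p : blocks k l) :
  contains X [:: diag p] <-> p \in X k l.
Proof. by rewrite /contains /= andbT. Qed.

Lemma contains2 (X : collection) k l (p : blocks k l) k' l' (q : blocks k' l') :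
  contains X [:: diag p; diag q] <-> p \in X k l /\ q \in X k' l'.
Proof. by rewrite /contains /= andbT; split=> [/andP|[-> ->]]. Qed.

Section Generators.
Variables (Y : collection) (HY : is_category Y).

Lemma words_of_singleton : p_singleton \in Y 0 1 -> words_of Y [:: 0].
Proof. exact: words_of_ex HY _ _ _ _ spells_singleton. Qed.

Lemma words_of_double : p_double_singleton \in Y 0 2 -> words_of Y [:: 0; 1].
Proof. exact: words_of_ex HY _ _ _ _ spells_double_singleton. Qed.

Lemma words_of_four : p_four \in Y 0 4 -> words_of Y [:: 0; 0; 0; 0].
Proof. exact: words_of_ex HY _ _ _ _ spells_four. Qed.

Lemma words_of_pos : p_pos \in Y 0 4 -> words_of Y [:: 0; 1; 2; 1].
Proof. exact: words_of_ex HY _ _ _ _ spells_pos. Qed.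

End Generators.

(** * The seven categories and their generators *)

Lemma NC_pairs_category : is_nc_category NC_pairs /\ generated_by [::] NC_pairs.
Proof.
have cat : is_category NC_pairs by rewrite NC_pairsE; exact: coll_nc_category admissible_pairs.
split; first by split=> //; exact: NC_pairs_sub.
rewrite NC_pairsE in cat *; apply: generated_coll => // Y cY _ w.
exact: generate_pairs (words_of_word_class cY) w.
Qed.

Lemma NC_even_category : is_nc_category NC_even /\ generated_by [:: diag p_four] NC_even.
Proof.
have cat : is_category NC_even by rewrite NC_evenE; exact: coll_nc_category admissible_even.
split; first by split=> //; exact: NC_even_sub.
rewrite NC_evenE in cat *; apply: generated_coll => //.
  by apply/contains1/collP; exists [:: 0; 0; 0; 0]; [exact: spells_four|exact: wordset_four].
move=> Y cY /contains1 /(words_of_four cY) W4 w.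
exact: generate_even (words_of_word_class cY) w W4.
Qed.

Lemma NC_evenly_many_odd_category : is_nc_category NC_evenly_many_odd /\
  generated_by [:: diag p_double_singleton; diag p_four] NC_evenly_many_odd.
Proof.
have cat : is_category NC_evenly_many_odd.
  by rewrite NC_evenly_many_oddE; exact: coll_nc_category (admissible_all true).
split; first by split=> //; exact: NC_evenly_many_odd_sub.
rewrite NC_evenly_many_oddE in cat *; apply: generated_coll => //.
  apply/contains2; split; apply/collP.
    by exists [:: 0; 1]; [exact: spells_double_singleton|exact: wordset_double].
  by exists [:: 0; 0; 0; 0]; [exact: spells_four|exact: wordset_four].
move=> Y cY /contains2[/(words_of_double cY) W2 /(words_of_four cY) W4] w.
exact: generate_all_even (words_of_word_class cY) w W2 W4.
Qed.

Lemma NC_category : is_nc_category NC /\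
  generated_by [:: diag p_singleton; diag p_four] NC.
Proof.
have cat : is_category NC by rewrite NC_E; exact: coll_nc_category (admissible_all false).
split; first by split.
rewrite NC_E in cat *; apply: generated_coll => //.
  apply/contains2; split; apply/collP.
    by exists [:: 0]; [exact: spells_singleton|exact: wordset_singleton].
  by exists [:: 0; 0; 0; 0]; [exact: spells_four|exact: wordset_four].
move=> Y cY /contains2[/(words_of_singleton cY) W1 /(words_of_four cY) W4] w.
exact: generate_all (words_of_word_class cY) w W1 W4.
Qed.

Lemma NC_alternating_category : is_nc_category NC_alternating /\
  generated_by [:: diag p_double_singleton] NC_alternating.
Proof.
have cat : is_category NC_alternating.
  by rewrite NC_alternatingE; exact: coll_nc_category (admissible_le2 _).
split; first by split=> //; exact: NC_alternating_sub.
rewrite NC_alternatingE in cat *; apply: generated_coll => //.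
  by apply/contains1/collP; exists [:: 0; 1]; [exact: spells_double_singleton|exact: wordset_double].
move=> Y cY /contains1 /(words_of_double cY) W2 w.
exact: generate_alternating (words_of_word_class cY) w W2.
Qed.

Lemma NC_even_singletons_category : is_nc_category NC_even_singletons /\
  generated_by [:: diag p_pos] NC_even_singletons.
Proof.
have cat : is_category NC_even_singletons.
  by rewrite NC_even_singletonsE; exact: coll_nc_category (admissible_le2 _).
split; first by split=> //; exact: NC_even_singletons_sub.
rewrite NC_even_singletonsE in cat *; apply: generated_coll => //.
  by apply/contains1/collP; exists [:: 0; 1; 2; 1]; [exact: spells_pos|exact: wordset_pos].
move=> Y cY /contains1 /(words_of_pos cY) Wp w.
exact: generate_even_singletons (words_of_word_class cY) w Wp.
Qed.

Lemma NC_one_two_category : is_nc_category NC_one_two /\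
  generated_by [:: diag p_singleton] NC_one_two.
Proof.
have cat : is_category NC_one_two.
  by rewrite NC_one_twoE; exact: coll_nc_category (admissible_le2 _).
split; first by split=> //; exact: NC_one_two_sub.
rewrite NC_one_twoE in cat *; apply: generated_coll => //.
  by apply/contains1/collP; exists [:: 0]; [exact: spells_singleton|exact: wordset_singleton].
move=> Y cY /contains1 /(words_of_singleton cY) W1 w.
exact: generate_le2 (words_of_word_class cY) w W1.
Qed.

(** * Quantum groups of word classes *)

Local Open Scope ring_scope.

Section QuantumGroup.
Variables (R : realType) (D : finType) (W : seq nat -> Prop).
Hypotheses (HW : word_class W) (Wrev : forall w, W w -> W (rev w)).
Variable d0 : D.
Implicit Types (I J K X Y : seq D).

Local Notation C := R[i].

(* A C*-algebra with a matrix whose fixed vectors are spanned by the vectors of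
   the words in [W]: the GNS representation of the Haar functional. *)
Lemma quantum_group_exists : exists (B : cstarType C) (v : D -> D -> B),
  [/\ forall i j, star (v i j) = v i j,
      forall k l (tau : seq D -> C), Fix W (k + l) tau ->
        intertwines v k l (fun J I => tau (rev I ++ J))
    & forall N f, fixed v N f -> Fix W N f].
Proof.
have [B [v' [v_star v_rel]]] := gns (haar_state R HW Wrev d0).
pose v i j := v' (i, j); exists B, v.
have uE I J : uprod v I J = \prod_(c <- zip I J) v' c.
  by apply: eq_bigr => -[].
have zipK I J : size I = size J -> unzip1 (zip I J) = I /\ unzip2 (zip I J) = J.
  by move=> IJ; rewrite unzip1_zip ?unzip2_zip ?IJ.
split=> [i j|k l tau ft J I' sJ sI'|N f hf]; first exact: v_star.
  (* The polynomial whose vanishing is the intertwining relation. By [gns] it is tested under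
     [haar], with arbitrary words on both sides, where it becomes [haar_act]. *)
  pose s := [seq (tau (rev K ++ J), zip K I') | K <- words D k] ++
    [seq (- tau (rev I' ++ J'), zip J J') | J' <- words D l].
  have := (v_rel s).2; rewrite big_cat !big_map /= => h; apply/eqP.
  rewrite -subr_eq0 -sumrN; apply/eqP; apply: etrans (h _).
    congr (_ + _); apply: eq_bigr => ? _; rewrite uE //.
    by rewrite scaleNr.
  move=> a b; rewrite big_cat !big_map /=.
  have := haar_act HW Wrev ft (A := unzip1 a) (J := J) (B := unzip1 b)
    (A' := unzip2 a) (I' := I') (B' := unzip2 b); rewrite !size_map.
  move=> /(_ erefl erefl sJ sI') E.
  have hE (I K : seq D) : size I = size K ->
      haar R W (a ++ zip I K ++ b) = proj R[i] W (size (unzip1 a ++ I ++ unzip1 b))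
        (unzip1 a ++ I ++ unzip1 b) (unzip2 a ++ K ++ unzip2 b).
    move=> IK; rewrite /haar; have [-> ->] := unzip_cat a (zip I K ++ b).
    by have [-> ->] := unzip_cat (zip I K) b; have [-> ->] := zipK _ _ IK.
  rewrite (eq_big_words (G := fun I => tau (rev I ++ J) *
    proj R[i] W (size (unzip1 a ++ I ++ unzip1 b))
        (unzip1 a ++ I ++ unzip1 b) (unzip2 a ++ I' ++ unzip2 b))); last first.
    by move=> I sI; rewrite hE // sI.
  rewrite E; apply/eqP; rewrite addr_eq0 -sumrN; apply/eqP.
  by apply: eq_big_words => J' sJ'; rewrite hE ?sJ' // mulNr opprK mulrC.
(* Applying the Haar functional to the fixed-point equation of [f] gives that [f] equals its own
   projection, which is a combination of columns in [Fix]. *)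
apply: (@Fix_ext _ _ _ _ (fun X => \sum_(Y <- words D N) f Y * proj R[i] W N X Y)); last first.
  by apply: Fix_sum => Y _; apply: FixZ; exact: Fix_proj.
move=> X sX.
pose s := [seq (f Y, zip X Y) | Y <- words D N] ++ [:: (- f X, [::])].
have s0 : \sum_(ct <- s) ct.1 *: \prod_(c <- ct.2) v' c = 0.
  rewrite big_cat big_map big_seq1 /= big_nil scaleNr -(hf X sX) -sumrN -big_split /=.
  by rewrite big1 // => Y _; rewrite uE subrr.
have := (v_rel s).1 s0 [::] [::].
rewrite big_cat big_map big_seq1 /= haar_nil // mulr1 => /eqP; rewrite subr_eq0 => /eqP <-.
apply: eq_big_words => Y sY; rewrite cats0 /haar.
by have [|-> ->] := zipK X Y; rewrite sX.
Qed.

End QuantumGroup.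

(** * Spans of the maps of partitions *)

Section Span.
Variables (C : numClosedFieldType) (n : nat) (n0 : (0 < n)%N).
Variables (W : seq nat -> Prop) (HW : word_class W).
Local Notation D := ('I_n).

Lemma delta_compat k l w (p : blocks k l) (i : multi_index n k) (j : multi_index n l) :
  spells w p -> delta p i j = compat w (rev (wd i) ++ wd j).
Proof.
move=> [sw pE].
have sX : size (rev (wd i) ++ wd j) = size w by rewrite size_cat size_rev !size_wd sw.
have idx (x : point k l) : nth (d0 n0) (rev (wd i) ++ wd j) (pos x) = index_at i j x.
  rewrite nth_cat size_rev size_wd; case: x => [a|b] /=.
    have ka : (k - a.+1 < k)%N by have := ltn_ord a; lia.
    rewrite ka nth_rev size_wd //; rewrite (_ : (k - (k - a.+1).+1 = a)%N) ?nth_wd //.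
    by have := ltn_ord a; lia.
  by rewrite ltnNge leq_addr /= addKn nth_wd.
apply/idP/(compatP (d0 n0) sX) => [h i1 j1|h].
  rewrite sw => /(@pos_surj k l)[x <-] /(@pos_surj k l)[y <-] xy; rewrite !idx.
  move: h; rewrite /delta pE => /forall_inP/(_ _ (in_classes (lab w) x)).
  by move=> /forall_inP/(_ x _)/forall_inP/(_ y _)/eqP; apply; rewrite inE // /lab xy.
apply/forall_inP => B; rewrite pE => /classesP[z ->].
apply/forall_inP => x; rewrite inE => /eqP xz; apply/forall_inP => y; rewrite inE => /eqP yz.
by rewrite -!idx; apply/eqP/h; rewrite ?sw ?pos_lt // -/(lab w x) xz -yz.
Qed.

Lemma span_ind (vT : vectType C) (s : seq vT) (Q : vT -> Prop) :
  Q 0 -> (forall a x y, Q x -> Q y -> Q (a *: x + y)) -> {in s, forall x, Q x} ->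
  forall x, x \in <<s>>%VS -> Q x.
Proof.
move=> Q0 QD Qs x; rewrite -[s]in_tupleE => /coord_span ->.
apply: (big_ind Q) => // [y z Qy Qz|i _]; first by rewrite -[y]scale1r; exact: QD.
rewrite -[_ *: _]addr0; apply: QD => //; apply: Qs; exact: mem_nth.
Qed.

Lemma span_Fix k l (T : 'Hom(tensor_power C n k, tensor_power C n l)) :
  T \in <<[seq T_ C n p | p in coll W k l]>>%VS <-> Fix W (k + l) (frob k (coefw n0 T)).
Proof.
have frobE (S : 'Hom(tensor_power C n k, tensor_power C n l)) X : size X = (k + l)%N ->
    frob k (coefw n0 S) X = coef S (mi n0 l (drop k X)) (mi n0 k (rev (take k X))) by [].
split.
  move: T; apply: span_ind.
  - apply: Fix_ext (@Fix0 _ _ _ _) => X sX.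
    by rewrite /frob /coefw /coef zero_lfunE ffunE.
  - move=> a S T hS hT; apply: Fix_ext (FixD (FixZ a hS) hT) => X sX.
    by rewrite /frob /coefw /coef add_lfunE scale_lfunE !ffunE.
  - move=> _ /imageP[p /collP[w wp Ww] ->].
    have [sw _] := wp; rewrite -sw; apply: Fix_ext (Fix_xi C D Ww) => X sX.
    have sR : size (rev (take k X)) = k by rewrite size_rev size_takel // sX sw leq_addr.
    have sD : size (drop k X) = l by rewrite size_drop sX sw addKn.
    by rewrite /frob /coefw coef_T (delta_compat _ _ wp) !miK // revK cat_take_drop.
move=> [s sW sE].
have -> : T = \sum_(ct <- s) ct.1 *: T_ C n (of_word k l ct.2).
  apply: coef_ext => j i.
  have := sE (rev (wd i) ++ wd j); rewrite size_cat size_rev !size_wd => /(_ erefl).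
  rewrite frob_cat ?size_rev ?size_wd // revK /coefw !wdK => ->.
  rewrite /coef sum_lfunE sum_ffunE; apply: eq_big_seq => ct /sW[Wct sct].
  rewrite scale_lfunE [RHS]ffunE; congr (_ * _).
  rewrite -[RHS]/(coef _ j i) coef_T (@delta_compat k l ct.2) //.
rewrite big_seq; apply: memv_suml => ct /sW[Wct sct]; apply/memvZ/memv_span.
by apply: image_f; apply/(in_coll HW (spells_of_word sct)).
Qed.

End Span.

Lemma orthogonal_fixed_word_class (C : numClosedFieldType) n (A : cstarType C)
    (u : 'I_n -> 'I_n -> A) : (0 < n)%N -> orthogonal_system u ->
  word_class (Wfixed u).
Proof.
move=> n0 [_ orth]; apply: fixed_word_class => [i j|i j|].
- by have [] := orth i j.
- by have [] := orth i j.
- by rewrite card_ord -lt0n.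
Qed.

Section Correspondence.
Variables (R : realType) (S : pred nat) (ev al : bool).
Hypothesis adm : admissible S ev al.
Local Notation C := R[i].
Local Notation W := (wordset S ev al).

(** The first hypothesis makes the vectors of [W] fixed under any solution of the relations. The
    second makes the GNS matrix a solution, so that universality yields a homomorphism to it. *)
Lemma correspondence (rel : relations C) :
  (forall n (A : cstarType C) (u : 'I_n -> 'I_n -> A), (0 < n)%N -> rel n A u ->
     orthogonal_system u /\ forall w, W w -> Wfixed u w) ->
  (forall n (B : cstarType C) (v : 'I_n -> 'I_n -> B),
     (forall i j, star (v i j) = v i j) ->
     (forall k l w, W w -> size w = (k + l)%N ->
        intertwines v k l (fun J I => xi C w (rev I ++ J))) -> rel n B v) ->
  corresponds_to (coll W) rel.
Proof.
move=> relW Wrel n n0 A u [ru _ univ] k l T.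
have HW := wordset_word_class adm; have [orth uW] := relW _ _ _ n0 ru.
have [_ uo] := orth.
have u_row i j : \sum_m u i m * u j m = (i == j)%:R by have [] := uo i j.
have u_col i j : \sum_m u m i * u m j = (i == j)%:R by have [] := uo i j.
rewrite (span_Fix n0 HW) (intertwinerE n0).
split=> [uT|fT]; last first.
  apply/(intertwines_fixed u_row u_col)/fixed_Fix.
  have [s sW sE] := fT; exists s => // ct /sW[Wct sct]; split=> //; exact: uW.
(* An intertwiner of [u] is one of [v], by universality. *)
have [B [v [v_star v_int v_fix]]] := quantum_group_exists R HW (wordset_rev (al := al)) (d0 n0).
have rv : rel n B v.
  apply: Wrel => // k' l' w Ww sw; apply: v_int; rewrite -sw; exact: Fix_xi.
have [[_ vo] _] := relW _ _ _ n0 rv.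
have v_row i j : \sum_m v i m * v j m = (i == j)%:R by have [] := vo i j.
have v_col i j : \sum_m v m i * v m j = (i == j)%:R by have [] := vo i j.
have [f [f_star fu]] := univ B v rv.
apply: v_fix; apply/(intertwines_fixed v_row v_col) => J I sJ sI.
have fprod I' I'' : f (uprod u I' I'') = uprod v I' I''.
  by rewrite rmorph_prod; apply: eq_bigr => ij _; exact: fu.
have := congr1 f (uT J I sJ sI); rewrite !linear_sum.
under eq_bigr do rewrite linearZ /= fprod.
by under [X in _ = X -> _]eq_bigr do rewrite linearZ /= fprod.
Qed.

End Correspondence.

(** * The relations of the seven quantum groups *)

Section SmallWords.
Variables (C : numClosedFieldType) (D : finType).
Implicit Types a b c d : D.

Lemma xi_singleton a : xi C [:: 0]%N [:: a] = 1.
Proof. by rewrite /xi (compat_map (fun=> a)). Qed.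

Lemma xi_pair a b : xi C [:: 0; 0]%N [:: a; b] = (a == b)%:R.
Proof.
rewrite /xi; congr (_%:R); congr nat_of_bool; apply/asboolP/eqP => [[g [-> ->]] //|->].
by exists (fun=> b).
Qed.

Lemma xi_double a b : xi C [:: 0; 1]%N [:: a; b] = 1.
Proof. by rewrite /xi (compat_map (fun m => if m == 0%N then a else b) [:: 0; 1]%N). Qed.

Lemma xi_four a b c d :
  xi C [:: 0; 0; 0; 0]%N [:: a; b; c; d] = [&& a == b, b == c & c == d]%:R.
Proof.
rewrite /xi; congr (_%:R); congr nat_of_bool; apply/asboolP/and3P.
  by move=> [g [-> -> -> ->]].
by move=> [/eqP-> /eqP-> /eqP->]; exists (fun=> d).
Qed.

Lemma xi_pos a b c d : xi C [:: 0; 1; 2; 1]%N [:: a; b; c; d] = (b == d)%:R.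
Proof.
rewrite /xi; congr (_%:R); congr nat_of_bool; apply/asboolP/eqP => [[g [_ -> _ ->]] //|->].
by exists (fun m => if m == 0%N then a else if m == 1%N then d else c).
Qed.

Variable V : nmodType.

Lemma big_words1 (F : seq D -> V) : \sum_(w <- words D 1) F w = \sum_a F [:: a].
Proof. by rewrite big_wordsS; apply: eq_bigr => a _; rewrite big_words0. Qed.

Lemma big_words2 (F : seq D -> V) :
  \sum_(w <- words D 2) F w = \sum_a \sum_b F [:: a; b].
Proof. by rewrite big_wordsS; apply: eq_bigr => a _; rewrite big_words1. Qed.

Lemma big_words4 (F : seq D -> V) :
  \sum_(w <- words D 4) F w = \sum_a \sum_b \sum_c \sum_d F [:: a; b; c; d].
Proof.
rewrite big_wordsS; apply: eq_bigr => a _; rewrite big_wordsS; apply: eq_bigr => b _.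
exact: big_words2.
Qed.

End SmallWords.

Section Relations.
Variables (C : numClosedFieldType) (n : nat) (A : cstarType C).
Variable u : 'I_n -> 'I_n -> A.
Local Notation D := 'I_n.

Lemma uprod1 i j : uprod u [:: i] [:: j] = u i j.
Proof. by rewrite uprod_cons uprod_nil mulr1. Qed.

Lemma uprod2 i i' j j' : uprod u [:: i; i'] [:: j; j'] = u i j * u i' j'.
Proof. by rewrite uprod_cons uprod1. Qed.

Lemma sum_deltal (a : D) (F : D -> A) : \sum_b (b == a)%:R *: F b = F a.
Proof.
rewrite (bigD1 a) //= eqxx scale1r big1 ?addr0 // => b /negPf->.
by rewrite scale0r.
Qed.

Lemma sum_deltar (a : D) (F : D -> A) : \sum_b (a == b)%:R *: F b = F a.
Proof. by rewrite -[RHS]sum_deltal; apply: eq_bigr => b _; rewrite eq_sym. Qed.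

Lemma fixed_singleton : (forall i, \sum_k u i k = 1) -> Wfixed u [:: 0]%N.
Proof.
move=> h [|i [|? ?]] // _; rewrite big_words1 xi_singleton scale1r -(h i).
by apply: eq_bigr => j _; rewrite xi_singleton scale1r uprod1.
Qed.

(** The entries of the second sum can be replaced, for each [k], by the sum of column [k].
    Orthogonality of rows then leaves only the term with row [i], which is 1. *)
Lemma sum_row_mul : orthogonal_system u -> equal_sums u ->
  forall i j, (\sum_k u i k) * (\sum_k u j k) = 1.
Proof.
move=> [_ orth] eqs i j; rewrite mulr_suml.
transitivity (\sum_k \sum_l u i k * u l k).
  by apply: eq_bigr => k _; rewrite (eqs j k) mulr_sumr.
rewrite exchange_big /= (bigD1 i) //= [X in _ + X]big1 => [|l li].
  by have [-> _] := orth i i; rewrite eqxx addr0.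
by have [-> _] := orth i l; rewrite eq_sym (negPf li).
Qed.

Lemma fixed_double : orthogonal_system u -> equal_sums u -> Wfixed u [:: 0; 1]%N.
Proof.
move=> orth eqs [|i [|i' [|? ?]]] // _; rewrite big_words2 xi_double scale1r.
rewrite -(sum_row_mul orth eqs i i') mulr_suml; apply: eq_bigr => j _.
by rewrite mulr_sumr; apply: eq_bigr => j' _; rewrite xi_double scale1r uprod2.
Qed.

Lemma fixed_four : cubic_system u -> Wfixed u [:: 0; 0; 0; 0]%N.
Proof.
move=> [[_ orth] cub] [|i1 [|i2 [|i3 [|i4 [|? ?]]]]] // _; rewrite big_words4 xi_four.
transitivity (\sum_j u i1 j * u i2 j * (u i3 j * u i4 j)).
  apply: eq_bigr => a _.
  transitivity (\sum_b (a == b)%:R *: \sum_c (b == c)%:R *: \sum_d (c == d)%:R *: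
      uprod u [:: i1; i2; i3; i4] [:: a; b; c; d]).
    apply: eq_bigr => b _; rewrite scaler_sumr; apply: eq_bigr => c _.
    rewrite !scaler_sumr; apply: eq_bigr => d _.
    by rewrite xi_four !scalerA -!natrM !mulnb andbA.
  by rewrite !sum_deltar !uprod_cons uprod_nil mulr1 mulrA.
have [i12|i12] := eqVneq i1 i2; last first.
  rewrite scale0r big1 // => j _.
  by have [-> _] := cub _ _ j i12; rewrite mul0r.
have [i34|i34] := eqVneq i3 i4; last first.
  rewrite andbF scale0r big1 // => j _.
  by have [-> _] := cub _ _ j i34; rewrite mulr0.
have [i23|i23] := eqVneq i2 i3; last first.
  rewrite scale0r big1 // => j _; rewrite mulrA -(mulrA (u i1 j)).
  by have [-> _] := cub _ _ j i23; rewrite mulr0 mul0r.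
have [E _] := orth i4 i4; rewrite eqxx in E.
rewrite scale1r i12 i23 i34 -[RHS]E.
(* Multiplying the square of an entry by the sum of the squares along its row, which is 1, shows
   that this square is idempotent: the mixed terms vanish by the cubic relations. *)
apply: eq_bigr => j _; rewrite -[RHS]mulr1 -[X in _ = _ * X]E mulr_sumr.
rewrite (bigD1 j) //= big1 ?addr0 // => k kj.
rewrite mulrA -(mulrA (u i4 j)); have jk : j != k by rewrite eq_sym.
by have [_ ->] := cub _ _ i4 jk; rewrite mulr0 mul0r.
Qed.

(** Summing over the two singletons produces the factor [r] twice. It commutes with the entries and
    squares to 1, so only an orthogonality sum of rows remains. *)
Lemma fixed_pos : bistochastic_system' u -> Wfixed u [:: 0; 1; 2; 1]%N.
Proof.
move=> [[orth eqs] comm] [|i1 [|i2 [|i3 [|i4 [|? ?]]]]] // _; rewrite big_words4 xi_pos.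
pose r := \sum_k u i3 k.
have rE : \sum_k u i1 k = r by rewrite (eqs i1 i1) -(eqs i3 i1).
have rr : r * r = 1 by rewrite sum_row_mul.
transitivity (r * \sum_b u i2 b * (r * u i4 b)).
  rewrite -{1}rE mulr_suml; apply: eq_bigr => a _; rewrite mulr_sumr; apply: eq_bigr => b _.
  rewrite /r mulr_suml mulr_sumr mulr_sumr; apply: eq_bigr => c _.
  under eq_bigr do rewrite xi_pos.
  by rewrite sum_deltar !uprod_cons uprod_nil mulr1.
have -> : \sum_b u i2 b * (r * u i4 b) = r * (i2 == i4)%:R.
  have [_ orth'] := orth; have [<- _] := orth' i2 i4; rewrite mulr_sumr.
  by apply: eq_bigr => b _; rewrite mulrA comm mulrA.
by rewrite mulrA rr mul1r; case: (_ == _); rewrite ?scale1r ?scale0r.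
Qed.

(** * Relations obtained from intertwiners *)

Section FromIntertwiners.
Variable W : seq nat -> Prop.
Hypothesis u_star : forall i j, star (u i j) = u i j.
Hypothesis u_int : forall k l w, W w -> size w = (k + l)%N ->
  intertwines u k l (fun J I => xi C w (rev I ++ J)).

Lemma int_orthogonal : W [:: 0; 0]%N -> orthogonal_system u.
Proof.
move=> W2; split=> // i j; split.
  have := @u_int 0 2 _ W2 erefl [:: i; j] [::] erefl erefl.
  rewrite big_words0 big_words2 /= uprod_nil xi_pair -natb_alg => ->.
  apply: eq_bigr => a _; under eq_bigr do rewrite xi_pair uprod2.
  by rewrite sum_deltar.
have := @u_int 2 0 _ W2 erefl [::] [:: i; j] erefl erefl.
rewrite big_words0 big_words2 /= uprod_nil xi_pair -natb_alg (eq_sym j) => <-.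
apply: eq_bigr => a _; under eq_bigr do rewrite xi_pair uprod2.
by rewrite sum_deltal.
Qed.

(** With two upper and two lower points, the four block sends [e_c (x) e_d] to [e_c (x) e_c] if
    [c = d] and to 0 otherwise. Each relation comes from a coefficient at which one side of the
    intertwining identity is empty. *)
Lemma int_cubic : W [:: 0; 0]%N -> W [:: 0; 0; 0; 0]%N -> cubic_system u.
Proof.
move=> W2 W4; split; first exact: int_orthogonal.
move=> i j k /negPf ij.
have E a b c d : \sum_x \sum_y [&& y == x, x == a & a == b]%:R *: (u x c * u y d) =
    \sum_x \sum_y [&& d == c, c == x & x == y]%:R *: (u a x * u b y).
  have := @u_int 2 2 _ W4 erefl [:: a; b] [:: c; d] erefl erefl.
  rewrite !big_words2; under eq_bigr do under eq_bigr do rewrite [rev _]/= xi_four uprod2.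
  by move=> ->; apply: eq_bigr => x _; apply: eq_bigr => y _; rewrite xi_four uprod2.
split.
  have := E i j k k; rewrite [LHS]big1 => [|x _].
    move=> /esym; under eq_bigr => x _ do under eq_bigr => y _ do
      rewrite eqxx /= -mulnb natrM -scalerA.
    under eq_bigr => x _ do rewrite -scaler_sumr sum_deltar.
    by rewrite sum_deltar.
  by apply: big1 => y _; rewrite ij !andbF scale0r.
have := E k k i j; rewrite [RHS]big1 => [|x _].
  under eq_bigr => x _ do under eq_bigr => y _ do
    rewrite eqxx andbT andbC -mulnb natrM -scalerA.
  under eq_bigr => x _ do rewrite -scaler_sumr sum_deltal.
  by rewrite sum_deltal.
by apply: big1 => y _; rewrite eq_sym ij scale0r.
Qed.

(** With one upper and one lower point, the two singletons are the matrix with all entries 1;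
    commuting with it equates row sums and column sums. *)
Lemma int_equal_sums : W [:: 0; 1]%N -> equal_sums u.
Proof.
move=> W2 i j; have := @u_int 1 1 _ W2 erefl [:: i] [:: j] erefl erefl.
rewrite !big_words1; under eq_bigr do rewrite [rev _]/= xi_double scale1r uprod1.
under [X in _ = X -> _]eq_bigr do rewrite xi_double scale1r uprod1.
exact: esym.
Qed.

Lemma int_sum1 : W [:: 0]%N -> forall i, \sum_k u i k = 1.
Proof.
move=> W1 i; have := @u_int 0 1 _ W1 erefl [:: i] [::] erefl erefl.
rewrite big_words0 big_words1 /= uprod_nil xi_singleton scale1r => ->.
by apply: eq_bigr => k _; rewrite xi_singleton scale1r uprod1.
Qed.

(** With two upper and two lower points, the positioner sends [e_x (x) e_y] to the sum over [b] of
    [e_b (x) e_x]. The identity equates [u i j] times a column sum with a row sum times [u i j], and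
    the two singletons identify these sums. *)
Lemma int_commute : W [:: 0; 1]%N -> W [:: 0; 1; 2; 1]%N ->
  forall i j a, let r := \sum_k u a k in u i j * r = r * u i j.
Proof.
move=> W2 Wp i j a /=.
have := @u_int 2 2 _ Wp erefl [:: a; i] [:: j; j] erefl erefl.
rewrite !big_words2 exchange_big /=.
under eq_bigr => y _ do under eq_bigr => x _ do rewrite xi_pos uprod2.
under eq_bigr do rewrite sum_deltal.
under [X in _ = X -> _]eq_bigr => x _ do under eq_bigr => y _ do rewrite xi_pos uprod2.
under [X in _ = X -> _]eq_bigr do rewrite sum_deltar.
by rewrite -mulr_sumr -mulr_suml -(int_equal_sums W2 a).
Qed.

End FromIntertwiners.

End Relations.

Section Correspondences.
Variable R : realType.

Lemma wordset_pair (S : pred nat) ev al : admissible S ev al ->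
  wordset S ev al [:: 0; 0]%N.
Proof. by move=> adm; exact: wc_pair (wordset_word_class adm). Qed.

Lemma NC_pairs_corresponds : corresponds_to NC_pairs (@orthogonal_system R[i]).
Proof.
have adm := admissible_pairs; rewrite NC_pairsE.
apply: (correspondence adm) => [n A u n0 orth|n B v vs vW].
  split=> // w; exact: (generate_pairs (orthogonal_fixed_word_class n0 orth)).
exact: int_orthogonal vs vW (wordset_pair adm).
Qed.

Lemma NC_even_corresponds : corresponds_to NC_even (@cubic_system R[i]).
Proof.
have adm := admissible_even; rewrite NC_evenE.
apply: (correspondence adm) => [n A u n0 cub|n B v vs vW].
  have [orth _] := cub; split=> // w.
  exact: (generate_even (orthogonal_fixed_word_class n0 orth)) (fixed_four cub).
by apply: int_cubic vs vW (wordset_pair adm) _; exact: wordset_four.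
Qed.

Lemma NC_evenly_many_odd_corresponds :
  corresponds_to NC_evenly_many_odd (@magic_system' R[i]).
Proof.
have adm := admissible_all true; rewrite NC_evenly_many_oddE.
apply: (correspondence adm) => [n A u n0 [cub eqs]|n B v vs vW].
  have [orth _] := cub; split=> // w.
  exact: (generate_all_even (orthogonal_fixed_word_class n0 orth))
    (fixed_double orth eqs) (fixed_four cub).
split; first by apply: int_cubic vs vW (wordset_pair adm) _; exact: wordset_four.
by apply: int_equal_sums vW _; exact: wordset_double.
Qed.

Lemma NC_corresponds : corresponds_to NC (@magic_system R[i]).
Proof.
have adm := admissible_all false; rewrite NC_E.
apply: (correspondence adm) => [n A u n0 [[cub eqs] sum1]|n B v vs vW].
  have [orth _] := cub; split=> // w.
  exact: (generate_all (orthogonal_fixed_word_class n0 orth))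
    (fixed_singleton sum1) (fixed_four cub).
split; first split; first by apply: int_cubic vs vW (wordset_pair adm) _; exact: wordset_four.
  by apply: int_equal_sums vW _; exact: wordset_double.
by apply: int_sum1 vW _; exact: wordset_singleton.
Qed.

Lemma NC_alternating_corresponds :
  corresponds_to NC_alternating (@bistochastic_sharp_system R[i]).
Proof.
have adm := @admissible_le2 true true isT; rewrite NC_alternatingE.
apply: (correspondence adm) => [n A u n0 [orth eqs]|n B v vs vW].
  split=> // w.
  exact: (generate_alternating (orthogonal_fixed_word_class n0 orth)) (fixed_double orth eqs).
split; first exact: int_orthogonal vs vW (wordset_pair adm).
by apply: int_equal_sums vW _; exact: wordset_double.
Qed.

Lemma NC_even_singletons_corresponds :
  corresponds_to NC_even_singletons (@bistochastic_system' R[i]).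
Proof.
have adm := @admissible_le2 true false isT; rewrite NC_even_singletonsE.
apply: (correspondence adm) => [n A u n0 bis|n B v vs vW].
  have [[orth _] _] := bis; split=> // w.
  exact: (generate_even_singletons (orthogonal_fixed_word_class n0 orth)) (fixed_pos bis).
split; last by apply: int_commute vW _ _; [exact: wordset_double|exact: wordset_pos].
split; first exact: int_orthogonal vs vW (wordset_pair adm).
by apply: int_equal_sums vW _; exact: wordset_double.
Qed.

Lemma NC_one_two_corresponds : corresponds_to NC_one_two (@bistochastic_system R[i]).
Proof.
have adm := @admissible_le2 false false isT; rewrite NC_one_twoE.
apply: (correspondence adm) => [n A u n0 [[[orth _] _] sum1]|n B v vs vW].
  split=> // w.
  exact: (generate_le2 (orthogonal_fixed_word_class n0 orth)) (fixed_singleton sum1).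
split; last by apply: int_sum1 vW _; exact: wordset_singleton.
split; last by apply: int_commute vW _ _; [exact: wordset_double|exact: wordset_pos].
split; first exact: int_orthogonal vs vW (wordset_pair adm).
by apply: int_equal_sums vW _; exact: wordset_double.
Qed.

End Correspondences.

Theorem proposition2p7 (R : realType) :
  (is_nc_category NC_pairs
   /\ generated_by [::] NC_pairs
   /\ corresponds_to NC_pairs (@orthogonal_system R[i]))
  /\
  (is_nc_category NC_even
   /\ generated_by [:: diag p_four] NC_even
   /\ corresponds_to NC_even (@cubic_system R[i]))
  /\
  (is_nc_category NC_evenly_many_odd
   /\ generated_by [:: diag p_double_singleton; diag p_four] NC_evenly_many_odd
   /\ corresponds_to NC_evenly_many_odd (@magic_system' R[i]))
  /\
  (is_nc_category NC
   /\ generated_by [:: diag p_singleton; diag p_four] NC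
   /\ corresponds_to NC (@magic_system R[i]))
  /\
  (is_nc_category NC_alternating
   /\ generated_by [:: diag p_double_singleton] NC_alternating
   /\ corresponds_to NC_alternating (@bistochastic_sharp_system R[i]))
  /\
  (is_nc_category NC_even_singletons
   /\ generated_by [:: diag p_pos] NC_even_singletons
   /\ corresponds_to NC_even_singletons (@bistochastic_system' R[i]))
  /\
  (is_nc_category NC_one_two
   /\ generated_by [:: diag p_singleton] NC_one_two
   /\ corresponds_to NC_one_two (@bistochastic_system R[i])).
Proof.
have [? ?] := NC_pairs_category; have [? ?] := NC_even_category.
have [? ?] := NC_evenly_many_odd_category; have [? ?] := NC_category.
have [? ?] := NC_alternating_category; have [? ?] := NC_even_singletons_category.
have [? ?] := NC_one_two_category.
refine (conj (conj _ (conj _ (@NC_pairs_corresponds R)))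
  (conj (conj _ (conj _ (@NC_even_corresponds R)))
  (conj (conj _ (conj _ (@NC_evenly_many_odd_corresponds R)))
  (conj (conj _ (conj _ (@NC_corresponds R)))
  (conj (conj _ (conj _ (@NC_alternating_corresponds R)))
  (conj (conj _ (conj _ (@NC_even_singletons_corresponds R)))
  (conj _ (conj _ (@NC_one_two_corresponds R))))))))); assumption.
Qed.
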